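(* Let $a>0$, $b,c\in\mathbb R$, and let $\Pi$ be the parabola $y=\tfrac{a}{2}x^2+bx+c$. (1) Under the affine curve-shortening flow, $\Pi$ moves by vertical translation with constant velocity $a^{1/3}$; thus at time $T>0$ it is the parabola $\Pi^T\colon y=\tfrac a2x^2+bx+c+Ta^{1/3}$. (2) Fix $T>0$. For a positive integer $n$, apply $m=\lfloor c_{\mathrm g}Tn^{4/3}\rfloor$ steps of grid peeling to $\Pi$ with respect to the grid $\tfrac1n\mathbb Z^2$, where $$c_{\mathrm g}=\sqrt[3]{\frac{\pi^2}{2\zeta(3)}}\approx 1.6012.$$ Then, as $n\to\infty$, the vertical distance between the resulting grid polygon and $\Pi^T$ (the supremum over $x\in\mathbb R$ of the absolute difference of their $y$-values at abscissa $x$) is $$O\!\left(\frac{(Ta^{2/3}+a^{-2/3})\log\frac na}{n^{1/3}}\right).$$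
   Context: Affine curve-shortening flow (ACSF): a smooth curve evolves in time so that each point moves in the direction of the normal pointing to the concave side, with normal speed $\kappa^{1/3}$, where $\kappa$ is the current curvature at that point. Grid peeling with respect to a grid $G$ (here $G=\tfrac1n\mathbb Z^2$): one peeling step applied to a set $U\subseteq G$ removes from $U$ all vertices (extreme points) of the convex hull $\mathrm{conv}(U)$. Grid peeling of a convex curve that is the graph of a convex function starts from $U_0=$ the set of points of $G$ on or above the curve and sets $U_{k+1}=U_k\setminus\{\text{vertices of }\mathrm{conv}(U_k)\}$; the grid polygon after $m$ steps is the lower boundary of $\mathrm{conv}(U_m)$, viewed as the graph of a function of $x$. $\zeta$ is the Riemann zeta function. *)

(* Defs.v *)
From Stdlib Require Import Reals Lra ZArith.
From Coquelicot Require Import Coquelicot.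
Open Scope R_scope.

Definition cbrt (r : R) : R :=
  if Rlt_dec 0 r then Rpower r (1/3)
  else if Rlt_dec r 0 then - Rpower (- r) (1/3) else 0.

(* A time-dependent parametrized planar curve (t, p) |-> (gx t p, gy t p)
   evolves by ACSF at time t, parameter p:
   with x' = d gx/dp, y' = d gy/dp (and '' the second p-derivatives),
   unit normal nu = (-y', x')/|gamma'|, signed curvature
   ks = (x'y''-y'x'')/|gamma'|^3 (curvature vector = ks nu), the normal pointing
   to the concave side is sgn(ks) nu and the normal speed is |ks|^(1/3);
   i.e. <d gamma/dt, nu> = sgn(ks)|ks|^(1/3) = cbrt ks. *)
Definition acsf_at (gx gy : R -> R -> R) (t p : R) : Prop :=
  let x1 := fun q => Derive (fun r => gx t r) q in
  let y1 := fun q => Derive (fun r => gy t r) q in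
  ex_derive (fun s => gx s p) t /\ ex_derive (fun s => gy s p) t /\
  (forall q, ex_derive (fun r => gx t r) q) /\
  (forall q, ex_derive (fun r => gy t r) q) /\
  ex_derive x1 p /\ ex_derive y1 p /\
  let xp := x1 p in let yp := y1 p in
  let xpp := Derive x1 p in let ypp := Derive y1 p in
  let sp := sqrt (xp ^ 2 + yp ^ 2) in
  0 < sp /\
  (Derive (fun s => gx s p) t * (- yp / sp) + Derive (fun s => gy s p) t * (xp / sp)
   = cbrt ((xp * ypp - yp * xpp) / sp ^ 3)).

Definition is_acsf (gx gy : R -> R -> R) : Prop :=
  forall t p, 0 <= t -> acsf_at gx gy t p.

Definition parab (a b c : R) (x : R) : R := a / 2 * x ^ 2 + b * x + c.

Definition pt := (R * R)%type.

Definition comb (l : R) (P Q : pt) : pt :=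
  (l * fst P + (1 - l) * fst Q, l * snd P + (1 - l) * snd Q).

Definition convex_set (C : pt -> Prop) : Prop :=
  forall P Q l, C P -> C Q -> 0 <= l <= 1 -> C (comb l P Q).

Definition conv (U : pt -> Prop) : pt -> Prop :=
  fun P => forall C, convex_set C -> (forall Q, U Q -> C Q) -> C P.

Definition extreme (C : pt -> Prop) (P : pt) : Prop :=
  C P /\ forall Q1 Q2 l, C Q1 -> C Q2 -> 0 < l < 1 -> P = comb l Q1 Q2 -> Q1 = Q2.

Definition on_grid (n : nat) (P : pt) : Prop :=
  exists i j : Z, fst P = IZR i / INR n /\ snd P = IZR j / INR n.

Definition grid_above (n : nat) (f : R -> R) : pt -> Prop :=
  fun P => on_grid n P /\ f (fst P) <= snd P.

Definition peel (U : pt -> Prop) : pt -> Prop :=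
  fun P => U P /\ ~ extreme (conv U) P.

Definition peel_iter (m : nat) (U : pt -> Prop) : pt -> Prop := Nat.iter m peel U.

Definition lower_boundary (U : pt -> Prop) (x : R) : Rbar :=
  Glb_Rbar (fun y => conv U (x, y)).

Definition zeta3 : R := Series (fun k => / (INR (S k)) ^ 3).

Definition c_g : R := Rpower (PI ^ 2 / (2 * zeta3)) (1/3).

Definition nsteps (T : R) (n : nat) : nat :=
  Z.to_nat (Int_part (c_g * T * Rpower (INR n) (4/3))).

(* Main.v *)
(** In grid units, fix an odd [t] and call a primitive vector [(q, p)] admissible when
    [1 <= q <= t]; neighbouring admissible directions have determinant 1 (Farey).  Take
    the convex lattice polygon whose edge in each admissible direction [(q, p)] is
    [floor (t / q)] times that vector.  Under peeling, the vertex between neighbouring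
    directions [v], [w] with abscissas [q], [r] moves by [w], [-v] or [w - v], and its
    abscissa performs a three-interval exchange of a window of length [t]: it moves by
    [r], [- q] or [r - q], according to its position.  All vertices start at the centre
    of their windows, and then the two ends of every edge remain at mirror positions
    modulo [q]; hence they agree on when the supporting line of the edge advances, and
    the exchange describes the peeling exactly.  Each supporting line advances by
    [q] in [t] steps, so the polygon rises at speed [1 / t]; it stays within
    [O(t^2 log t)] of a parabola of curvature [1 / H], where
    [H = sum x / gcd(x, y) = 2 zeta(3) / pi^2 t^3 + O(t^2 log t)].
    Peeling is monotone, so a general parabola is squeezed between two such polygons,
    one slightly steeper and one slightly flatter, nearly touching it at the abscissa
    under consideration. *)

Require Import Defs.
From Stdlib Require Import Reals ZArith Lia Lra Psatz List Classical ClassicalEpsilon.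
From Coquelicot Require Import Coquelicot.
Open Scope Z_scope.

(** * Three-interval exchanges *)

(** Exact evolution is available only for one polygon per odd [t], and its inverse curvature is
    known only as t^3 / c_g^3 up to O(t^2 log t). Changing [t] by delta changes t^3 by about 3 t^2
    delta, so a shift of [t] by a multiple of log t makes the polygon provably steeper or flatter
    than the given parabola. The shift changes the speed 1/t by a relative amount log t / t, which
    yields the error term with T a^(2/3); the distance between polygon and parabola yields the term
    with a^(-2/3). Oddness of [t] gives the window 0, ..., t - 1 an integer centre, from which the
    mirror symmetry starts. The factors 1/gcd are removed by writing 1/g as the sum of c(d) over d |
    g with |c| <= 1: all sums become sums over full grids, where trivial bounds lose only a harmonic
    sum, the origin of the logarithm. The series of c(k)/k^2 has the value zeta(3)/zeta(2), so the
    pi^2 in c_g stems from zeta(2) = pi^2/6, which is proved here with a rate. *)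

Definition iet_step (t q r x : Z) : Z :=
  if x <? t - r then x + r else if x <? q then x + r - q else x - q.

Definition iet (t q r : Z) (k : nat) : Z := Nat.iter k (iet_step t q r) ((t - 1) / 2).

Definition fires_left (t q r : Z) (k : nat) : Z := if iet t q r k <? q then 1 else 0.
Definition fires_right (t q r : Z) (k : nat) : Z := if iet t q r k <? t - r then 0 else 1.

Fixpoint zsum (f : nat -> Z) (k : nat) : Z :=
  match k with O => 0 | S k' => zsum f k' + f k' end.

Lemma iet_S t q r k : iet t q r (S k) = iet_step t q r (iet t q r k).
Proof. reflexivity. Qed.

Lemma iet_range t q r k :
  1 <= q <= t -> 1 <= r <= t -> t < q + r -> 0 <= iet t q r k < t.
Proof.
  intros Hq Hr Hqr; induction k as [|k IH].
  - unfold iet; simpl. split; [apply Z.div_pos; lia | apply Z.div_lt_upper_bound; lia].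
  - rewrite iet_S; unfold iet_step.
    destruct (Z.ltb_spec (iet t q r k) (t - r)); [lia|].
    destruct (Z.ltb_spec (iet t q r k) q); lia.
Qed.

(** Every move is [r] times the left flag minus [q] times the right flag, because the middle
    interval [t - r <= x < q] raises both flags. Positions are thereby linear in the numbers of
    advances of the two lines. *)
Lemma iet_count t q r k :
  1 <= q <= t -> 1 <= r <= t -> t < q + r ->
  iet t q r k = (t - 1) / 2 + r * zsum (fires_left t q r) k
                - q * zsum (fires_right t q r) k.
Proof.
  intros Hq Hr Hqr; induction k as [|k IH].
  - unfold iet; simpl; lia.
  - rewrite iet_S; simpl. unfold iet_step, fires_left at 2, fires_right at 2.
    destruct (Z.ltb_spec (iet t q r k) (t - r)); destruct (Z.ltb_spec (iet t q r k) q); lia.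
Qed.

(** The intervals [0, q) and [t - r, t) cover the window since [t < q + r]. Geometrically, both
    neighbours of a resting edge advance. *)
Lemma fires_left_or_right t q r k :
  t < q + r -> fires_left t q r k = 1 \/ fires_right t q r k = 1.
Proof.
  intros H; unfold fires_left, fires_right.
  destruct (Z.ltb_spec (iet t q r k) (t - r)); destruct (Z.ltb_spec (iet t q r k) q); lia.
Qed.

(* The vertices at both ends of an edge sit at mirror positions of the residue
   class of their abscissas modulo [q], so both ends agree on when it fires. *)
Definition mirror (t q xl xr : Z) : Prop :=
  exists rho n i, 0 <= rho < q /\ rho + (n - 1) * q < t <= rho + n * q /\ 0 <= i <= n - 1 /\
    xl = rho + i * q /\ xr = rho + (n - 1 - i) * q.

Lemma mirror_center t q : t mod 2 = 1 -> 1 <= q <= t -> mirror t q ((t - 1) / 2) ((t - 1) / 2).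
Proof.
  intros Ht Hq.
  assert (E : t = 2 * ((t - 1) / 2) + 1).
  { pose proof (Z.div_mod t 2 ltac:(lia)).
    replace ((t - 1) / 2) with (t / 2); [lia|].
    symmetry; rewrite H at 1; rewrite Ht.
    replace (2 * (t / 2) + 1 - 1) with (t / 2 * 2) by ring. apply Z.div_mul; lia. }
  set (m := (t - 1) / 2) in *.
  pose proof (Z.div_mod m q ltac:(lia)) as D.
  pose proof (Z.mod_pos_bound m q ltac:(lia)) as B.
  assert (0 <= m / q) by (apply Z.div_pos; lia).
  set (i := m / q) in *; set (rho := m mod q) in *.
  (* The window is symmetric about [m], so the residue class of [m] has [i] members below it and [i]
     above it. *)
  exists rho, (2 * i + 1), i; repeat split; nia.
Qed.

(** The left condition says that [xl] is the last member of its residue class, the right one that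
    [xr] is the first; the mirror exchanges the two. *)
Lemma mirror_fires t q xl xr : 1 <= q <= t -> mirror t q xl xr -> (t - q <= xl <-> xr < q).
Proof.
  intros Hq (rho & n & i & Hr & Hn & Hi & El & Er).
  assert (i = n - 1 \/ i <= n - 2) as [E|E] by lia.
  - subst i. split; intros; nia.
  - assert (xl + q < t) by nia. assert (q <= xr) by nia. lia.
Qed.

Lemma mirror_step t q r' r xl xr :
  1 <= q <= t -> 1 <= r <= t -> 1 <= r' <= t -> t < q + r -> t < q + r' ->
  (q | r' + r) -> mirror t q xl xr ->
  mirror t q (iet_step t r' q xl) (iet_step t q r xr).
Proof.
  intros Hq Hr Hr' H1 H2 (j & Hj) Hm.
  pose proof (mirror_fires t q xl xr Hq Hm) as Hf.
  destruct Hm as (rho & n & i & Hrho & Hn & Hi & El & Er).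
  unfold iet_step.
  destruct (Z.ltb_spec xl (t - q)) as [C|C].
  (* The edge rests: its left end moves by [+ q] and its right end by [- q], inside the same residue
     class. *)
  - assert (q <= xr) by lia.
    assert (i <= n - 2).
    { assert (i = n - 1 \/ i <= n - 2) as [E|E] by lia; [|exact E]. subst i; nia. }
    destruct (Z.ltb_spec xr (t - r)); [lia|]. destruct (Z.ltb_spec xr q); [lia|].
    exists rho, n, (i + 1); repeat split; lia.
  (* The edge fires: both ends leave the class, the left one landing among the first [q] positions
     and the right one among the last [q]. As [q] divides [r' + r], they land in a common class, at
     its opposite extremes, so the new index is 0. *)
  - assert (C' : xr < q) by lia.
    set (yl := if xl <? r' then xl + q - r' else xl - r').
    set (yr := if xr <? t - r then xr + r else if xr <? q then xr + r - q else xr - q).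
    assert (Xl : 0 <= xl < t) by (split; nia).
    assert (Xr : 0 <= xr < t) by (split; nia).
    assert (Yl : 0 <= yl < q) by (unfold yl; destruct (Z.ltb_spec xl r'); lia).
    assert (Yr : t - q <= yr < t).
    { unfold yr; destruct (Z.ltb_spec xr (t - r)); [lia|]. destruct (Z.ltb_spec xr q); lia. }
    assert (exists d, yr - yl = d * q) as (d & Hd).
    { assert (exists a, yl = xl - r' + a * q) as (a & Ha).
      { unfold yl; destruct (xl <? r'); [exists 1 | exists 0]; lia. }
      assert (exists b, yr = xr + r + b * q) as (b & Hb).
      { unfold yr; destruct (Z.ltb_spec xr (t - r)); [exists 0; lia|].
        destruct (Z.ltb_spec xr q); [exists (-1); lia|lia]. }
      exists (n - 1 - i - i + j + b - a).
      rewrite Ha, Hb, El, Er. replace r with (j * q - r') by lia. ring. }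
    assert (0 <= d) by nia.
    exists yl, (d + 1), 0; repeat split; nia.
Qed.

Lemma iet_mirror t q r' r k :
  t mod 2 = 1 -> 1 <= q <= t -> 1 <= r <= t -> 1 <= r' <= t -> t < q + r -> t < q + r' ->
  (q | r' + r) -> mirror t q (iet t r' q k) (iet t q r k).
Proof.
  intros; induction k as [|k IH].
  - apply mirror_center; assumption.
  - rewrite !iet_S; apply mirror_step; auto.
Qed.

Lemma fires_agree t q r' r k :
  t mod 2 = 1 -> 1 <= q <= t -> 1 <= r <= t -> 1 <= r' <= t -> t < q + r -> t < q + r' ->
  (q | r' + r) -> fires_right t r' q k = fires_left t q r k.
Proof.
  intros H0 H1 H2 H3 H4 H5 H6.
  pose proof (mirror_fires t q _ _ H1 (iet_mirror t q r' r k H0 H1 H2 H3 H4 H5 H6)).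
  unfold fires_left, fires_right.
  destruct (Z.ltb_spec (iet t r' q k) (t - q)); destruct (Z.ltb_spec (iet t q r k) q); lia.
Qed.

(** Here [m] is the current multiplicity of the edge: the initial one, [t / q], plus the relative
    displacement n - 1 - 2i of the ends. The class has [t / q] or [t / q + 1] members, and firing
    means i = n - 1, which leaves at most one primitive segment. *)
Lemma edge_length_bounds t q xl xr m :
  1 <= q <= t -> mirror t q xl xr -> m * q = t / q * q + (xr - xl) ->
  0 <= m /\ (xr < q -> m <= 1).
Proof.
  intros Hq (rho & n & i & Hrho & Hn & Hi & El & Er) Hm.
  pose proof (Z.div_mod t q ltac:(lia)) as D.
  pose proof (Z.mod_pos_bound t q ltac:(lia)) as B.
  set (a := t / q) in *; set (b := t mod q) in *.
  assert (E : m = a + (n - 1 - i - i)) by nia.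
  assert (a <= n <= a + 1) by nia.
  split; [lia|]. intros C.
  assert (n - 1 - i = 0) by nia. lia.
Qed.

(** * Farey neighbours *)

Definition vec := (Z * Z)%type.

Definition det (v w : vec) : Z := fst v * snd w - snd v * fst w.

Definition farey (t : Z) (v : vec) : Prop :=
  1 <= fst v <= t /\ Z.gcd (fst v) (snd v) = 1.

(** The condition [t < fst v + fst w] excludes the mediant; together with determinant 1 it makes [v]
    and [w] consecutive by slope. *)
Definition adj (t : Z) (v w : vec) : Prop :=
  farey t v /\ farey t w /\ det v w = 1 /\ t < fst v + fst w.

Lemma gcd1_of_bezout a b x y : a * x + b * y = 1 -> Z.gcd a b = 1.
Proof.
  intros H. apply Z.bezout_1_gcd. exists x, y. lia.
Qed.

Lemma adj_right_exists t v : farey t v -> exists w, adj t v w.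
Proof.
  destruct v as [q p]; intros Hv; pose proof Hv as [Hq Hg]; simpl in *.
  destruct (Z.gcd_bezout q p 1 Hg) as (a & b & Hab).
  (* All solutions of [det v w = 1] are (nq - b, np + a); this [n] puts the abscissa into (t - q,
     t]. *)
  set (n := (t + b) / q).
  pose proof (Z.div_mod (t + b) q ltac:(lia)) as D.
  pose proof (Z.mod_pos_bound (t + b) q ltac:(lia)) as B. fold n in D.
  exists (n * q - b, n * p + a). unfold adj, det; simpl.
  assert (E : q * (n * p + a) - p * (n * q - b) = 1) by nia.
  split; [exact Hv|]. repeat split; simpl; try lia.
  apply (gcd1_of_bezout _ _ (- p) q); lia.
Qed.

Definition reflect (v : vec) : vec := (fst v, - snd v).

Lemma reflect_involutive v : reflect (reflect v) = v.
Proof. destruct v; unfold reflect; simpl; f_equal; lia. Qed.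

Lemma farey_reflect t v : farey t v -> farey t (reflect v).
Proof. intros [H1 H2]; split; simpl; [lia | rewrite Z.gcd_opp_r; exact H2]. Qed.

Lemma adj_reflect t v w : adj t v w -> adj t (reflect w) (reflect v).
Proof.
  intros (Hv & Hw & Hd & Hs).
  split; [apply farey_reflect, Hw|]. split; [apply farey_reflect, Hv|].
  unfold det, reflect in *; simpl; lia.
Qed.

Lemma adj_left_exists t v : farey t v -> exists u, adj t u v.
Proof.
  intros Hv. destruct (adj_right_exists t (reflect v) (farey_reflect t v Hv)) as (w & Hw).
  exists (reflect w). rewrite <- (reflect_involutive v). apply adj_reflect; exact Hw.
Qed.

Lemma farey_parallel t v w : farey t v -> farey t w -> det v w = 0 -> v = w.
Proof.
  destruct v as [q p], w as [r s]; unfold farey, det; simpl; intros [Hq Gq] [Hr Gr] D.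
  assert (D1 : (q | r)).
  { apply (Z.gauss q p r); [exists s; lia | exact Gq]. }
  assert (D2 : (r | q)).
  { apply (Z.gauss r s q); [exists p; lia | exact Gr]. }
  assert (E : q = r) by (apply Z.divide_antisym_nonneg; lia || assumption).
  subst r. f_equal. nia.
Qed.

(** The sum of the neighbours has determinant 0 with the primitive [v]. The multiplier [j] turns
    [j * h v - h u - h w] into the second difference of a support function [h], that is, into an
    edge length. *)
Lemma adj_sum t u v w : adj t u v -> adj t v w ->
  exists j, fst u + fst w = j * fst v /\ snd u + snd w = j * snd v.
Proof.
  destruct u as [r' s'], v as [q p], w as [r s]; unfold adj, farey, det; simpl.
  intros (_ & [Hq Gq] & D1 & _) (_ & _ & D2 & _).
  assert (H : q * (s' + s) = p * (r' + r)) by lia.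
  assert (D : (q | r' + r)).
  { apply (Z.gauss q p (r' + r)); [exists (s' + s); lia | exact Gq]. }
  destruct D as (j & Hj). exists j; split; [exact Hj|].
  rewrite Hj in H. nia.
Qed.

Lemma adj_right_unique t v w w' : adj t v w -> adj t v w' -> w = w'.
Proof.
  destruct v as [q p], w as [r s], w' as [r' s']; unfold adj, farey, det; simpl.
  intros ([Hq Gq] & [Hr _] & D1 & S1) (_ & [Hr' _] & D2 & S2).
  assert (H : q * (s - s') = p * (r - r')) by lia.
  assert (D : (q | r - r')).
  { apply (Z.gauss q p (r - r')); [exists (s - s'); lia | exact Gq]. }
  destruct D as (d & Hd).
  assert (d = 0) by nia. subst d.
  assert (r = r') by lia. subst r'. f_equal. nia.
Qed.

Lemma adj_left_unique t u u' v : adj t u v -> adj t u' v -> u = u'.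
Proof.
  intros H H'. apply adj_reflect in H; apply adj_reflect in H'.
  rewrite <- (reflect_involutive u), <- (reflect_involutive u').
  f_equal. eapply adj_right_unique; eauto.
Qed.

(** In the basis [v], [w] the vector [z] has coefficients [det z w] and [det v z]; if both are
    positive, its abscissa is at least [fst v + fst w > t]. *)
Lemma adj_gap t v w z : adj t v w -> fst z <= t -> 0 < det v z -> 0 < det z w -> False.
Proof.
  destruct v as [q p], w as [r s], z as [x y]; unfold adj, farey, det; simpl.
  intros ([Hq _] & [Hr _] & D & S) Hx A B.
  assert (E : x = (x * s - y * r) * q + (q * y - p * x) * r).
  { replace x with (x * (q * s - p * r)) at 1 by (rewrite D; ring). ring. }
  nia.
Qed.

(** Induction along consecutive directions. It terminates because consecutive slopes differ by at
    least 1/t^2. *)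
Lemma walk_right t (P : vec -> Prop) v : farey t v -> P v ->
  (forall a b, adj t a b -> 0 <= det v a -> P a -> P b) ->
  forall z, farey t z -> 0 <= det v z -> P z.
Proof.
  intros Hv Pv Hstep z Hz.
  (* The last hypothesis says that the slope gap from [a] to [z] is at most N/t^2; every step to the
     right neighbour consumes 1/t^2 of it. *)
  assert (G : forall N a, farey t a -> 0 <= det v a -> P a -> 0 <= det a z ->
            det a z * (t * t) <= Z.of_nat N * (fst a * fst z) -> P z).
  { induction N as [|N IH]; intros a Ha Hva Pa H0 HN.
    - assert (det a z = 0) by (destruct Ha as [? _]; destruct Hz as [? _]; nia).
      rewrite <- (farey_parallel t a z); assumption.
    - destruct (Z.eq_dec (det a z) 0) as [E|E].
      { rewrite <- (farey_parallel t a z); assumption. }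
      destruct (adj_right_exists t a Ha) as (b & Hb).
      pose proof Hb as (_ & Fb & Dab & Sab).
      assert (H1 : 0 <= det b z).
      { destruct (Z_lt_le_dec (det b z) 0) as [L|L]; [|exact L]. exfalso.
        apply (adj_gap t a b z Hb); [destruct Hz as [? _]; lia | lia |].
        unfold det in *; lia. }
      apply (IH b Fb).
      + destruct Hv as [Fv _], Ha as [Fa _], Fb as [Fb _].
        assert (fst a * det v b = fst b * det v a + fst v * det a b) by (unfold det; ring). nia.
      + eapply Hstep; eauto.
      + exact H1.
      + destruct Ha as [Ha _], Fb as [Fb _], Hz as [Hz _].
        assert (I : fst a * det b z = fst b * det a z - fst z * det a b) by (unfold det; ring).
        rewrite Dab in I.
        assert (I2 : fst a * (det b z * (t * t)) <= fst a * (Z.of_nat N * (fst b * fst z))).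
        { replace (fst a * (det b z * (t * t))) with ((fst b * det a z - fst z * 1) * (t * t))
            by (rewrite <- I; ring).
          assert (fst b * (det a z * (t * t)) <= fst b * (Z.of_nat (S N) * (fst a * fst z)))
            by (apply Z.mul_le_mono_nonneg_l; lia).
          assert (fst a * fst b <= t * t) by nia.
          assert (fst z * (fst a * fst b) <= fst z * (t * t)) by (apply Z.mul_le_mono_nonneg_l; lia).
          rewrite Nat2Z.inj_succ in *. nia. }
        apply Z.mul_le_mono_pos_l with (p := fst a); [lia | exact I2]. }
  intros H0.
  apply (G (Z.to_nat (det v z * (t * t))) v); auto.
  - unfold det; lia.
  - destruct Hv as [? _], Hz as [? _].
    assert (0 <= det v z * (t * t)) by nia.
    rewrite Z2Nat.id by assumption.
    assert (1 <= fst v * fst z) by nia. nia.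
Qed.

Lemma walk_left t (P : vec -> Prop) v : farey t v -> P v ->
  (forall a b, adj t a b -> 0 <= det b v -> P b -> P a) ->
  forall z, farey t z -> 0 <= det z v -> P z.
Proof.
  intros Hv Pv Hstep z Hz H0.
  rewrite <- (reflect_involutive z).
  apply (walk_right t (fun y => P (reflect y)) (reflect v)).
  - apply farey_reflect; exact Hv.
  - rewrite reflect_involutive; exact Pv.
  - intros a b Hab Hd Pa. apply adj_reflect in Hab.
    refine (Hstep _ _ Hab _ Pa). unfold det, reflect in *; simpl in *; lia.
  - apply farey_reflect; exact Hz.
  - unfold det, reflect in *; simpl in *; lia.
Qed.

(* [parab_chord D N] is [N psi(D/N)], where [psi] interpolates linearly, between
   consecutive integers, the values [i (i - 1) / 2] at [i]. *)
Definition parab_chord (D N : Z) : Z :=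
  let i := D / N in i * D - N * (i * (i + 1) / 2).

Lemma triangular i : 2 * (i * (i + 1) / 2) = i * (i + 1).
Proof.
  destruct (Z.Even_or_Odd i) as [[k E]|[k E]]; subst i.
  - replace (2 * k * (2 * k + 1)) with (k * (2 * k + 1) * 2) by ring.
    rewrite Z.div_mul; lia.
  - replace ((2 * k + 1) * (2 * k + 1 + 1)) with ((2 * k + 1) * (k + 1) * 2) by ring.
    rewrite Z.div_mul; lia.
Qed.

(** Adjacent linear pieces agree at their common integer, so the closed interval is allowed;
    neighbouring directions do land exactly on such break points. *)
Lemma parab_chord_eq D N i : 0 < N -> i * N <= D <= (i + 1) * N ->
  parab_chord D N = i * D - N * (i * (i + 1) / 2).
Proof.
  intros HN HD; unfold parab_chord.
  pose proof (Z.div_mod D N ltac:(lia)) as E.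
  pose proof (Z.mod_pos_bound D N HN) as B.
  assert (D / N = i \/ (D / N = i + 1 /\ D = (i + 1) * N)) as [H|[H H']] by nia.
  - rewrite H; reflexivity.
  - rewrite H. pose proof (triangular i); pose proof (triangular (i + 1)).
    assert (E2 : (i + 1) * (i + 1 + 1) / 2 = i * (i + 1) / 2 + (i + 1)) by lia.
    rewrite E2, H'. ring.
Qed.

(** [K z] is [fst z * x] times psi at the slope of [z] minus y/x: homogeneous in [z], and linear
    except across the rays through (x, y + ix). Crossing such a ray adds the determinant with it,
    which is 1 on the right neighbour. No such ray lies strictly between neighbours, so only a ray
    through [v] itself contributes. *)
Lemma parab_chord_kink t x y u v w j :
  1 <= x <= t -> Z.gcd x y = 1 -> adj t u v -> adj t v w ->
  fst u + fst w = j * fst v -> snd u + snd w = j * snd v ->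
  let K z := parab_chord (snd z * x - fst z * y) (fst z * x) in
  K u + K w - j * K v = if ((fst v =? x) && ((snd v - y) mod x =? 0))%bool then 1 else 0.
Proof.
  intros Hx Gx Huv Hvw E1 E2 K.
  destruct u as [r' s'], v as [q p], w as [r s].
  pose proof Huv as (Fu & Fv & Duv & Suv). pose proof Hvw as (_ & Fw & Dvw & Svw).
  assert (Hq : 1 <= q <= t) by (destruct Fv; assumption).
  assert (Hr' : 1 <= r' <= t) by (destruct Fu; assumption).
  assert (Hr : 1 <= r <= t) by (destruct Fw; assumption).
  unfold det in *; cbn [fst snd] in *.
  set (i := (p * x - q * y) / (q * x)).
  pose proof (Z.div_mod (p * x - q * y) (q * x) ltac:(nia)) as Dm.
  pose proof (Z.mod_pos_bound (p * x - q * y) (q * x) ltac:(nia)) as Bm.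
  fold i in Dm. set (rem := (p * x - q * y) mod (q * x)) in *.
  (* The direction (x, y0) is the last break ray whose slope does not exceed that of [v]. *)
  set (y0 := y + i * x).
  assert (A0 : 0 <= x * p - y0 * q < q * x) by (unfold y0; nia).
  assert (Gz : farey t (x, y0)).
  { split; cbn; [lia|]. unfold y0. rewrite Z.add_comm, Z.mul_comm.
    replace (x * i + y) with (y + i * x) by ring. rewrite Z.gcd_add_mult_diag_r. exact Gx. }
  assert (W1 : 0 < x * s - y0 * r).
  { assert (I : x = (x * s - y0 * r) * q + (q * y0 - p * x) * r).
    { replace x with (x * (q * s - p * r)) at 1 by (rewrite Dvw; ring). ring. }
    nia. }
  assert (W2 : x * s - y0 * r <= r * x).
  { destruct (Z_lt_le_dec (r * x) (x * s - y0 * r)) as [L|L]; [exfalso|exact L].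
    apply (adj_gap t (q, p) (r, s) (x, y0 + x) Hvw); unfold det; cbn; nia. }
  assert (U2 : x * s' - y0 * r' <= r' * x).
  { destruct (Z_lt_le_dec (r' * x) (x * s' - y0 * r')) as [L|L]; [exfalso|exact L].
    assert (q * (r' * x) < q * (x * s' - y0 * r')) by nia.
    assert (q * s' = p * r' - 1) by nia.
    nia. }
  assert (KV : K (q, p) = i * (p * x - q * y) - q * x * (i * (i + 1) / 2)).
  { unfold K; cbn. apply parab_chord_eq; [nia|]. unfold y0 in A0; nia. }
  assert (KW : K (r, s) = i * (s * x - r * y) - r * x * (i * (i + 1) / 2)).
  { unfold K; cbn. apply parab_chord_eq; [nia|]. unfold y0 in W1, W2; nia. }
  destruct (Z.eq_dec (x * p - y0 * q) 0) as [Z0|Z0].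
  - assert (EV : (x, y0) = (q, p)) by (apply (farey_parallel t); [exact Gz | exact Fv | unfold det; cbn; lia]).
    assert (x = q) by congruence. assert (y0 = p) by congruence. subst x.
    replace (q =? q) with true by (symmetry; apply Z.eqb_refl).
    replace ((p - y) mod q =? 0) with true.
    2:{ symmetry; apply Z.eqb_eq. replace (p - y) with (i * q) by (unfold y0 in *; lia).
        apply Z.mod_mul; lia. }
    cbn [andb].
    (* Here [v] is itself a break ray, so [u] belongs to the preceding linear piece. *)
    assert (KU : K (r', s') = (i - 1) * (s' * q - r' * y) - r' * q * ((i - 1) * (i - 1 + 1) / 2)).
    { unfold K; cbn. apply parab_chord_eq; [nia|]. unfold y0 in *; nia. }
    rewrite KU, KV, KW.
    pose proof (triangular i); pose proof (triangular (i - 1)).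
    assert (T : (i - 1) * (i - 1 + 1) / 2 = i * (i + 1) / 2 - i) by lia.
    rewrite T. set (T0 := i * (i + 1) / 2) in *.
    replace r with (j * q - r') by lia. replace s with (j * p - s') by lia.
    assert (p = y + i * q) by (unfold y0 in *; lia). nia.
  - assert (U1 : 0 <= x * s' - y0 * r').
    { destruct (Z_lt_le_dec (x * s' - y0 * r') 0) as [L|L]; [exfalso|exact L].
      apply (adj_gap t (r', s') (q, p) (x, y0) Huv); unfold det; cbn; nia. }
    assert (KU : K (r', s') = i * (s' * x - r' * y) - r' * x * (i * (i + 1) / 2)).
    { unfold K; cbn. apply parab_chord_eq; [nia|]. unfold y0 in U1, U2; nia. }
    rewrite KU, KV, KW.
    replace (((q =? x) && ((p - y) mod x =? 0))%bool) with false.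
    + replace r with (j * q - r') by lia. replace s with (j * p - s') by lia. ring.
    + symmetry. apply Bool.andb_false_iff.
      destruct (Z.eqb_spec q x) as [Eq|]; [right|left; reflexivity].
      apply Z.eqb_neq. intros M0. apply Z0. subst x.
      apply Z.mod_divide in M0; [|lia]. destruct M0 as (c & Hc).
      assert (0 <= c - i < 1) by (unfold y0 in A0; nia).
      unfold y0. assert (c = i) by lia. subst c. nia.
Qed.

(** * Support function of the polygon *)

Lemma zsum_ext (f g : nat -> Z) (n : nat) :
  (forall i, (i < n)%nat -> f i = g i) -> zsum f n = zsum g n.
Proof. intros H; induction n; simpl; [reflexivity|]. rewrite IHn, H; auto. Qed.

Lemma zsum_plus (f g : nat -> Z) (n : nat) : zsum (fun i => f i + g i) n = zsum f n + zsum g n.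
Proof. induction n; simpl; lia. Qed.

Lemma zsum_scal (c : Z) (f : nat -> Z) (n : nat) : zsum (fun i => c * f i) n = c * zsum f n.
Proof. induction n; simpl; lia. Qed.

Lemma zsum_zero (f : nat -> Z) (n : nat) : (forall i, (i < n)%nat -> f i = 0) -> zsum f n = 0.
Proof. intros H; induction n; simpl; [reflexivity|]. rewrite IHn, H; auto. Qed.

Lemma zsum_single (f : nat -> Z) (n i0 : nat) :
  (i0 < n)%nat -> (forall i, (i < n)%nat -> i <> i0 -> f i = 0) -> zsum f n = f i0.
Proof.
  induction n; intros Hi H; [lia|]. simpl.
  destruct (Nat.eq_dec i0 n) as [E|E].
  - subst. rewrite zsum_zero; [lia|]. intros; apply H; lia.
  - rewrite IHn, (H n); auto; lia.
Qed.

Lemma zsum_multiples (q : Z) (n : nat) : 0 < q ->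
  zsum (fun i => if Z.of_nat (S i) mod q =? 0 then 1 else 0) n = Z.of_nat n / q.
Proof.
  intros Hq; induction n as [|n IH]; [reflexivity|].
  cbn [zsum]. rewrite IH.
  pose proof (Z.div_mod (Z.of_nat n) q ltac:(lia)) as D1.
  pose proof (Z.mod_pos_bound (Z.of_nat n) q Hq) as B1.
  pose proof (Z.div_mod (Z.of_nat (S n)) q ltac:(lia)) as D2.
  pose proof (Z.mod_pos_bound (Z.of_nat (S n)) q Hq) as B2.
  destruct (Z.eqb_spec (Z.of_nat (S n) mod q) 0); nia.
Qed.

Definition prim_chord (v : vec) (x y : Z) : Z :=
  let g := Z.gcd x y in
  parab_chord (snd v * (x / g) - fst v * (y / g)) (fst v * (x / g)).

(* Every lattice vector [(x, y)] with [1 <= x <= t], modulo shears, contributes one copy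
   of its primitive vector to the edges; this gives the multiplicities [t / q]. *)
Definition support (t : Z) (v : vec) : Z :=
  - zsum (fun i => zsum (fun y => prim_chord v (Z.of_nat (S i)) (Z.of_nat y)) (S i)) (Z.to_nat t).

Lemma gcd_reduce x y : 0 < x ->
  0 < Z.gcd x y /\ x = Z.gcd x y * (x / Z.gcd x y) /\ y = Z.gcd x y * (y / Z.gcd x y) /\
  Z.gcd (x / Z.gcd x y) (y / Z.gcd x y) = 1.
Proof.
  intros Hx.
  assert (0 < Z.gcd x y).
  { pose proof (Z.gcd_nonneg x y). assert (Z.gcd x y <> 0) by (intros E; apply Z.gcd_eq_0_l in E; lia). lia. }
  split; [assumption|].
  split; [apply Z.div_exact; [lia|apply Z.mod_divide; [lia|apply Z.gcd_divide_l]]|].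
  split; [apply Z.div_exact; [lia|apply Z.mod_divide; [lia|apply Z.gcd_divide_r]]|].
  apply Z.gcd_div_gcd; lia.
Qed.

(** A kink at [v] needs (x, y) to be a multiple of [v] up to an integer shear. This requires [fst v]
    to divide [x], and then exactly one [y] in [0, x) qualifies: x / fst v times the residue of
    [snd v] modulo [fst v]. *)
Lemma prim_chord_kinks t u v w j x : 1 <= x <= t -> adj t u v -> adj t v w ->
  fst u + fst w = j * fst v -> snd u + snd w = j * snd v ->
  zsum (fun y => prim_chord u x (Z.of_nat y) + prim_chord w x (Z.of_nat y)
                 - j * prim_chord v x (Z.of_nat y)) (Z.to_nat x)
  = if x mod fst v =? 0 then 1 else 0.
Proof.
  intros Hx Huv Hvw E1 E2.
  set (ind := fun y => if ((fst v =? x / Z.gcd x y)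
      && ((snd v - y / Z.gcd x y) mod (x / Z.gcd x y) =? 0))%bool then 1 else 0).
  rewrite (zsum_ext _ (fun y => ind (Z.of_nat y))).
  2:{ intros y Hy. unfold prim_chord, ind.
      destruct (gcd_reduce x (Z.of_nat y) ltac:(lia)) as (G0 & G1 & G2 & G3).
      apply (parab_chord_kink t); auto. nia. }
  destruct v as [q p]; cbn [fst snd] in *.
  pose proof Huv as (_ & [Hq Gq] & _); cbn [fst snd] in *.
  pose proof (Z.mod_pos_bound p q ltac:(lia)) as Bp.
  pose proof (Z.div_mod p q ltac:(lia)) as Dp.
  destruct (Z.eqb_spec (x mod q) 0) as [D|D].
  - apply Z.mod_divide in D; [|lia]. destruct D as (k & Hk).
    assert (0 < k) by nia.
    assert (Gp : Z.gcd q (p mod q) = 1) by (rewrite Z.gcd_comm, Z.gcd_mod, Z.gcd_comm by lia; rewrite Z.gcd_comm; exact Gq).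
    rewrite (zsum_single _ _ (Z.to_nat (k * (p mod q)))).
    + rewrite Z2Nat.id by nia. unfold ind. subst x. rewrite (Z.mul_comm k q).
      rewrite (Z.mul_comm k (p mod q)). rewrite Z.gcd_mul_mono_r, Gp.
      rewrite Z.abs_eq by lia. rewrite Z.mul_1_l, !Z.div_mul by lia.
      rewrite Z.eqb_refl. replace (p - p mod q) with (p / q * q) by lia.
      rewrite Z.mod_mul by lia. reflexivity.
    + apply Z2Nat.inj_lt; nia.
    + intros y Hy Hne. unfold ind.
      destruct (Z.eqb_spec q (x / Z.gcd x (Z.of_nat y))) as [Eq|]; [|reflexivity].
      destruct (gcd_reduce x (Z.of_nat y) ltac:(lia)) as (G0 & G1 & G2 & G3).
      rewrite <- Eq in *. set (g := Z.gcd x (Z.of_nat y)) in *. set (y' := Z.of_nat y / g) in *.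
      destruct (Z.eqb_spec ((p - y') mod q) 0) as [M|]; [exfalso|reflexivity].
      apply Z.mod_divide in M; [|lia]. destruct M as (c & Hc).
      assert (0 <= y') by (apply Z.div_pos; lia).
      assert (y' < q) by nia.
      assert (y' = p mod q) by (apply (Z.mod_unique_pos p q c); lia).
      assert (g = k) by nia. apply Hne. rewrite <- (Nat2Z.id y), G2. f_equal. nia.
  - apply zsum_zero. intros y Hy. unfold ind.
    destruct (Z.eqb_spec q (x / Z.gcd x (Z.of_nat y))) as [Eq|]; [exfalso|reflexivity].
    destruct (gcd_reduce x (Z.of_nat y) ltac:(lia)) as (G0 & G1 & G2 & G3).
    apply D. rewrite G1, <- Eq. apply Z.mod_mul; lia.
Qed.

(** The second difference counts the multiples of [fst v] up to [t]: the initial edge consists of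
    that many primitive segments. *)
Lemma support_kink t u v w j : adj t u v -> adj t v w ->
  fst u + fst w = j * fst v -> snd u + snd w = j * snd v ->
  j * support t v - support t u - support t w = t / fst v.
Proof.
  intros Huv Hvw E1 E2.
  assert (Ht : 1 <= fst v <= t) by (destruct Huv as (_ & [? _] & _); assumption).
  unfold support.
  set (S := fun z i => zsum (fun y => prim_chord z (Z.of_nat (S i)) (Z.of_nat y)) (Datatypes.S i)).
  change (j * - zsum (S v) (Z.to_nat t) - - zsum (S u) (Z.to_nat t) - - zsum (S w) (Z.to_nat t)
          = t / fst v).
  transitivity (zsum (fun i => S u i + S w i + (- j) * S v i) (Z.to_nat t)).
  { rewrite !zsum_plus, zsum_scal. lia. }
  rewrite <- (Z2Nat.id t) at 2 by lia.
  rewrite <- (zsum_multiples (fst v) (Z.to_nat t)) by lia.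
  apply zsum_ext. intros i Hi.
  rewrite <- (prim_chord_kinks t u v w j (Z.of_nat (Datatypes.S i))); auto; [|lia].
  rewrite Nat2Z.id. unfold S. rewrite <- zsum_scal, <- !zsum_plus.
  apply zsum_ext. intros; ring.
Qed.

(** * Exact evolution under peeling *)

Definition right_nbr (t : Z) (v : vec) : vec := epsilon (inhabits (0, 0)) (adj t v).

(** The decision is read off at the right end of the edge; [fires_left_adj] shows that the left end
    decides alike, by the mirror symmetry. *)
Definition fires (t : Z) (v : vec) : nat -> Z := fires_left t (fst v) (fst (right_nbr t v)).

Definition height (t : Z) (v : vec) (k : nat) : Z := support t v + zsum (fires t v) k.

Lemma fires_right_adj t v w k : adj t v w -> fires t v k = fires_left t (fst v) (fst w) k.
Proof.
  intros H. unfold fires.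
  assert (E : adj t v (right_nbr t v)) by (unfold right_nbr; apply epsilon_spec; exists w; exact H).
  rewrite (adj_right_unique t v _ _ E H). reflexivity.
Qed.

Lemma fires_left_adj t u v k : t mod 2 = 1 -> adj t u v ->
  fires t v k = fires_right t (fst u) (fst v) k.
Proof.
  intros Ht Huv.
  pose proof Huv as (Fu & Fv & _ & S1).
  destruct (adj_right_exists t v Fv) as (w & Hvw).
  pose proof Hvw as (_ & Fw & _ & S2).
  rewrite (fires_right_adj t v w k Hvw).
  destruct (adj_sum t u v w Huv Hvw) as (j & Hj & _).
  destruct Fu, Fv, Fw.
  symmetry; apply fires_agree; auto; try lia. exists j; exact Hj.
Qed.

Lemma fires_adj t v w k : t mod 2 = 1 -> adj t v w -> fires t v k = 1 \/ fires t w k = 1.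
Proof.
  intros Ht H. rewrite (fires_right_adj t v w k H), (fires_left_adj t v w k Ht H).
  apply fires_left_or_right. apply H.
Qed.

Lemma fires_01 t v k : fires t v k = 0 \/ fires t v k = 1.
Proof. unfold fires, fires_left. destruct (_ <? _); auto. Qed.

Lemma height_S t v k : height t v (S k) = height t v k + fires t v k.
Proof. unfold height; cbn; lia. Qed.

(** Since [det v w = 1], the lines of [v] and [w] meet at abscissa
    [fst w * height v - fst v * height w]. The exchange position is thus the displacement of this
    vertex, measured from the window centre. *)
Lemma iet_adj t v w k : t mod 2 = 1 -> adj t v w ->
  iet t (fst v) (fst w) k =
  (t - 1) / 2 + fst w * zsum (fires t v) k - fst v * zsum (fires t w) k.
Proof.
  intros Ht H. pose proof H as ([Hv _] & [Hw _] & _ & S).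
  rewrite iet_count by lia.
  rewrite (zsum_ext (fires t v) (fires_left t (fst v) (fst w)))
    by (intros; apply fires_right_adj; exact H).
  rewrite (zsum_ext (fires t w) (fires_right t (fst v) (fst w)))
    by (intros; apply fires_left_adj; assumption).
  reflexivity.
Qed.

Lemma edge_length t u v w j k : t mod 2 = 1 -> adj t u v -> adj t v w ->
  fst u + fst w = j * fst v -> snd u + snd w = j * snd v ->
  let m := j * height t v k - height t u k - height t w k in
  0 <= m /\ (fires t v k = 1 -> m <= 1).
Proof.
  intros Ht Huv Hvw E1 E2 m.
  pose proof Huv as ([Fu _] & [Fv _] & _ & S1). pose proof Hvw as (_ & [Fw _] & _ & S2).
  (* The horizontal extent of the edge is its initial extent plus the difference of the
     displacements of its two ends. *)
  assert (Hm : m * fst v = t / fst v * fst v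
               + (iet t (fst v) (fst w) k - iet t (fst u) (fst v) k)).
  { rewrite (iet_adj t v w k Ht Hvw), (iet_adj t u v k Ht Huv).
    rewrite <- (support_kink t u v w j Huv Hvw E1 E2).
    unfold m, height.
    replace (fst w) with (j * fst v - fst u) by lia. ring. }
  assert (D : (fst v | fst u + fst w)) by (exists j; exact E1).
  destruct (edge_length_bounds t (fst v) _ _ m Fv
    (iet_mirror t (fst v) (fst u) (fst w) k Ht Fv Fw Fu S2 ltac:(lia) D) Hm) as [A B].
  split; [exact A|]. intros F. apply B.
  rewrite (fires_right_adj t v w k Hvw) in F. unfold fires_left in F.
  destruct (Z.ltb_spec (iet t (fst v) (fst w) k) (fst v)); lia.
Qed.

Definition above (t : Z) (k : nat) (X Y : Z) : Prop :=
  forall v, farey t v -> height t v k <= fst v * Y - snd v * X.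

(** Nonnegative edge lengths make the slack [d] convex along the Farey order, so a slack vanishing
    at two neighbours is nonnegative everywhere. *)
Lemma vertex_above t v w k X Y : t mod 2 = 1 -> adj t v w ->
  fst v * Y - snd v * X = height t v k -> fst w * Y - snd w * X = height t w k ->
  above t k X Y.
Proof.
  intros Ht Hvw Ev Ew z Fz.
  set (d := fun z : vec => fst z * Y - snd z * X - height t z k).
  assert (Dv : d v = 0) by (unfold d; lia).
  assert (Dw : d w = 0) by (unfold d; lia).
  enough (0 <= d z) by (unfold d in *; lia).
  assert (Hd : forall a b c j, adj t a b -> adj t b c -> fst a + fst c = j * fst b ->
            snd a + snd c = j * snd b -> j * d b <= d a + d c).
  { intros a b c j Hab Hbc E1 E2.
    destruct (edge_length t a b c j k Ht Hab Hbc E1 E2) as [A _]. unfold d.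
    replace (fst c) with (j * fst b - fst a) by lia.
    replace (snd c) with (j * snd b - snd a) by lia. lia. }
  pose proof Hvw as (Fv & Fw & D & S).
  destruct (Z_lt_le_dec (det w z) 0) as [L|L].
  - assert (L' : 0 <= det z v).
    { destruct (Z_lt_le_dec (det z v) 0) as [N|N]; [exfalso|exact N].
      apply (adj_gap t v w z Hvw); [apply Fz| |]; unfold det in *; lia. }
    (* The invariant carries, with denominators cleared, that the vertical slack [d z / fst z] does
       not decrease when moving away from the vertex. *)
    apply (walk_left t (fun z => 0 <= d z /\ forall b, adj t z b -> d b * fst z <= d z * fst b) v);
      auto.
    + split; [lia|]. intros b Hb. rewrite (adj_right_unique t v b w Hb Hvw), Dv, Dw; lia.
    + intros a b Hab _ [P1 P2].
      pose proof Hab as ([Fa _] & Fb & _ & _).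
      destruct (adj_right_exists t b Fb) as (c & Hbc).
      destruct (adj_sum t a b c Hab Hbc) as (j & E1 & E2).
      specialize (P2 c Hbc). pose proof (Hd a b c j Hab Hbc E1 E2) as Q.
      destruct Fb as [Fb _]. pose proof Hbc as (_ & [Fc _] & _).
      assert (G : d b * fst a <= d a * fst b).
      { replace (fst a) with (j * fst b - fst c) by lia. nia. }
      split; [nia|]. intros b' Hb'. rewrite (adj_right_unique t a b' b Hb' Hab). exact G.
  - apply (walk_right t (fun z => 0 <= d z /\ forall a, adj t a z -> d a * fst z <= d z * fst a) w);
      auto.
    + split; [lia|]. intros b Hb. rewrite (adj_left_unique t b v w Hb Hvw), Dv, Dw; lia.
    + intros b c Hbc _ [P1 P2].
      pose proof Hbc as (Fb & [Fc _] & _ & _).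
      destruct (adj_left_exists t b Fb) as (a & Hab).
      destruct (adj_sum t a b c Hab Hbc) as (j & E1 & E2).
      specialize (P2 a Hab). pose proof (Hd a b c j Hab Hbc E1 E2) as Q.
      destruct Fb as [Fb _]. pose proof Hab as ([Fa _] & _).
      assert (G : d b * fst c <= d c * fst b).
      { replace (fst c) with (j * fst b - fst a) by lia. nia. }
      split; [nia|]. intros b' Hb'. rewrite (adj_left_unique t b' b c Hb' Hbc). exact G.
Qed.

Lemma nat_measure_min (A : Type) (P : A -> Prop) (f : A -> nat) a0 : P a0 ->
  exists a, P a /\ forall b, P b -> (f a <= f b)%nat.
Proof.
  intros H0. remember (f a0) as n eqn:E.
  revert a0 H0 E. induction n as [n IH] using lt_wf_ind. intros a0 H0 E.
  destruct (classic (exists b, P b /\ (f b < n)%nat)) as [(b & Hb & Lb)|N].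
  - apply (IH (f b) Lb b Hb eq_refl).
  - exists a0; split; [exact H0|]. intros b Hb. subst n.
    apply not_lt. intros L. apply N. exists b; split; [exact Hb | lia].
Qed.

Lemma divide_fact (n k : nat) : (1 <= k <= n)%nat -> (Z.of_nat k | Z.of_nat (fact n)).
Proof.
  induction n as [|n IH]; intros H; [lia|].
  cbn [fact].
  destruct (Nat.eq_dec k (S n)) as [E|E].
  - subst k. exists (Z.of_nat (fact n)). rewrite <- Nat2Z.inj_mul. f_equal. cbn [Nat.mul]. lia.
  - destruct (IH ltac:(lia)) as (c & Hc). exists (c * Z.of_nat (S n)).
    replace (fact n + n * fact n)%nat with (S n * fact n)%nat by (cbn; lia).
    rewrite Nat2Z.inj_mul, Hc. ring.
Qed.

(* The vertical distances to the supporting lines lie in [Z / t!], hence have a minimum. *)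
Lemma lowest_edge t k X Y : 1 <= t -> above t k X Y ->
  exists u v w, adj t u v /\ adj t v w /\
    let d z := fst z * Y - snd z * X - height t z k in
    0 <= d v /\ d v * fst u <= d u * fst v /\ d v * fst w <= d w * fst v.
Proof.
  intros Ht HA.
  set (d := fun z : vec => fst z * Y - snd z * X - height t z k).
  set (F := Z.of_nat (fact (Z.to_nat t))).
  assert (HF : 0 < F) by (unfold F; pose proof (lt_O_fact (Z.to_nat t)); lia).
  assert (DF : forall z, farey t z -> exists c, F = c * fst z /\ 0 < c).
  { intros z [Hz _]. destruct (divide_fact (Z.to_nat t) (Z.to_nat (fst z))) as (c & Hc); [lia|].
    rewrite Z2Nat.id in Hc by lia. exists c. unfold F. split; [exact Hc|]. fold F in Hc. nia. }
  assert (F10 : farey t (1, 0)) by (split; cbn; [lia|reflexivity]).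
  destruct (nat_measure_min vec (farey t) (fun z => Z.to_nat (F / fst z * d z)) (1, 0) F10)
    as (v & Fv & Hmin).
  assert (Hd : forall z, farey t z -> 0 <= d z) by (intros z Hz; specialize (HA z Hz); unfold d; lia).
  assert (Hcmp : forall z, farey t z -> d v * fst z <= d z * fst v).
  { intros z Fz. specialize (Hmin z Fz).
    destruct (DF v Fv) as (c & Hc & Pc). destruct (DF z Fz) as (e & He & Pe).
    pose proof (Hd v Fv). pose proof (Hd z Fz).
    destruct Fv as [Fv _], Fz as [Fz _].
    assert (C1 : F / fst v = c) by (rewrite Hc; apply Z.div_mul; lia).
    assert (C2 : F / fst z = e) by (rewrite He; apply Z.div_mul; lia).
    cbv beta in Hmin. rewrite C1, C2 in Hmin.
    assert (G : c * d v <= e * d z) by (apply Z2Nat.inj_le; nia).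
    assert (c * fst v = e * fst z) by lia.
    assert (c * (d v * fst z) <= c * (d z * fst v)) by nia.
    nia. }
  destruct (adj_left_exists t v Fv) as (u & Huv).
  destruct (adj_right_exists t v Fv) as (w & Hvw).
  exists u, v, w. split; [exact Huv|]. split; [exact Hvw|].
  cbv beta zeta. fold (d v) (d u) (d w).
  split; [apply Hd, Fv|]. split; apply Hcmp; [apply Huv | apply Hvw].
Qed.

Close Scope Z_scope.
Open Scope R_scope.

Definition level (t : Z) (k : nat) : pt -> Prop :=
  fun P => exists X Y : Z, fst P = IZR X /\ snd P = IZR Y /\ above t k X Y.

Lemma conv_incl (U : pt -> Prop) P : U P -> conv U P.
Proof. intros H C _ HC; auto. Qed.

Lemma conv_convex (U : pt -> Prop) : convex_set (conv U).
Proof. intros P Q l HP HQ Hl C HC HU. apply HC; [apply HP | apply HQ |]; auto. Qed.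

Lemma halfplane_convex (a b c : R) : convex_set (fun P => c <= a * snd P + b * fst P).
Proof.
  intros P Q l HP HQ Hl. unfold comb; simpl.
  replace (a * (l * snd P + (1 - l) * snd Q) + b * (l * fst P + (1 - l) * fst Q))
    with (l * (a * snd P + b * fst P) + (1 - l) * (a * snd Q + b * fst Q)) by ring.
  nra.
Qed.

Lemma conv_level_above t k v P : farey t v -> conv (level t k) P ->
  IZR (height t v k) <= IZR (fst v) * snd P - IZR (snd v) * fst P.
Proof.
  intros Fv HP.
  pose proof (HP _ (halfplane_convex (IZR (fst v)) (- IZR (snd v)) (IZR (height t v k)))) as H.
  cbv beta in H.
  enough (IZR (height t v k) <= IZR (fst v) * snd P + - IZR (snd v) * fst P) by lra.
  apply H. intros Q (X & Y & EX & EY & HA). rewrite EX, EY.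
  specialize (HA v Fv). apply IZR_le in HA. rewrite minus_IZR, !mult_IZR in HA. lra.
Qed.

Lemma comb_extremal (a b c l p q : R) : 0 < l < 1 ->
  c <= p -> c <= q -> c = l * p + (1 - l) * q -> p = c /\ q = c.
Proof. intros. split; nra. Qed.

(* A firing row contains at most two lattice points, and both are end points of the face. *)
Lemma extreme_of_firing t k X Y v : (t mod 2 = 1)%Z ->
  above t k X Y -> farey t v -> fires t v k = 1%Z ->
  (fst v * Y - snd v * X = height t v k)%Z -> extreme (conv (level t k)) (IZR X, IZR Y).
Proof.
  intros Ht HA Fv Hf Ev.
  destruct (adj_left_exists t v Fv) as (u & Huv).
  destruct (adj_right_exists t v Fv) as (w & Hvw).
  destruct (adj_sum t u v w Huv Hvw) as (j & E1 & E2).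
  destruct (edge_length t u v w j k Ht Huv Hvw E1 E2) as [M0 M1]. specialize (M1 Hf).
  pose proof Huv as (Fu & _ & D1 & _). pose proof Hvw as (_ & Fw & D2 & _).
  split.
  { apply conv_incl. exists X, Y. auto. }
  intros Q1 Q2 l C1 C2 Hl EP.
  assert (EX : IZR X = l * fst Q1 + (1 - l) * fst Q2) by (injection EP; auto).
  assert (EY : IZR Y = l * snd Q1 + (1 - l) * snd Q2) by (injection EP; auto).
  assert (LIN : forall z, IZR (fst z * Y - snd z * X)
     = l * (IZR (fst z) * snd Q1 - IZR (snd z) * fst Q1)
       + (1 - l) * (IZR (fst z) * snd Q2 - IZR (snd z) * fst Q2)).
  { intros z. rewrite minus_IZR, !mult_IZR, EX, EY. ring. }
  assert (TIGHT : forall z, farey t z -> (fst z * Y - snd z * X = height t z k)%Z ->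
     IZR (fst z) * snd Q1 - IZR (snd z) * fst Q1 = IZR (height t z k) /\
     IZR (fst z) * snd Q2 - IZR (snd z) * fst Q2 = IZR (height t z k)).
  { intros z Fz Ez. apply (comb_extremal 0 0 _ l); auto.
    - apply conv_level_above; assumption.
    - apply conv_level_above; assumption.
    - rewrite <- Ez. apply LIN. }
  destruct (TIGHT v Fv Ev) as [V1 V2].
  (* On the line of [v], the slacks towards [u] and [w] are nonnegative integers whose sum is the
     edge length, at most 1. One of them vanishes, and two tight unimodular lines determine [Q1] and
     [Q2]. *)
  assert (exists z, farey t z /\ (det v z = 1 \/ det v z = -1)%Z /\
            (fst z * Y - snd z * X = height t z k)%Z) as (z & Fz & Dz & Ez).
  { pose proof (HA u Fu) as A1. pose proof (HA w Fw) as A2.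
    assert ((fst u * Y - snd u * X = height t u k)%Z \/ (fst w * Y - snd w * X = height t w k)%Z)
      as [E|E].
    { assert ((fst u * Y - snd u * X) + (fst w * Y - snd w * X) = j * height t v k)%Z.
      { rewrite <- Ev. replace (fst w) with (j * fst v - fst u)%Z by lia.
        replace (snd w) with (j * snd v - snd u)%Z by lia. ring. }
      lia. }
    - exists u. split; [exact Fu|]. split; [right; unfold det in *; lia | exact E].
    - exists w. split; [exact Fw|]. split; [left; exact D2 | exact E]. }
  destruct (TIGHT z Fz Ez) as [Z1 Z2].
  assert (DR : IZR (fst v) * IZR (snd z) - IZR (snd v) * IZR (fst z) = 1 \/
               IZR (fst v) * IZR (snd z) - IZR (snd v) * IZR (fst z) = -1).
  { unfold det in Dz. rewrite <- !mult_IZR, <- minus_IZR.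
    destruct Dz as [-> | ->]; [left|right]; reflexivity. }
  destruct Q1 as [x1 y1], Q2 as [x2 y2]; simpl in *.
  set (a := IZR (fst v)) in *; set (b := IZR (snd v)) in *;
  set (c := IZR (fst z)) in *; set (e := IZR (snd z)) in *.
  assert (A1 : a * (y1 - y2) - b * (x1 - x2) = 0) by lra.
  assert (A2 : c * (y1 - y2) - e * (x1 - x2) = 0) by lra.
  assert (B1 : (a * e - b * c) * (y1 - y2) = 0).
  { replace ((a * e - b * c) * (y1 - y2))
      with (e * (a * (y1 - y2) - b * (x1 - x2)) - b * (c * (y1 - y2) - e * (x1 - x2))) by ring.
    rewrite A1, A2; ring. }
  assert (B2 : (a * e - b * c) * (x1 - x2) = 0).
  { replace ((a * e - b * c) * (x1 - x2))
      with (c * (a * (y1 - y2) - b * (x1 - x2)) - a * (c * (y1 - y2) - e * (x1 - x2))) by ring.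
    rewrite A1, A2; ring. }
  f_equal; destruct DR as [DR|DR]; rewrite DR in *; lra.
Qed.

Lemma not_extreme_strict t k P Q1 Q2 l : conv (level t k) Q1 -> conv (level t k) Q2 ->
  0 < l < 1 -> P = comb l Q1 Q2 -> Q1 <> Q2 -> ~ extreme (conv (level t k)) P.
Proof. intros H1 H2 Hl E N [_ H]. apply N, (H Q1 Q2 l); assumption. Qed.

Lemma level_up t k X Y c : (1 <= t)%Z -> (0 <= c)%Z -> above t k X Y -> above t k X (Y + c).
Proof. intros Ht Hc H v Fv. specialize (H v Fv). destruct Fv as [Fv _]. nia. Qed.

(** Let [v] minimise the vertical slack, so that the point lies over the edge of [v]. Either it lies
    on that edge, which then rests while both neighbours fire, and it is interior to the edge; or it
    is interior to the vertical segment from the edge to the grid point one unit above it. *)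
Lemma not_extreme_of_next t k X Y : (1 <= t)%Z -> (t mod 2 = 1)%Z ->
  above t (S k) X Y -> ~ extreme (conv (level t k)) (IZR X, IZR Y).
Proof.
  intros Ht1 Ht HS.
  assert (HA : above t k X Y).
  { intros v Fv. specialize (HS v Fv). rewrite height_S in HS.
    destruct (fires_01 t v k); lia. }
  destruct (lowest_edge t k X Y Ht1 HA) as (u & v & w & Huv & Hvw & Hd).
  set (d := fun z : vec => (fst z * Y - snd z * X - height t z k)%Z) in Hd.
  destruct Hd as (D0 & D1 & D2).
  change (0 <= d v)%Z in D0. change (d v * fst u <= d u * fst v)%Z in D1.
  change (d v * fst w <= d w * fst v)%Z in D2.
  pose proof Huv as (Fu & Fv & Euv & _). pose proof Hvw as (_ & Fw & Evw & _).
  (* This is the vertex where the lines of [v] and [w] meet; it is a lattice point by unimodularity.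
     [HVl] treats the other end. *)
  assert (HVr : above t k (X + d w * fst v - d v * fst w) (Y + d w * snd v - d v * snd w)).
  { apply (vertex_above t v w k); auto.
    - transitivity (fst v * Y - snd v * X - d v * det v w)%Z; [unfold det; ring|].
      rewrite Evw; unfold d; ring.
    - transitivity (fst w * Y - snd w * X - d w * det v w)%Z; [unfold det; ring|].
      rewrite Evw; unfold d; ring. }
  assert (HVl : above t k (X - d u * fst v + d v * fst u) (Y - d u * snd v + d v * snd u)).
  { apply (vertex_above t u v k); auto.
    - transitivity (fst u * Y - snd u * X - d u * det u v)%Z; [unfold det; ring|].
      rewrite Euv; unfold d; ring.
    - transitivity (fst v * Y - snd v * X - d v * det u v)%Z; [unfold det; ring|].
      rewrite Euv; unfold d; ring. }
  (* [xr] and [xl] are the horizontal distances from the point to the two ends of the edge;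
     minimality of the slack of [v] makes them nonnegative. *)
  set (xr := (d w * fst v - d v * fst w)%Z) in *.
  set (xl := (d u * fst v - d v * fst u)%Z) in *.
  set (Vr := (IZR (X + d w * fst v - d v * fst w), IZR (Y + d w * snd v - d v * snd w)) : pt).
  set (Vl := (IZR (X - d u * fst v + d v * fst u), IZR (Y - d u * snd v + d v * snd u)) : pt).
  assert (CVr : conv (level t k) Vr)
    by (apply conv_incl; exists (X + d w * fst v - d v * fst w)%Z, (Y + d w * snd v - d v * snd w)%Z; auto).
  assert (CVl : conv (level t k) Vl)
    by (apply conv_incl; exists (X - d u * fst v + d v * fst u)%Z, (Y - d u * snd v + d v * snd u)%Z; auto).
  assert (CP1 : conv (level t k) (IZR X, IZR (Y + 1)))
    by (apply conv_incl; exists X, (Y + 1)%Z; repeat split; apply level_up; auto; lia).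
  destruct Fv as [Fv Gv].
  assert (0 <= xr)%Z by (apply Zle_minus_le_0; exact D2).
  assert (0 <= xl)%Z by (apply Zle_minus_le_0; exact D1).
  assert (EVr : Vr = (IZR X + IZR (d w) * IZR (fst v) - IZR (d v) * IZR (fst w),
                      IZR Y + IZR (d w) * IZR (snd v) - IZR (d v) * IZR (snd w)))
    by (unfold Vr; rewrite !minus_IZR, !plus_IZR, !mult_IZR; reflexivity).
  assert (EVl : Vl = (IZR X - IZR (d u) * IZR (fst v) + IZR (d v) * IZR (fst u),
                      IZR Y - IZR (d u) * IZR (snd v) + IZR (d v) * IZR (snd u)))
    by (unfold Vl; rewrite !plus_IZR, !minus_IZR, !mult_IZR; reflexivity).
  assert (Exr : IZR xr = IZR (d w) * IZR (fst v) - IZR (d v) * IZR (fst w))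
    by (unfold xr; rewrite minus_IZR, !mult_IZR; reflexivity).
  assert (Exl : IZR xl = IZR (d u) * IZR (fst v) - IZR (d v) * IZR (fst u))
    by (unfold xl; rewrite minus_IZR, !mult_IZR; reflexivity).
  assert (Duv : IZR (fst u) * IZR (snd v) - IZR (snd u) * IZR (fst v) = 1)
    by (rewrite <- !mult_IZR, <- minus_IZR; unfold det in Euv; rewrite Euv; reflexivity).
  assert (Dvw : IZR (fst v) * IZR (snd w) - IZR (snd v) * IZR (fst w) = 1)
    by (rewrite <- !mult_IZR, <- minus_IZR; unfold det in Evw; rewrite Evw; reflexivity).
  assert (Pq : 0 < IZR (fst v)) by (apply IZR_lt; lia).
  assert (Pxr : 0 <= IZR xr) by (apply IZR_le; assumption).
  assert (Pxl : 0 <= IZR xl) by (apply IZR_le; assumption).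
  destruct (Z.eq_dec (d v) 0) as [Z0|Z0].
  - assert (NF : fires t v k = 0%Z).
    { specialize (HS v (conj Fv Gv)). rewrite height_S in HS. unfold d in Z0.
      destruct (fires_01 t v k); lia. }
    assert (1 <= d w)%Z.
    { destruct (fires_adj t v w k Ht Hvw) as [E|E]; [lia|].
      specialize (HS w Fw). rewrite height_S in HS. unfold d; lia. }
    assert (1 <= d u)%Z.
    { destruct (fires_adj t u v k Ht Huv) as [E|E]; [|lia].
      specialize (HS u Fu). rewrite height_S in HS. unfold d; lia. }
    assert (Pdw : 1 <= IZR (d w)) by (apply IZR_le; assumption).
    assert (Pdu : 1 <= IZR (d u)) by (apply IZR_le; assumption).
    apply (not_extreme_strict t k _ Vr Vl (IZR (d u) / (IZR (d u) + IZR (d w)))); auto.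
    + split; [apply Rdiv_lt_0_compat; lra|]. apply Rlt_div_l; lra.
    + rewrite EVr, EVl. unfold comb; simpl. rewrite Z0. f_equal; field; lra.
    + rewrite EVr, EVl. rewrite Z0. intros E. injection E. intros _ E1. nra.
  - assert (Pdv : 0 < IZR (d v)) by (apply IZR_lt; lia).
    (* The foot of the point on the edge of [v]. The edge may have length 0, in which case the foot
       is the vertex [Vr] itself. *)
    assert (CS : conv (level t k) (IZR X, IZR Y - IZR (d v) / IZR (fst v))).
    { destruct (Z.eq_dec (xr + xl) 0) as [E|E].
      - assert (xr = 0%Z) as E0 by lia. rewrite E0 in Exr.
        replace (IZR X, IZR Y - IZR (d v) / IZR (fst v)) with Vr; [exact CVr|].
        rewrite EVr. f_equal; [lra|].
        assert (EW : IZR (snd w) = (1 + IZR (snd v) * IZR (fst w)) / IZR (fst v)).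
        { apply Rmult_eq_reg_l with (IZR (fst v)); [|lra]. field_simplify; lra. }
        assert (EDW : IZR (d w) = IZR (d v) * IZR (fst w) / IZR (fst v)).
        { apply Rmult_eq_reg_l with (IZR (fst v)); [|lra]. field_simplify; lra. }
        rewrite EW, EDW. field. lra.
      - assert (PS : 0 < IZR xr + IZR xl) by (rewrite <- plus_IZR; apply IZR_lt; lia).
        replace (IZR X, IZR Y - IZR (d v) / IZR (fst v))
          with (comb (IZR xl / (IZR xr + IZR xl)) Vr Vl).
        + apply conv_convex; auto. split.
          * apply Rdiv_le_0_compat; lra.
          * apply Rle_div_l; lra.
        + rewrite EVr, EVl. unfold comb; simpl.
          assert (SU : IZR (snd u) = (IZR (fst u) * IZR (snd v) - 1) / IZR (fst v)).
          { apply Rmult_eq_reg_l with (IZR (fst v)); [|lra]. field_simplify; lra. }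
          assert (SW : IZR (snd w) = (1 + IZR (snd v) * IZR (fst w)) / IZR (fst v)).
          { apply Rmult_eq_reg_l with (IZR (fst v)); [|lra]. field_simplify; lra. }
          assert (DU : IZR (d u) = (IZR xl + IZR (d v) * IZR (fst u)) / IZR (fst v)).
          { apply Rmult_eq_reg_l with (IZR (fst v)); [|lra]. field_simplify; lra. }
          assert (DW : IZR (d w) = (IZR xr + IZR (d v) * IZR (fst w)) / IZR (fst v)).
          { apply Rmult_eq_reg_l with (IZR (fst v)); [|lra]. field_simplify; lra. }
          rewrite SU, SW, DU, DW. f_equal; field; lra. }
    set (h := IZR (d v) / IZR (fst v)) in *.
    assert (Ph : 0 < h) by (apply Rdiv_lt_0_compat; lra).
    apply (not_extreme_strict t k _ (IZR X, IZR (Y + 1)) (IZR X, IZR Y - h) (h / (1 + h))); auto.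
    + split; [apply Rdiv_lt_0_compat; lra|]. apply Rlt_div_l; lra.
    + unfold comb; simpl. rewrite plus_IZR. f_equal; field; lra.
    + rewrite plus_IZR. intros E. injection E. lra.
Qed.

(** Heights are integers, so raising a line by 1 deletes exactly the lattice points on it; these are
    extreme when the line fires, and the remaining points are not extreme. *)
Lemma peel_level t k P : (1 <= t)%Z -> (t mod 2 = 1)%Z ->
  peel (level t k) P <-> level t (S k) P.
Proof.
  intros Ht1 Ht; split.
  - intros [(X & Y & EX & EY & HA) NE]. exists X, Y. split; [exact EX|]. split; [exact EY|].
    intros v Fv. rewrite height_S. specialize (HA v Fv) as HAv.
    destruct (fires_01 t v k) as [E|E]; [lia|].
    destruct (Z.eq_dec (fst v * Y - snd v * X) (height t v k)) as [E'|]; [exfalso|lia].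
    apply NE. replace P with (IZR X, IZR Y) by (destruct P; simpl in *; congruence).
    apply (extreme_of_firing t k X Y v); auto.
  - intros (X & Y & EX & EY & HS). split.
    + exists X, Y. split; [exact EX|]. split; [exact EY|]. intros v Fv. specialize (HS v Fv).
      rewrite height_S in HS. destruct (fires_01 t v k); lia.
    + replace P with (IZR X, IZR Y) by (destruct P; simpl in *; congruence).
      apply not_extreme_of_next; assumption.
Qed.

(** * Speed of the supporting lines *)

Definition slope (v : vec) : R := IZR (snd v) / IZR (fst v).

Lemma farey_pos t v : farey t v -> 0 < IZR (fst v).
Proof. intros [H _]. apply IZR_lt; lia. Qed.

Lemma slope_adj t v w : adj t v w -> slope w - slope v = / (IZR (fst v) * IZR (fst w)).
Proof.
  intros H. pose proof H as (Fv & Fw & D & _).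
  apply farey_pos in Fv; apply farey_pos in Fw.
  assert (E : IZR (fst v) * IZR (snd w) - IZR (snd v) * IZR (fst w) = 1)
    by (rewrite <- !mult_IZR, <- minus_IZR; unfold det in D; rewrite D; reflexivity).
  unfold slope.
  replace (IZR (snd w) / IZR (fst w) - IZR (snd v) / IZR (fst v))
    with ((IZR (fst v) * IZR (snd w) - IZR (snd v) * IZR (fst w)) / (IZR (fst v) * IZR (fst w)))
    by (field; lra).
  rewrite E. field; lra.
Qed.

Lemma det_slope t v w : farey t v -> farey t w -> slope v <= slope w -> (0 <= det v w)%Z.
Proof.
  intros Fv Fw H. apply farey_pos in Fv; apply farey_pos in Fw. unfold slope in H.
  apply le_IZR. unfold det. rewrite minus_IZR, !mult_IZR.
  replace (IZR (fst v) * IZR (snd w) - IZR (snd v) * IZR (fst w))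
    with ((IZR (fst v) * IZR (fst w)) * (IZR (snd w) / IZR (fst w) - IZR (snd v) / IZR (fst v)))
    by (field; lra).
  apply Rmult_le_pos; nra.
Qed.

(** Positions never leave a window of length [t], which bounds the cross difference of the two
    counts by [t]; dividing by both abscissas gives the slope gap. *)
Lemma fires_rate_adj t v w k : (t mod 2 = 1)%Z -> adj t v w ->
  Rabs (IZR (zsum (fires t w) k) / IZR (fst w) - IZR (zsum (fires t v) k) / IZR (fst v))
  <= IZR t * (slope w - slope v).
Proof.
  intros Ht H. rewrite (slope_adj t v w H).
  pose proof (iet_adj t v w k Ht H) as E.
  pose proof H as (Fv & Fw & _ & S).
  assert (B : (0 <= iet t (fst v) (fst w) k < t)%Z)
    by (apply iet_range; [apply Fv | apply Fw | exact S]).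
  assert (C : (0 <= (t - 1) / 2 < t)%Z).
  { destruct Fv. split; [apply Z.div_pos; lia | apply Z.div_lt_upper_bound; lia]. }
  assert (A : (- t <= fst w * zsum (fires t v) k - fst v * zsum (fires t w) k <= t)%Z) by lia.
  destruct A as [A1 A2]. apply IZR_le in A1, A2.
  rewrite minus_IZR, !mult_IZR in A1, A2. rewrite opp_IZR in A1.
  apply farey_pos in Fv; apply farey_pos in Fw.
  set (a := IZR (zsum (fires t v) k)) in *. set (b := IZR (zsum (fires t w) k)) in *.
  set (q := IZR (fst v)) in *. set (r := IZR (fst w)) in *.
  replace (b / r - a / q) with ((q * b - r * a) * / (q * r)) by (field; lra).
  assert (0 < / (q * r)) by (apply Rinv_0_lt_compat; nra).
  rewrite Rabs_mult, (Rabs_pos_eq (/ (q * r))) by lra.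
  apply Rmult_le_compat_r; [lra|]. apply Rabs_le; lra.
Qed.

(** For abscissa [t] the firing interval is the whole window. These directions are the benchmark
    with vertical speed exactly 1/t. *)
Lemma fires_top t p k : (1 <= t)%Z -> (t mod 2 = 1)%Z -> farey t (t, p) ->
  zsum (fires t (t, p)) k = Z.of_nat k.
Proof.
  intros H1 Ht F. destruct (adj_right_exists t _ F) as (w & Hw).
  assert (E : forall i, fires t (t, p) i = 1%Z).
  { intros i. rewrite (fires_right_adj t _ w i Hw). unfold fires_left; cbn [fst].
    pose proof Hw as (_ & [Fw _] & _ & S). cbn [fst] in S.
    pose proof (iet_range t t (fst w) i ltac:(lia) Fw S).
    destruct (Z.ltb_spec (iet t t (fst w) i) t); lia. }
  induction k as [|k IH]; [reflexivity|]. cbn [zsum]. rewrite IH, E. lia.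
Qed.

Lemma fires_rate t z k : (1 <= t)%Z -> (t mod 2 = 1)%Z -> farey t z ->
  Rabs (IZR (zsum (fires t z) k) / IZR (fst z) - INR k / IZR t) <= 2 * IZR t.
Proof.
  intros Ht1 Ht Fz.
  (* The benchmark [v] has slope i + 1/t, which is at most that of [z] and less than 2 away from it;
     this 2 is the constant of the lemma. *)
  set (i := (snd z / fst z - 1)%Z).
  set (v := (t, (t * i + 1)%Z) : vec).
  assert (Fv : farey t v).
  { split; cbn; [lia|]. apply (gcd1_of_bezout _ _ (- i) 1); ring. }
  assert (Pt : 1 <= IZR t) by (apply IZR_le; lia).
  pose proof (farey_pos t z Fz) as Pz.
  assert (Sv : slope v = IZR i + / IZR t).
  { unfold slope, v; cbn [fst snd]. rewrite plus_IZR, mult_IZR. field; lra. }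
  assert (It : 0 < / IZR t <= 1).
  { split; [apply Rinv_0_lt_compat; lra|]. rewrite <- Rinv_1. apply Rinv_le_contravar; lra. }
  assert (Sz : IZR i + 1 <= slope z <= IZR i + 2).
  { pose proof Fz as [Fz' _].
    pose proof (Z.div_mod (snd z) (fst z) ltac:(lia)) as D.
    pose proof (Z.mod_pos_bound (snd z) (fst z) ltac:(lia)) as B.
    assert (B1 : ((i + 1) * fst z <= snd z)%Z) by (unfold i; lia).
    assert (B2 : (snd z <= (i + 2) * fst z)%Z) by (unfold i; lia).
    apply IZR_le in B1, B2. rewrite mult_IZR, plus_IZR in B1, B2.
    unfold slope. split; [apply Rle_div_r | apply Rle_div_l]; lra. }
  set (phi := fun z : vec => IZR (zsum (fires t z) k) / IZR (fst z)).
  assert (G : Rabs (phi z - phi v) <= IZR t * (slope z - slope v)).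
  { apply (walk_right t (fun z => Rabs (phi z - phi v) <= IZR t * (slope z - slope v)) v); auto.
    - rewrite !Rminus_diag, Rabs_R0. lra.
    - intros a b Hab _ IHa. pose proof (fires_rate_adj t a b k Ht Hab) as S.
      fold (phi a) (phi b) in S.
      replace (phi b - phi v) with ((phi b - phi a) + (phi a - phi v)) by ring.
      eapply Rle_trans; [apply Rabs_triang|]. lra.
    - apply (det_slope t); auto. lra. }
  assert (Ev : phi v = INR k / IZR t).
  { unfold phi, v. rewrite fires_top by assumption. cbn [fst]. rewrite <- INR_IZR_INZ. reflexivity. }
  rewrite Ev in G. unfold phi in G. nra.
Qed.

(** * Averages over lattice vectors *)

Fixpoint rsum (f : nat -> R) (n : nat) : R :=
  match n with O => 0 | S n' => rsum f n' + f n' end.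

Lemma rsum_ext (f g : nat -> R) n : (forall i, (i < n)%nat -> f i = g i) -> rsum f n = rsum g n.
Proof. intros H; induction n; simpl; [reflexivity|]. rewrite IHn, H; auto. Qed.

Lemma rsum_plus (f g : nat -> R) n : rsum (fun i => f i + g i) n = rsum f n + rsum g n.
Proof. induction n; simpl; lra. Qed.

Lemma rsum_scal (c : R) (f : nat -> R) n : rsum (fun i => c * f i) n = c * rsum f n.
Proof. induction n; simpl; [ring|]. rewrite IHn; ring. Qed.

Lemma rsum_minus (f g : nat -> R) n : rsum (fun i => f i - g i) n = rsum f n - rsum g n.
Proof. induction n; simpl; lra. Qed.

Lemma rsum_le (f g : nat -> R) n : (forall i, (i < n)%nat -> f i <= g i) -> rsum f n <= rsum g n.
Proof.
  intros H; induction n; simpl; [lra|]. apply Rplus_le_compat; [apply IHn; auto | apply H; lia].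
Qed.

Lemma rsum_zero (f : nat -> R) n : (forall i, (i < n)%nat -> f i = 0) -> rsum f n = 0.
Proof. intros H; induction n; simpl; [reflexivity|]. rewrite IHn, H; auto; ring. Qed.

Lemma rsum_nonneg (f : nat -> R) n : (forall i, (i < n)%nat -> 0 <= f i) -> 0 <= rsum f n.
Proof. intros H. rewrite <- (rsum_zero (fun _ => 0) n) by auto. apply rsum_le; auto. Qed.

Lemma rsum_abs (f : nat -> R) n : Rabs (rsum f n) <= rsum (fun i => Rabs (f i)) n.
Proof.
  induction n; simpl; [rewrite Rabs_R0; lra|].
  eapply Rle_trans; [apply Rabs_triang|]. lra.
Qed.

Lemma rsum_const (c : R) n : rsum (fun _ => c) n = INR n * c.
Proof. induction n; [simpl; ring|]. rewrite S_INR; simpl rsum. rewrite IHn; ring. Qed.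

Lemma rsum_swap (f : nat -> nat -> R) m n :
  rsum (fun i => rsum (fun j => f i j) n) m = rsum (fun j => rsum (fun i => f i j) m) n.
Proof.
  induction m; simpl.
  - symmetry; apply rsum_zero; auto.
  - rewrite IHm, <- rsum_plus. reflexivity.
Qed.

Lemma rsum_app (f : nat -> R) a b : rsum f (a + b) = rsum f a + rsum (fun i => f (a + i)%nat) b.
Proof.
  induction b; simpl; [rewrite Nat.add_0_r; ring|].
  rewrite Nat.add_succ_r. simpl. rewrite IHb. ring.
Qed.

Lemma rsum_head (f : nat -> R) n : rsum f (S n) = f 0%nat + rsum (fun i => f (S i)) n.
Proof. change (S n) with (1 + n)%nat. rewrite rsum_app. simpl. ring. Qed.

Lemma IZR_zsum (f : nat -> Z) n : IZR (zsum f n) = rsum (fun i => IZR (f i)) n.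
Proof. induction n; simpl; [reflexivity|]. rewrite plus_IZR, IHn. reflexivity. Qed.

Definition dvdb (d n : nat) : bool := Nat.eqb (n mod d) 0.

Lemma dvdb_spec d n : d <> 0%nat -> dvdb d n = true <-> Nat.divide d n.
Proof. intros H. unfold dvdb. rewrite Nat.eqb_eq. apply Nat.Lcm0.mod_divide. Qed.

Lemma rsum_multiples (f : nat -> R) d n : d <> 0%nat ->
  rsum (fun i => if dvdb d (S i) then f (S i) else 0) n
  = rsum (fun j => f (d * S j)%nat) (n / d).
Proof.
  intros Hd; induction n as [|n IH]; [rewrite Nat.Div0.div_0_l; reflexivity|].
  cbn [rsum]. rewrite IH.
  pose proof (Nat.div_mod n d Hd) as D1. pose proof (Nat.mod_upper_bound n d Hd) as B1.
  pose proof (Nat.div_mod (S n) d Hd) as D2. pose proof (Nat.mod_upper_bound (S n) d Hd) as B2.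
  unfold dvdb. destruct (Nat.eqb_spec (S n mod d) 0) as [E|E].
  - assert (Q : (S n / d = S (n / d))%nat) by nia. rewrite Q. cbn [rsum].
    f_equal. f_equal. nia.
  - assert (Q : (S n / d = n / d)%nat) by nia. rewrite Q. ring.
Qed.

Lemma rsum_multiples_below (f : nat -> R) d e : d <> 0%nat ->
  rsum (fun y => if dvdb d y then f y else 0) (d * e) = rsum (fun j => f (d * j)%nat) e.
Proof.
  intros Hd; induction e as [|e IH]; [rewrite Nat.mul_0_r; reflexivity|].
  replace (d * S e)%nat with (d * e + d)%nat by lia.
  rewrite rsum_app, IH. cbn [rsum]. f_equal.
  destruct d as [|d]; [congruence|]. rewrite rsum_head, rsum_zero.
  - rewrite Nat.add_0_r. unfold dvdb. rewrite Nat.mul_comm, Nat.Div0.mod_mul. simpl. ring.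
  - intros i Hi. unfold dvdb.
    replace ((S d * e + S i) mod S d)%nat with (S i).
    + reflexivity.
    + rewrite Nat.add_comm, Nat.mul_comm, Nat.Div0.mod_add. symmetry; apply Nat.mod_small; lia.
Qed.

(** The second clause determines [c] as the Dirichlet convolution of the Moebius function with 1/n.
    The estimates use only these two clauses. *)
Definition inv_weights (c : nat -> R) : Prop :=
  (forall n, (1 <= n)%nat -> Rabs (c n) <= 1) /\
  (forall n, (1 <= n)%nat ->
     rsum (fun i => if dvdb (S i) n then c (S i) else 0) n = / INR n).

Lemma inv_weights_gcd c x y t : inv_weights c -> (1 <= x <= t)%nat ->
  / INR (Nat.gcd x y) = rsum (fun i => if (dvdb (S i) x && dvdb (S i) y)%bool then c (S i) else 0) t.
Proof.
  intros [_ Hc] Hx.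
  assert (G1 : (1 <= Nat.gcd x y)%nat).
  { destruct (Nat.eq_dec (Nat.gcd x y) 0) as [E|]; [|lia]. apply Nat.gcd_eq_0_l in E; lia. }
  assert (G2 : (Nat.gcd x y <= x)%nat) by (apply Nat.divide_pos_le; [lia | apply Nat.gcd_divide_l]).
  rewrite <- (Hc _ G1).
  replace t with (Nat.gcd x y + (t - Nat.gcd x y))%nat by lia.
  rewrite rsum_app, (rsum_zero (fun i => if (dvdb (S (Nat.gcd x y + i)) x && dvdb (S (Nat.gcd x y + i)) y)%bool then c (S (Nat.gcd x y + i)) else 0)).
  - rewrite Rplus_0_r. apply rsum_ext. intros i Hi.
    replace (dvdb (S i) x && dvdb (S i) y)%bool with (dvdb (S i) (Nat.gcd x y)); [reflexivity|].
    apply Bool.eq_iff_eq_true. rewrite Bool.andb_true_iff, !dvdb_spec by lia.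
    split.
    + intros H; split; eapply Nat.divide_trans; eauto; [apply Nat.gcd_divide_l | apply Nat.gcd_divide_r].
    + intros [A B]. apply Nat.gcd_greatest; assumption.
  - intros i Hi. destruct (dvdb (S (Nat.gcd x y + i)) x && dvdb (S (Nat.gcd x y + i)) y)%bool eqn:E;
      [exfalso|reflexivity].
    apply Bool.andb_true_iff in E. rewrite !dvdb_spec in E by lia. destruct E as [A B].
    pose proof (Nat.gcd_greatest _ _ _ A B) as D. apply Nat.divide_pos_le in D; lia.
Qed.

(** After expanding 1/gcd over common divisors [k] and exchanging sums, x = kj and y = ky' with an
    unrestricted y' < j. *)
Lemma gcd_weighted_sum c (G : nat -> nat -> R) t : inv_weights c ->
  rsum (fun i => rsum (fun y => G (S i) y / INR (Nat.gcd (S i) y)) (S i)) t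
  = rsum (fun k => c (S k) * rsum (fun j => rsum (fun y => G (S k * S j)%nat (S k * y)%nat) (S j))
                               (t / S k)) t.
Proof.
  intros Hc.
  transitivity (rsum (fun k => c (S k) * rsum (fun i => if dvdb (S k) (S i)
      then rsum (fun y => if dvdb (S k) y then G (S i) y else 0) (S i) else 0) t) t).
  - transitivity (rsum (fun i => rsum (fun k => c (S k) * (if dvdb (S k) (S i)
      then rsum (fun y => if dvdb (S k) y then G (S i) y else 0) (S i) else 0)) t) t).
    + apply rsum_ext. intros i Hi.
      transitivity (rsum (fun y => rsum (fun k => c (S k) * (if dvdb (S k) (S i)
        then (if dvdb (S k) y then G (S i) y else 0) else 0)) t) (S i)).
      * apply rsum_ext. intros y Hy. unfold Rdiv.
        rewrite (inv_weights_gcd c (S i) y t Hc) by lia. rewrite <- rsum_scal.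
        apply rsum_ext. intros k Hk.
        destruct (dvdb (S k) (S i)), (dvdb (S k) y); simpl; ring.
      * rewrite rsum_swap. apply rsum_ext. intros k Hk. rewrite rsum_scal. f_equal.
        destruct (dvdb (S k) (S i)); [reflexivity|]. apply rsum_zero; auto.
    + rewrite rsum_swap. apply rsum_ext. intros k Hk. apply rsum_scal.
  - apply rsum_ext. intros k Hk. f_equal.
    rewrite (rsum_multiples (fun x => rsum (fun y => if dvdb (S k) y then G x y else 0) x)) by lia.
    apply rsum_ext. intros j Hj. apply rsum_multiples_below. lia.
Qed.

Definition harm (n : nat) : R := rsum (fun i => / INR (S i)) n.

Lemma INR_S_pos n : 0 < INR (S n).
Proof. apply lt_0_INR; lia. Qed.

Lemma harm_le_ln n : (1 <= n)%nat -> harm n <= 1 + ln (INR n).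
Proof.
  induction n as [|n IH]; intros H; [lia|]. unfold harm in *; cbn [rsum].
  destruct n as [|n].
  - simpl. rewrite ln_1. lra.
  - specialize (IH ltac:(lia)).
    set (a := INR (S n)) in *. assert (Pa : 0 < a) by apply INR_S_pos.
    rewrite (S_INR (S n)). fold a.
    enough (ln a - ln (a + 1) <= - / (a + 1)) by lra.
    rewrite <- ln_div by lra.
    assert (E : a / (a + 1) = 1 + - / (a + 1)) by (field; lra).
    rewrite E. rewrite <- (ln_exp (- / (a + 1))) at 2.
    apply ln_le; [|apply exp_ineq1_le].
    rewrite <- E. apply Rdiv_lt_0_compat; lra.
Qed.

Lemma INR_div_le n d : d <> 0%nat -> INR (n / d) <= INR n / INR d.
Proof.
  intros H. assert (0 < INR d) by (apply lt_0_INR; lia).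
  apply Rle_div_r; [assumption|]. rewrite <- mult_INR. apply le_INR.
  pose proof (Nat.div_mod n d H). lia.
Qed.

Lemma rsum_id_le n : rsum (fun j => INR (S j)) n <= INR n * INR n.
Proof.
  rewrite <- (rsum_const (INR n) n). apply rsum_le. intros i Hi. apply le_INR. lia.
Qed.

(** Row [k] contributes at most k K (t/k)^2 = K t^2 / k, whence the harmonic sum. *)
Lemma inv_weights_error c (f : nat -> nat -> R) (K : R) t : inv_weights c -> 0 <= K ->
  (forall k j, Rabs (f k j) <= K) ->
  Rabs (rsum (fun k => c (S k) * rsum (fun j => INR (S k * S j) * f k j) (t / S k)) t)
  <= K * (INR t * INR t) * harm t.
Proof.
  intros [Hc _] HK Hf.
  eapply Rle_trans; [apply rsum_abs|].
  unfold harm. rewrite <- rsum_scal. apply rsum_le. intros k Hk.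
  rewrite Rabs_mult.
  pose proof (INR_S_pos k) as Pk.
  assert (B : Rabs (rsum (fun j => INR (S k * S j) * f k j) (t / S k))
              <= INR (S k) * K * ((INR t / INR (S k)) * (INR t / INR (S k)))).
  { eapply Rle_trans; [apply rsum_abs|].
    apply Rle_trans with (rsum (fun j => INR (S k) * K * INR (S j)) (t / S k)).
    - apply rsum_le. intros j Hj. rewrite Rabs_mult, mult_INR.
      pose proof (INR_S_pos j). specialize (Hf k j).
      rewrite Rabs_pos_eq by nra.
      replace (INR (S k) * K * INR (S j)) with (INR (S k) * INR (S j) * K) by ring.
      apply Rmult_le_compat_l; [nra|assumption].
    - rewrite rsum_scal. apply Rmult_le_compat_l; [nra|].
      eapply Rle_trans; [apply rsum_id_le|].
      pose proof (INR_div_le t (S k) ltac:(lia)). pose proof (pos_INR (t / S k)).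
      apply Rmult_le_compat; assumption. }
  pose proof (Hc (S k) ltac:(lia)) as C.
  apply Rle_trans with (1 * (INR (S k) * K * ((INR t / INR (S k)) * (INR t / INR (S k))))).
  - apply Rmult_le_compat; auto using Rabs_pos.
  - right. field. lra.
Qed.

(* [bump] is the periodic part of the chord interpolation of [y (y - 1) / 2]. *)
Definition bump (y : R) : R := frac_part y * (1 - frac_part y) / 2.

Lemma bump_eq y i : IZR i <= y <= IZR i + 1 -> bump y = (y - IZR i) * (1 - (y - IZR i)) / 2.
Proof.
  intros [H1 H2]. unfold bump, frac_part.
  destruct (base_Int_part y) as [B1 B2].
  assert ((i - 1 < Int_part y)%Z) by (apply lt_IZR; rewrite minus_IZR; lra).
  assert ((Int_part y < i + 2)%Z) by (apply lt_IZR; rewrite plus_IZR; lra).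
  assert (Int_part y = i \/ Int_part y = (i + 1)%Z) as [E|E] by lia; rewrite E in *.
  - reflexivity.
  - rewrite plus_IZR in *. assert (y = IZR i + 1) by lra. subst y. field.
Qed.

Lemma floor_exists y : exists i, IZR i <= y < IZR i + 1.
Proof. exists (Int_part y). destruct (base_Int_part y). lra. Qed.

Lemma bump_shift y i : bump (y + IZR i) = bump y.
Proof.
  destruct (floor_exists y) as (k & Hk).
  rewrite (bump_eq y k), (bump_eq (y + IZR i) (k + i)); rewrite ?plus_IZR; lra.
Qed.

Lemma bump_lipschitz y h : 0 <= h <= 1 -> Rabs (bump (y + h) - bump y) <= h.
Proof.
  intros Hh. destruct (floor_exists y) as (k & Hk).
  rewrite (bump_eq y k) by lra.
  destruct (Rle_lt_dec (y + h) (IZR k + 1)) as [L|L].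
  - rewrite (bump_eq (y + h) k) by lra. apply Rabs_le. split; nra.
  - rewrite (bump_eq (y + h) (k + 1)); rewrite plus_IZR; [|lra]. apply Rabs_le. split; nra.
Qed.

Definition bump_sum (s : R) (e : nat) : R := rsum (fun y => bump (s - INR y / INR e)) e.

Lemma bump_sum_period s e : bump_sum (s + / INR (S e)) (S e) = bump_sum s (S e).
Proof.
  unfold bump_sum. pose proof (INR_S_pos e). rewrite rsum_head. cbn [rsum].
  rewrite Rplus_comm. f_equal.
  - apply rsum_ext. intros i Hi. f_equal. rewrite (S_INR i). field. lra.
  - rewrite <- (bump_shift (s - INR e / INR (S e)) 1). f_equal.
    rewrite (S_INR e) in *. simpl (INR 0). field. lra.
Qed.

Lemma bump_sum_period_Z s e i : bump_sum (s + IZR i / INR (S e)) (S e) = bump_sum s (S e).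
Proof.
  pose proof (INR_S_pos e) as P.
  assert (G : forall n s, bump_sum (s + INR n / INR (S e)) (S e) = bump_sum s (S e)).
  { induction n as [|n IH]; intros s'.
    - change (INR 0) with 0. unfold Rdiv. rewrite Rmult_0_l, Rplus_0_r. reflexivity.
    - rewrite <- (IH s'), <- (bump_sum_period (s' + INR n / INR (S e))). f_equal.
      rewrite (S_INR n). field. lra. }
  destruct (Z_le_gt_dec 0 i) as [L|L].
  - rewrite <- (G (Z.to_nat i) s), (INR_IZR_INZ (Z.to_nat i)), Z2Nat.id by lia. reflexivity.
  - rewrite <- (G (Z.to_nat (- i)) (s + IZR i / INR (S e))).
    rewrite (INR_IZR_INZ (Z.to_nat _)), Z2Nat.id, opp_IZR by lia. f_equal. field. lra.
Qed.

(** The sum has period 1/e in [s], and each of its [e] terms is 1-Lipschitz, so the bound does not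
    grow with [e]. *)
Lemma bump_sum_oscillation s e : Rabs (bump_sum s e - bump_sum 0 e) <= 1.
Proof.
  destruct e as [|e]; [unfold bump_sum; simpl; rewrite Rminus_0_r, Rabs_R0; lra|].
  pose proof (INR_S_pos e) as P.
  destruct (floor_exists (s * INR (S e))) as (i & Hi).
  set (h := s - IZR i / INR (S e)).
  assert (Hh : 0 <= h <= / INR (S e)).
  { assert (E : h = (s * INR (S e) - IZR i) * / INR (S e)) by (unfold h; field; lra).
    assert (0 < / INR (S e)) by (apply Rinv_0_lt_compat; lra).
    rewrite E. split; [apply Rmult_le_pos; lra|]. nra. }
  assert (I1 : / INR (S e) <= 1).
  { rewrite <- Rinv_1. apply Rinv_le_contravar; [lra|]. rewrite S_INR. pose proof (pos_INR e). lra. }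
  replace s with (h + IZR i / INR (S e)) by (unfold h; ring).
  rewrite bump_sum_period_Z. unfold bump_sum. rewrite <- rsum_minus.
  eapply Rle_trans; [apply rsum_abs|].
  apply Rle_trans with (rsum (fun _ => / INR (S e)) (S e)).
  - apply rsum_le. intros y Hy.
    replace (h - INR y / INR (S e)) with (0 - INR y / INR (S e) + h) by ring.
    eapply Rle_trans; [apply bump_lipschitz; lra|]. lra.
  - rewrite rsum_const. right. field. lra.
Qed.

(** * Distance between the polygon and a parabola *)

Definition wsum (n : nat) (G : R -> R) : R :=
  rsum (fun i => rsum (fun y => INR (S i) / INR (Nat.gcd (S i) y) * G (INR y / INR (S i))) (S i)) n.

Lemma wsum_ext n F G : (forall s, F s = G s) -> wsum n F = wsum n G.
Proof.
  intros H. unfold wsum. apply rsum_ext; intros i Hi. apply rsum_ext; intros y Hy.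
  rewrite H. reflexivity.
Qed.

Lemma wsum_plus n F G : wsum n (fun s => F s + G s) = wsum n F + wsum n G.
Proof.
  unfold wsum. rewrite <- rsum_plus. apply rsum_ext; intros i Hi.
  rewrite <- rsum_plus. apply rsum_ext; intros y Hy. ring.
Qed.

Lemma wsum_scal n a G : wsum n (fun s => a * G s) = a * wsum n G.
Proof.
  unfold wsum. rewrite <- rsum_scal. apply rsum_ext; intros i Hi.
  rewrite <- rsum_scal. apply rsum_ext; intros y Hy. ring.
Qed.

(** The abscissa gained by the polygon while its slope grows by 1, that is, its inverse mean
    curvature. *)
Definition period (n : nat) : R := wsum n (fun _ => 1).

Definition chord (y : R) : R := (y ^ 2 - y) / 2 + bump y.

Lemma parab_chord_real D N : (0 < N)%Z -> IZR (parab_chord D N) = IZR N * chord (IZR D / IZR N).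
Proof.
  intros HN.
  pose proof (Z.div_mod D N ltac:(lia)) as E.
  pose proof (Z.mod_pos_bound D N HN) as B.
  set (i := (D / N)%Z) in *.
  assert (PN : 0 < IZR N) by (apply IZR_lt; assumption).
  assert (B1 : (i * N <= D)%Z) by lia. assert (B2 : (D <= (i + 1) * N)%Z) by lia.
  rewrite (parab_chord_eq D N i) by lia.
  apply IZR_le in B1, B2. rewrite mult_IZR in B1, B2. rewrite plus_IZR in B2.
  assert (Bd : IZR i <= IZR D / IZR N <= IZR i + 1)
    by (split; [apply Rle_div_r | apply Rle_div_l]; lra).
  unfold chord. rewrite (bump_eq _ i Bd).
  pose proof (triangular i) as T. apply (f_equal IZR) in T.
  rewrite !mult_IZR, plus_IZR in T. rewrite minus_IZR, !mult_IZR.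
  replace (IZR (i * (i + 1) / 2)) with (IZR i * (IZR i + 1) / 2) by lra.
  field. lra.
Qed.

Lemma Zgcd_Natgcd a b : Z.gcd (Z.of_nat a) (Z.of_nat b) = Z.of_nat (Nat.gcd a b).
Proof.
  apply Z.gcd_unique.
  - lia.
  - destruct (Nat.gcd_divide_l a b) as (k & Hk). exists (Z.of_nat k).
    rewrite <- Nat2Z.inj_mul, <- Hk. reflexivity.
  - destruct (Nat.gcd_divide_r a b) as (k & Hk). exists (Z.of_nat k).
    rewrite <- Nat2Z.inj_mul, <- Hk. reflexivity.
  - intros q (x & Hx) (y & Hy).
    destruct (Nat.gcd_bezout a b) as [(u & w & E)|(u & w & E)];
      apply (f_equal Z.of_nat) in E;
      rewrite ?Nat2Z.inj_add, ?Nat2Z.inj_mul in E.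
    + exists (Z.of_nat u * x - Z.of_nat w * y)%Z. lia.
    + exists (Z.of_nat u * y - Z.of_nat w * x)%Z. lia.
Qed.

Lemma support_real t v : farey t v ->
  IZR (support t v) = - (IZR (fst v) * wsum (Z.to_nat t) (fun s => chord (slope v - s))).
Proof.
  intros Fv. unfold support, wsum. rewrite opp_IZR, IZR_zsum. f_equal.
  rewrite <- rsum_scal. apply rsum_ext; intros i Hi.
  rewrite IZR_zsum, <- rsum_scal. apply rsum_ext; intros y Hy.
  unfold prim_chord.
  destruct (gcd_reduce (Z.of_nat (S i)) (Z.of_nat y) ltac:(lia)) as (G0 & G1 & G2 & _).
  rewrite Zgcd_Natgcd in *. set (g := Nat.gcd (S i) y) in *.
  set (a := (Z.of_nat (S i) / Z.of_nat g)%Z) in *. set (b := (Z.of_nat y / Z.of_nat g)%Z) in *.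
  pose proof (farey_pos t v Fv) as Pq. destruct Fv as [Fv _].
  assert (Pa : (0 < a)%Z) by nia.
  rewrite parab_chord_real by nia.
  assert (Pg' : 0 < INR g) by (rewrite INR_IZR_INZ; apply IZR_lt; assumption).
  assert (Pa' : 0 < IZR a) by (apply IZR_lt; assumption).
  apply (f_equal IZR) in G1, G2. rewrite mult_IZR, <- !INR_IZR_INZ in G1, G2.
  rewrite G1, G2, minus_IZR, !mult_IZR. unfold slope.
  replace (INR g * IZR a / INR g) with (IZR a) by (field; lra).
  replace (IZR (snd v) / IZR (fst v) - INR g * IZR b / (INR g * IZR a))
    with ((IZR (snd v) * IZR a - IZR (fst v) * IZR b) / (IZR (fst v) * IZR a)) by (field; lra).
  ring.
Qed.

Lemma wsum_bump c n s : inv_weights c ->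
  Rabs (wsum n (fun x => bump (s - x)) - wsum n (fun x => bump (0 - x)))
  <= INR n * INR n * harm n.
Proof.
  intros Hc.
  assert (E : forall s, wsum n (fun x => bump (s - x)) =
    rsum (fun k => c (S k) * rsum (fun j => INR (S k * S j) * bump_sum s (S j)) (n / S k)) n).
  { intros s'. unfold wsum.
    rewrite <- (rsum_ext (fun i => rsum (fun y => INR (S i) * bump (s' - INR y / INR (S i))
                                                 / INR (Nat.gcd (S i) y)) (S i))).
    2:{ intros i Hi. apply rsum_ext; intros y Hy. unfold Rdiv. ring. }
    rewrite (gcd_weighted_sum c (fun x y => INR x * bump (s' - INR y / INR x)) n Hc).
    apply rsum_ext; intros k Hk. f_equal. apply rsum_ext; intros j Hj.
    rewrite rsum_scal. f_equal. unfold bump_sum. apply rsum_ext; intros y Hy. f_equal.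
    pose proof (INR_S_pos k). pose proof (INR_S_pos j). rewrite !mult_INR. field. lra. }
  rewrite !E, <- rsum_minus.
  rewrite (rsum_ext _ (fun k => c (S k) * rsum (fun j => INR (S k * S j) *
             (bump_sum s (S j) - bump_sum 0 (S j))) (n / S k))).
  2:{ intros k Hk. rewrite <- Rmult_minus_distr_l, <- rsum_minus. f_equal.
      apply rsum_ext; intros j Hj. ring. }
  eapply Rle_trans; [apply (inv_weights_error c _ 1); auto; [lra|]|].
  - intros. apply bump_sum_oscillation.
  - lra.
Qed.

Lemma period_bounds n : (1 <= n)%nat -> 0 < period n <= INR n ^ 3.
Proof.
  intros Hn. unfold period, wsum.
  assert (P : forall i y, 0 < / INR (Nat.gcd (S i) y) <= 1).
  { intros i y. assert (1 <= Nat.gcd (S i) y)%nat.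
    { destruct (Nat.eq_dec (Nat.gcd (S i) y) 0) as [E|]; [|lia]. apply Nat.gcd_eq_0_l in E; lia. }
    apply le_INR in H. change (INR 1) with 1 in H. split; [apply Rinv_0_lt_compat; lra|].
    rewrite <- Rinv_1. apply Rinv_le_contravar; lra. }
  split.
  - destruct n as [|n]; [lia|]. rewrite rsum_head.
    match goal with |- 0 < ?a + ?b => assert (0 < a); [|assert (0 <= b)] end.
    + simpl. lra.
    + apply rsum_nonneg; intros i Hi. apply rsum_nonneg; intros y Hy.
      specialize (P (S i) y). pose proof (INR_S_pos (S i)). unfold Rdiv. nra.
    + lra.
  - apply Rle_trans with (rsum (fun _ => INR n * INR n) n).
    + apply rsum_le; intros i Hi.
      apply Rle_trans with (rsum (fun _ => INR n) (S i)).
      * apply rsum_le; intros y Hy. specialize (P i y). pose proof (INR_S_pos i).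
        assert (INR (S i) <= INR n) by (apply le_INR; lia). unfold Rdiv. nra.
      * rewrite rsum_const. assert (INR (S i) <= INR n) by (apply le_INR; lia).
        pose proof (pos_INR n). nra.
    + rewrite rsum_const. right; ring.
Qed.

(** Expanding [chord (s - x)] shows that the support function at slope s, per unit abscissa, is
    close to -Hs^2/2 + bs - c, where the periodic part is frozen at s = 0 inside [shape_c]. [shape]
    is the parabola with these tangents, a Legendre transform. *)
Definition shape_b (n : nat) : R := wsum n (fun s => s + 1 / 2).
Definition shape_c (n : nat) : R :=
  wsum n (fun s => (s ^ 2 + s) / 2) + wsum n (fun s => bump (0 - s)).
Definition shape (n : nat) (X : R) : R :=
  (X + shape_b n) ^ 2 / (2 * period n) - shape_c n.
(** The first term pays for freezing the periodic part. Of the 3n, 2n pay for the uneven firing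
    rates and the rest for the gaps between Farey slopes. *)
Definition shape_error (n : nat) : R := INR n * INR n * harm n + 3 * INR n.

Lemma support_slope c t v : inv_weights c -> (1 <= t)%Z -> farey t v ->
  let n := Z.to_nat t in
  Rabs (IZR (support t v) / IZR (fst v)
        - (- period n * slope v ^ 2 / 2 + shape_b n * slope v - shape_c n))
  <= INR n * INR n * harm n.
Proof.
  intros Hc Ht Fv n. rewrite (support_real t v Fv). fold n.
  pose proof (farey_pos t v Fv) as Pq.
  set (s := slope v).
  rewrite (wsum_ext n (fun x => chord (s - x))
    (fun x => (s ^ 2 / 2) * 1 + ((- s) * (x + 1 / 2) + ((x ^ 2 + x) / 2 + bump (s - x)))))
    by (intros x; unfold chord; field).
  rewrite !wsum_plus, !wsum_scal. fold (period n) (shape_b n).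
  unfold shape_c.
  eapply Rle_trans; [right|apply (wsum_bump c n s Hc)].
  rewrite <- Rabs_Ropp. f_equal. field. lra.
Qed.

Lemma height_slope c t v k : inv_weights c -> (1 <= t)%Z -> (t mod 2 = 1)%Z -> farey t v ->
  let n := Z.to_nat t in
  Rabs (IZR (height t v k) / IZR (fst v)
        - (- period n * slope v ^ 2 / 2 + shape_b n * slope v - shape_c n + INR k / INR n))
  <= INR n * INR n * harm n + 2 * INR n.
Proof.
  intros Hc Ht1 Ht Fv n.
  pose proof (support_slope c t v Hc Ht1 Fv) as A. cbv zeta in A. fold n in A.
  pose proof (fires_rate t v k Ht1 Ht Fv) as B.
  assert (En : IZR t = INR n) by (unfold n; rewrite INR_IZR_INZ, Z2Nat.id by lia; reflexivity).
  rewrite En in B. unfold height. rewrite plus_IZR.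
  pose proof (farey_pos t v Fv) as Pq.
  set (u := - period n * slope v ^ 2 / 2 + shape_b n * slope v - shape_c n) in *.
  assert (Pn : 1 <= INR n) by (rewrite <- En; apply IZR_le; lia).
  replace ((IZR (support t v) + IZR (zsum (fires t v) k)) / IZR (fst v) - (u + INR k / INR n))
    with ((IZR (support t v) / IZR (fst v) - u)
          + (IZR (zsum (fires t v) k) / IZR (fst v) - INR k / INR n)) by (field; lra).
  eapply Rle_trans; [apply Rabs_triang|]. lra.
Qed.

Lemma farey_dense t s : (1 <= t)%Z -> exists v, farey t v /\ Rabs (slope v - s) <= / IZR t.
Proof.
  intros Ht. assert (Pt : 1 <= IZR t) by (apply IZR_le; lia).
  destruct (floor_exists (s * IZR t)) as (p & Hp).
  destruct (gcd_reduce t p ltac:(lia)) as (G0 & G1 & G2 & G3).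
  set (g := Z.gcd t p) in *. set (a := (t / g)%Z) in *. set (b := (p / g)%Z) in *.
  exists (a, b). split.
  - split; cbn; [nia|exact G3].
  - assert (E : slope (a, b) = IZR p / IZR t).
    { unfold slope; cbn. rewrite G1, G2, !mult_IZR.
      assert (0 < IZR g) by (apply IZR_lt; lia).
      assert (0 < IZR a) by (apply IZR_lt; nia). field; lra. }
    rewrite E.
    replace (IZR p / IZR t - s) with ((IZR p - s * IZR t) * / IZR t) by (field; lra).
    assert (0 < / IZR t) by (apply Rinv_0_lt_compat; lra).
    rewrite Rabs_mult, (Rabs_pos_eq (/ IZR t)) by lra.
    rewrite <- (Rmult_1_l (/ IZR t)) at 2. apply Rmult_le_compat_r; [lra|].
    apply Rabs_le; lra.
Qed.

Lemma above_shape c t k X Y : inv_weights c -> (1 <= t)%Z -> (t mod 2 = 1)%Z ->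
  let n := Z.to_nat t in
  above t k X Y -> shape n (IZR X) + INR k / INR n - shape_error n <= IZR Y.
Proof.
  intros Hc Ht1 Ht n HA.
  assert (Hn : (1 <= n)%nat) by (unfold n; lia).
  assert (En : IZR t = INR n) by (unfold n; rewrite INR_IZR_INZ, Z2Nat.id by lia; reflexivity).
  destruct (period_bounds n Hn) as [P1 P2].
  set (H := period n) in *. set (b := shape_b n) in *.
  (* The tangent of [shape] at X has slope (X + b)/H. Missing it by 1/t costs at most H/(2t^2), and
     this is at most t/2 because H <= t^3. *)
  destruct (farey_dense t ((IZR X + b) / H) Ht1) as (v & Fv & Dv).
  pose proof (height_slope c t v k Hc Ht1 Ht Fv) as E. cbv zeta in E.
  fold n in E. fold H b in E. rewrite En in Dv.
  specialize (HA v Fv). apply IZR_le in HA. rewrite minus_IZR, !mult_IZR in HA.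
  pose proof (farey_pos t v Fv) as Pq.
  assert (Pn : 1 <= INR n) by (rewrite <- En; apply IZR_le; lia).
  assert (HA' : IZR (height t v k) / IZR (fst v) + slope v * IZR X <= IZR Y).
  { unfold slope.
    replace (IZR (height t v k) / IZR (fst v) + IZR (snd v) / IZR (fst v) * IZR X)
      with ((IZR (height t v k) + IZR (snd v) * IZR X) / IZR (fst v)) by (field; lra).
    apply Rle_div_l; lra. }
  apply Rabs_def2b in E || apply Rabs_le_between in E.
  set (s := slope v) in *. set (s0 := (IZR X + b) / H) in *.
  unfold shape, shape_error. fold H b.
  assert (I : (IZR X + b) ^ 2 / (2 * H) - shape_c n
              = s * IZR X + (- H * s ^ 2 / 2 + b * s - shape_c n) + H / 2 * (s - s0) ^ 2).
  { unfold s0. field. lra. }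
  rewrite I.
  assert (D2 : (s - s0) ^ 2 <= (/ INR n) ^ 2).
  { apply pow_maj_Rabs; exact Dv. }
  assert (D3 : H / 2 * (s - s0) ^ 2 <= INR n / 2).
  { apply Rle_trans with (INR n ^ 3 / 2 * (/ INR n) ^ 2).
    - apply Rmult_le_compat; try lra. apply pow2_ge_0.
    - right. field. lra. }
  lra.
Qed.

(** Completing the square: every tangent lies below the parabola, so all supporting lines are
    respected at once. *)
Lemma shape_above c t k X Y : inv_weights c -> (1 <= t)%Z -> (t mod 2 = 1)%Z ->
  let n := Z.to_nat t in
  shape n (IZR X) + INR k / INR n + shape_error n <= IZR Y -> above t k X Y.
Proof.
  intros Hc Ht1 Ht n HS v Fv.
  assert (Hn : (1 <= n)%nat) by (unfold n; lia).
  destruct (period_bounds n Hn) as [P1 P2].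
  pose proof (height_slope c t v k Hc Ht1 Ht Fv) as E. cbv zeta in E. fold n in E.
  set (H := period n) in *. set (b := shape_b n) in *.
  pose proof (farey_pos t v Fv) as Pq.
  apply le_IZR. rewrite minus_IZR, !mult_IZR.
  apply Rabs_le_between in E.
  set (s := slope v) in *.
  unfold shape, shape_error in HS. fold H b in HS.
  assert (I : (IZR X + b) ^ 2 / (2 * H) - shape_c n
              = s * IZR X + (- H * s ^ 2 / 2 + b * s - shape_c n)
                + H / 2 * (s - (IZR X + b) / H) ^ 2) by (field; lra).
  rewrite I in HS.
  assert (0 <= H / 2 * (s - (IZR X + b) / H) ^ 2)
    by (apply Rmult_le_pos; [lra | apply pow2_ge_0]).
  pose proof (pos_INR n).
  assert (F : IZR (height t v k) / IZR (fst v) <= IZR Y - s * IZR X) by lra.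
  apply Rle_div_l in F; [|assumption].
  unfold s, slope in F.
  replace (IZR (fst v) * IZR Y - IZR (snd v) * IZR X)
    with ((IZR Y - IZR (snd v) / IZR (fst v) * IZR X) * IZR (fst v)) by (field; lra).
  exact F.
Qed.

(** * Weights whose sum over the divisors of n is 1/n *)

Definition primeb (r : nat) : bool :=
  Nat.leb 2 r && forallb (fun d => negb (dvdb d r)) (seq 2 (r - 2)).

Lemma primeb_spec r : primeb r = true <->
  (2 <= r)%nat /\ forall d, Nat.divide d r -> d = 1%nat \/ d = r.
Proof.
  unfold primeb. rewrite Bool.andb_true_iff, Nat.leb_le, forallb_forall. split.
  - intros [H2 H]; split; [exact H2|]. intros d Hd.
    assert (d <> 0%nat) by (intros ->; apply Nat.divide_0_l in Hd; lia).
    pose proof (Nat.divide_pos_le d r ltac:(lia) Hd).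
    destruct (Nat.eq_dec d 1); [auto|]. destruct (Nat.eq_dec d r); [auto|]. exfalso.
    specialize (H d). rewrite in_seq in H. specialize (H ltac:(lia)).
    apply dvdb_spec in Hd; [|assumption]. rewrite Hd in H. discriminate.
  - intros [H2 H]; split; [exact H2|]. intros d Hd. rewrite in_seq in Hd.
    destruct (dvdb d r) eqn:E; [exfalso|reflexivity].
    apply dvdb_spec in E; [|lia]. specialize (H d E). lia.
Qed.

Lemma primeb_gcd p x : primeb p = true -> ~ Nat.divide p x -> Nat.gcd p x = 1%nat.
Proof.
  intros Hp Hx. apply primeb_spec in Hp. destruct Hp as [_ H].
  destruct (H (Nat.gcd p x) (Nat.gcd_divide_l p x)) as [E|E]; [exact E|].
  exfalso. apply Hx. rewrite <- E. apply Nat.gcd_divide_r.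
Qed.

Lemma prime_divisor_exists n : (2 <= n)%nat -> exists p, primeb p = true /\ Nat.divide p n.
Proof.
  induction n as [n IH] using lt_wf_ind. intros Hn.
  destruct (primeb n) eqn:E.
  - exists n; split; [exact E | apply Nat.divide_refl].
  - unfold primeb in E. replace (Nat.leb 2 n) with true in E by (symmetry; apply Nat.leb_le; lia).
    simpl in E.
    assert (exists d, In d (seq 2 (n - 2)) /\ dvdb d n = true) as (d & Hd & Dd).
    { apply Bool.not_true_iff_false in E.
      destruct (existsb (fun d => dvdb d n) (seq 2 (n - 2))) eqn:F.
      - apply existsb_exists in F. exact F.
      - exfalso. apply E. apply forallb_forall. intros d Hd.
        apply Bool.negb_true_iff. apply Bool.not_true_iff_false. intros G.
        apply Bool.not_true_iff_false in F. apply F. apply existsb_exists. exists d; auto. }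
    apply in_seq in Hd. apply dvdb_spec in Dd; [|lia].
    destruct (IH d ltac:(lia) ltac:(lia)) as (p & Hp & Dp).
    exists p; split; [exact Hp|]. eapply Nat.divide_trans; eauto.
Qed.

Lemma prime_power_factor p n : primeb p = true -> (1 <= n)%nat ->
  exists k m, n = (p ^ k * m)%nat /\ ~ Nat.divide p m.
Proof.
  intros Hp. apply primeb_spec in Hp. destruct Hp as [Hp _].
  induction n as [n IH] using lt_wf_ind. intros Hn.
  destruct (dvdb p n) eqn:E.
  - apply dvdb_spec in E; [|lia]. destruct E as (n' & E).
    destruct (IH n' ltac:(nia) ltac:(nia)) as (k & m & E' & D).
    exists (S k), m; split; [|exact D]. rewrite E, E'. simpl. ring.
  - exists 0%nat, n; split; [simpl; lia|]. intros D. apply dvdb_spec in D; [congruence|lia].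
Qed.

Lemma prime_divides_power p r k m : primeb p = true -> primeb r = true ->
  Nat.divide r (p ^ k * m) -> r = p \/ Nat.divide r m.
Proof.
  intros Hp Hr. induction k as [|k IH]; intros D.
  - right. simpl in D. rewrite Nat.add_0_r in D. exact D.
  - simpl in D. rewrite <- Nat.mul_assoc in D.
    destruct (dvdb r p) eqn:E.
    + apply primeb_spec in Hp. apply primeb_spec in Hr.
      apply dvdb_spec in E; [|lia]. destruct (proj2 Hp r E); [lia|auto].
    + apply IH. apply (Nat.gauss r p); [exact D|]. apply primeb_gcd; [exact Hr|].
      intros F. apply dvdb_spec in F; [congruence|]. apply primeb_spec in Hr. lia.
Qed.

Lemma divisor_split p d k m : primeb p = true ->
  Nat.divide d (p ^ S k * m) ->
  Nat.divide d (p ^ k * m) \/ exists d', d = (p ^ S k * d')%nat /\ Nat.divide d' m.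
Proof.
  intros Hp. revert d. assert (P2 : (2 <= p)%nat) by (apply primeb_spec in Hp; lia).
  induction k as [|k IH]; intros d D.
  - simpl (p ^ 1)%nat in *. rewrite Nat.mul_1_r in *. simpl (p ^ 0)%nat. rewrite Nat.mul_1_l.
    destruct (dvdb p d) eqn:E.
    + right. apply dvdb_spec in E; [|lia]. destruct E as (d' & E). exists d'. split; [lia|].
      subst d. rewrite (Nat.mul_comm d' p) in D. apply Nat.mul_divide_cancel_l in D; [exact D|lia].
    + left. apply (Nat.gauss d p); [exact D|]. rewrite Nat.gcd_comm. apply primeb_gcd; [exact Hp|].
      intros F. apply dvdb_spec in F; [congruence|lia].
  - assert (E0 : (p ^ S (S k) * m = p * (p ^ S k * m))%nat) by (simpl; ring). rewrite E0 in D.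
    destruct (dvdb p d) eqn:E.
    + apply dvdb_spec in E; [|lia]. destruct E as (d1 & E). rewrite (Nat.mul_comm d1 p) in E.
      subst d. apply Nat.mul_divide_cancel_l in D; [|lia].
      destruct (IH d1 D) as [L|(d' & L & L')].
      * left. replace (p ^ S k * m)%nat with (p * (p ^ k * m))%nat by (simpl; ring).
        apply Nat.mul_divide_mono_l. exact L.
      * right. exists d'. split; [|exact L']. rewrite L. simpl; ring.
    + left. apply (Nat.gauss d p); [exact D|]. rewrite Nat.gcd_comm. apply primeb_gcd; [exact Hp|].
      intros F. apply dvdb_spec in F; [congruence|lia].
Qed.

Fixpoint rprod (f : nat -> R) (n : nat) : R :=
  match n with O => 1 | S n' => rprod f n' * f n' end.

Lemma rprod_ext f g n : (forall i, (i < n)%nat -> f i = g i) -> rprod f n = rprod g n.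
Proof. intros H; induction n; simpl; [reflexivity|]. rewrite IHn, H; auto. Qed.

Lemma rprod_mult f g n : rprod (fun i => f i * g i) n = rprod f n * rprod g n.
Proof. induction n; simpl; [ring|]. rewrite IHn; ring. Qed.

Lemma rprod_one f n : (forall i, (i < n)%nat -> f i = 1) -> rprod f n = 1.
Proof. intros H; induction n; simpl; [reflexivity|]. rewrite IHn, H; auto; ring. Qed.

Lemma rprod_extend f n N : (n <= N)%nat -> (forall i, (n <= i < N)%nat -> f i = 1) ->
  rprod f N = rprod f n.
Proof.
  intros L; induction L as [|N L IH]; intros H; [reflexivity|].
  simpl. rewrite IH, H; try lia; try ring. intros; apply H; lia.
Qed.

Lemma rprod_single f n i0 : (i0 < n)%nat -> (forall i, i <> i0 -> f i = 1) -> rprod f n = f i0.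
Proof.
  induction n; intros L H; [lia|]. simpl. destruct (Nat.eq_dec i0 n) as [E|E].
  - subst. rewrite rprod_one; [ring|]. intros; apply H; lia.
  - rewrite IHn, (H n) by (auto; lia). ring.
Qed.

Definition prime_factor (n r : nat) : R := if (primeb r && dvdb r n)%bool then 1 - INR r else 1.

(** A multiplicative function with value (1 - p)/p^k = p^(-k) - p^(-(k-1)) at a prime power. *)
Definition inv_weight (n : nat) : R := rprod (fun i => prime_factor n (S i)) n / INR n.

Lemma inv_weight_mult p k m : primeb p = true -> (1 <= m)%nat -> ~ Nat.divide p m ->
  inv_weight (p ^ S k * m) = (1 - INR p) / INR p ^ S k * inv_weight m.
Proof.
  intros Hp Hm D. pose proof Hp as Hp'. apply primeb_spec in Hp'. destruct Hp' as [P2 _].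
  unfold inv_weight.
  assert (Pp : (1 <= p ^ k)%nat) by (pose proof (Nat.pow_nonzero p k); lia).
  assert (N : (p ^ S k = p * p ^ k)%nat) by reflexivity.
  assert (L : (m <= p ^ S k * m)%nat) by nia.
  rewrite (rprod_ext _ (fun i => prime_factor m (S i) * (if Nat.eqb (S i) p then 1 - INR p else 1))).
  - rewrite rprod_mult, (rprod_extend (fun i => prime_factor m (S i)) m); [|exact L|].
    + rewrite (rprod_single (fun i => if Nat.eqb (S i) p then 1 - INR p else 1) _ (p - 1)).
      * replace (S (p - 1)) with p by lia. rewrite Nat.eqb_refl, mult_INR, pow_INR.
        assert (0 < INR p) by (apply lt_0_INR; lia). assert (0 < INR m) by (apply lt_0_INR; lia).
        field. split; [lra|]. apply pow_nonzero; lra.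
      * nia.
      * intros i Hi. destruct (Nat.eqb_spec (S i) p); [lia|reflexivity].
    + intros i Hi. unfold prime_factor. destruct (dvdb (S i) m) eqn:E.
      * apply dvdb_spec in E; [|lia]. apply Nat.divide_pos_le in E; lia.
      * rewrite Bool.andb_false_r. reflexivity.
  - intros i Hi. unfold prime_factor. destruct (primeb (S i)) eqn:Er; cbn [andb].
    + destruct (Nat.eqb_spec (S i) p) as [E|E].
      * replace (dvdb (S i) m) with false.
        2:{ symmetry. apply Bool.not_true_iff_false. rewrite dvdb_spec by lia. rewrite E. exact D. }
        replace (dvdb (S i) (p ^ S k * m)) with true; [rewrite E; ring|].
        symmetry. apply dvdb_spec; [lia|]. rewrite E, N. exists (p ^ k * m)%nat. ring.
      * replace (dvdb (S i) (p ^ S k * m)) with (dvdb (S i) m); [ring|].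
        apply Bool.eq_iff_eq_true. rewrite !dvdb_spec by lia. split; intros H.
        -- apply Nat.divide_mul_r. exact H.
        -- destruct (prime_divides_power p (S i) (S k) m Hp Er H); [contradiction|assumption].
    + destruct (Nat.eqb_spec (S i) p) as [E|E]; [congruence|ring].
Qed.

Lemma rsum_extend f n N : (n <= N)%nat -> (forall i, (n <= i < N)%nat -> f i = 0) ->
  rsum f N = rsum f n.
Proof.
  intros L; induction L as [|N L IH]; intros H; [reflexivity|].
  simpl. rewrite IH, H; try lia; try ring. intros; apply H; lia.
Qed.

Lemma inv_weight_one : inv_weight 1 = 1.
Proof.
  unfold inv_weight. rewrite rprod_one; [simpl; field|].
  intros i Hi. assert (i = 0%nat) by lia. subst i. reflexivity.
Qed.

(** Induction on n = p^(k+1) m with p not dividing m. A divisor of n either divides n' = n/p, and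
    these contribute 1/n', or equals p^(k+1) d' with d' | m, and these contribute (1 - p)/(p^(k+1)
    m). The total is (1/n')(1 + (1 - p)/p) = 1/n. *)
Lemma inv_weights_exist : inv_weights inv_weight.
Proof.
  assert (G : forall n, (1 <= n)%nat -> Rabs (inv_weight n) <= 1 /\
     rsum (fun i => if dvdb (S i) n then inv_weight (S i) else 0) n = / INR n).
  { induction n as [n IH] using lt_wf_ind. intros Hn.
    destruct (Nat.eq_dec n 1) as [->|N1].
    { rewrite inv_weight_one. split; [rewrite Rabs_R1; lra|].
      simpl. rewrite inv_weight_one. lra. }
    destruct (prime_divisor_exists n ltac:(lia)) as (p & Hp & Dp).
    destruct (prime_power_factor p n Hp Hn) as (k0 & m & En & Dm).
    destruct k0 as [|k].
    { exfalso. simpl in En. rewrite Nat.add_0_r in En. subst m. contradiction. }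
    pose proof Hp as Hp'. apply primeb_spec in Hp'. destruct Hp' as [P2 _].
    assert (Pk : (1 <= p ^ k)%nat) by (pose proof (Nat.pow_nonzero p k); lia).
    assert (Ek : (p ^ S k = p * p ^ k)%nat) by reflexivity.
    assert (Pm : (1 <= m)%nat) by (destruct m; [rewrite Nat.mul_0_r in En; lia | lia]).
    set (n' := (p ^ k * m)%nat).
    assert (En' : (n = p * n')%nat) by (unfold n'; rewrite En, Ek; ring).
    destruct (IH m ltac:(nia) Pm) as [Bm Sm].
    destruct (IH n' ltac:(nia) ltac:(nia)) as [_ Sn'].
    assert (Rp : 2 <= INR p) by (apply le_INR in P2; simpl in P2; lra).
    assert (Rk : 1 <= INR p ^ k) by (apply pow_R1_Rle; lra).
    assert (Rm : 1 <= INR m) by (apply le_INR in Pm; exact Pm).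
    split.
    - rewrite En, inv_weight_mult by assumption. rewrite Rabs_mult.
      apply Rle_trans with (1 * 1); [|lra].
      apply Rmult_le_compat; auto using Rabs_pos.
      simpl pow. rewrite Rabs_left1.
      + replace (- ((1 - INR p) / (INR p * INR p ^ k))) with ((INR p - 1) / (INR p * INR p ^ k))
          by (field; lra).
        apply Rle_div_l; nra.
      + replace ((1 - INR p) / (INR p * INR p ^ k)) with (- ((INR p - 1) / (INR p * INR p ^ k)))
          by (field; lra).
        assert (0 <= (INR p - 1) / (INR p * INR p ^ k)) by (apply Rdiv_le_0_compat; nra). lra.
    - transitivity (rsum (fun i => if dvdb (S i) n' then inv_weight (S i) else 0) n +
        rsum (fun i => if dvdb (p ^ S k) (S i)
          then (if dvdb (S i / p ^ S k) m then inv_weight (S i) else 0) else 0) n).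
      + rewrite <- rsum_plus. apply rsum_ext. intros i Hi.
        destruct (dvdb (p ^ S k) (S i)) eqn:E1.
        * pose proof E1 as E1'. apply dvdb_spec in E1'; [|nia]. destruct E1' as (d' & Ed).
          rewrite Nat.mul_comm in Ed.
          replace (S i / p ^ S k)%nat with d' by (rewrite Ed, Nat.mul_comm, Nat.div_mul; nia).
          replace (dvdb (S i) n') with false.
          2:{ symmetry. apply Bool.not_true_iff_false. rewrite dvdb_spec by lia. intros (e & He).
              apply Dm. exists (e * d')%nat. unfold n' in He. rewrite Ed, Ek in He.
              apply (Nat.mul_cancel_l _ _ (p ^ k)); [lia|]. rewrite He. ring. }
          rewrite Rplus_0_l. f_equal.
          replace (dvdb (S i) n) with (dvdb d' m); [reflexivity|].
          apply Bool.eq_iff_eq_true. rewrite !dvdb_spec by nia. rewrite Ed, En.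
          symmetry. apply Nat.mul_divide_cancel_l. nia.
        * rewrite Rplus_0_r.
          replace (dvdb (S i) n) with (dvdb (S i) n'); [reflexivity|].
          apply Bool.eq_iff_eq_true. rewrite !dvdb_spec by lia. split; intros H.
          -- rewrite En'. apply Nat.divide_mul_r. exact H.
          -- rewrite En in H. destruct (divisor_split p (S i) k m Hp H) as [L|(d' & L & _)]; [exact L|].
             exfalso. apply Bool.not_true_iff_false in E1. apply E1. apply dvdb_spec; [nia|].
             exists d'. rewrite L. ring.
      + rewrite (rsum_extend (fun i => if dvdb (S i) n' then inv_weight (S i) else 0) n').
        2: nia.
        2:{ intros i Hi. destruct (dvdb (S i) n') eqn:E; [exfalso|reflexivity].
            apply dvdb_spec in E; [|lia]. apply Nat.divide_pos_le in E; nia. }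
        rewrite Sn'.
        rewrite (rsum_multiples (fun x => if dvdb (x / p ^ S k) m then inv_weight x else 0)) by nia.
        replace (n / p ^ S k)%nat with m by (rewrite En, Nat.mul_comm, Nat.div_mul; nia).
        rewrite (rsum_ext _ (fun j => (1 - INR p) / INR p ^ S k *
                    (if dvdb (S j) m then inv_weight (S j) else 0))).
        * rewrite rsum_scal, Sm. unfold n'. rewrite En, !mult_INR, !pow_INR. simpl pow.
          field. lra.
        * intros j Hj.
          replace (p ^ S k * S j / p ^ S k)%nat with (S j)
            by (rewrite Nat.mul_comm, Nat.div_mul; nia).
          destruct (dvdb (S j) m) eqn:E; [|ring].
          apply inv_weight_mult; [exact Hp|lia|].
          intros F. apply Dm. eapply Nat.divide_trans; [exact F|].
          apply dvdb_spec in E; [exact E|lia]. }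
  split; intros n Hn; apply G; exact Hn.
Qed.

(** * The value of zeta(2) *)

Definition wallis (n : nat) : R := RInt (fun x => cos x ^ (2 * n)) 0 (PI / 2).
Definition wallis2 (n : nat) : R := RInt (fun x => x ^ 2 * cos x ^ (2 * n)) 0 (PI / 2).

Lemma ex_RInt_of_derivable (f : R -> R) a b : (forall x, ex_derive f x) -> ex_RInt f a b.
Proof.
  intros H. apply (ex_RInt_continuous f). intros x _.
  apply (ex_derive_continuous f). apply H.
Qed.

Lemma wallis_is n : is_RInt (fun x => cos x ^ (2 * n)) 0 (PI / 2) (wallis n).
Proof.
  apply (RInt_correct (fun x => cos x ^ (2 * n))). apply ex_RInt_of_derivable.
  intros x. auto_derive. exact I.
Qed.

Lemma wallis2_is n : is_RInt (fun x => x ^ 2 * cos x ^ (2 * n)) 0 (PI / 2) (wallis2 n).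
Proof.
  apply (RInt_correct (fun x => x ^ 2 * cos x ^ (2 * n))). apply ex_RInt_of_derivable.
  intros x. auto_derive. exact I.
Qed.

Lemma is_RInt_primitive (F f : R -> R) a b : (forall x, is_derive F x (f x)) ->
  (forall x, ex_derive f x) -> is_RInt f a b (F b - F a).
Proof.
  intros H1 H2. apply (is_RInt_derive F f).
  - intros; apply H1.
  - intros; apply (ex_derive_continuous f); apply H2.
Qed.

Lemma cos_double_pow x m : cos x ^ (2 * S m) = cos x ^ (2 * m) * (cos x * cos x).
Proof. replace (2 * S m)%nat with (2 * m + 2)%nat by lia. rewrite pow_add. ring. Qed.

Lemma sin_sq x : sin x * sin x = 1 - cos x * cos x.
Proof. pose proof (sin2_cos2 x) as H. unfold Rsqr in H. lra. Qed.

(** The combination of integrands is the derivative of sin x cos^(2m+1) x, which vanishes at both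
    ends. *)
Lemma wallis_rec m : 2 * INR (S m) * wallis (S m) = (2 * INR m + 1) * wallis m.
Proof.
  assert (A : is_RInt (fun x => 2 * INR (S m) * cos x ^ (2 * S m)
              + - (2 * INR m + 1) * cos x ^ (2 * m)) 0 (PI / 2)
      (2 * INR (S m) * wallis (S m) + - (2 * INR m + 1) * wallis m)).
  { apply (is_RInt_plus (V := R_NormedModule)
      (fun x => 2 * INR (S m) * cos x ^ (2 * S m)) (fun x => - (2 * INR m + 1) * cos x ^ (2 * m))).
    - apply (is_RInt_scal (V := R_NormedModule) (fun x => cos x ^ (2 * S m))). apply wallis_is.
    - apply (is_RInt_scal (V := R_NormedModule) (fun x => cos x ^ (2 * m))). apply wallis_is. }
  assert (B : is_RInt (fun x => 2 * INR (S m) * cos x ^ (2 * S m)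
              + - (2 * INR m + 1) * cos x ^ (2 * m)) 0 (PI / 2)
      (sin (PI / 2) * cos (PI / 2) ^ (2 * m + 1) - sin 0 * cos 0 ^ (2 * m + 1))).
  { apply (is_RInt_primitive (fun x => sin x * cos x ^ (2 * m + 1))).
    - intros x. auto_derive; [exact I|]. rewrite cos_double_pow.
      replace (Nat.pred (2 * m + 1)) with (2 * m)%nat by lia.
      replace (m + (m + 0) + 1)%nat with (2 * m + 1)%nat by lia.
      replace (Nat.pred (2 * m + 1)) with (2 * m)%nat by lia.
      rewrite (pow_add _ (2 * m) 1), plus_INR, mult_INR, (S_INR m). simpl (INR 2). simpl (INR 1).
      rewrite pow_1. set (c := cos x ^ (2 * m)).
      transitivity (cos x * (c * cos x) - (2 * INR m + 1) * c * (sin x * sin x)); [ring|].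
      rewrite sin_sq. ring.
    - intros x. auto_derive. exact I. }
  pose proof (is_RInt_unique _ _ _ _ A) as EA. rewrite (is_RInt_unique _ _ _ _ B) in EA.
  rewrite sin_0, cos_PI2, pow_add, pow_1 in EA. lra.
Qed.

(** Integrating cos^(2n) by parts twice, with n = m + 1, produces the primitive used below; its
    boundary values vanish. *)
Lemma wallis2_rec m : wallis (S m) + 2 * INR (S m) ^ 2 * wallis2 (S m)
  = INR (S m) * (2 * INR m + 1) * wallis2 m.
Proof.
  set (n := INR (S m)).
  assert (A : is_RInt (fun x => cos x ^ (2 * S m) + (2 * n ^ 2 * (x ^ 2 * cos x ^ (2 * S m))
              + - (n * (2 * INR m + 1)) * (x ^ 2 * cos x ^ (2 * m)))) 0 (PI / 2)
      (wallis (S m) + (2 * n ^ 2 * wallis2 (S m) + - (n * (2 * INR m + 1)) * wallis2 m))).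
  { apply (is_RInt_plus (V := R_NormedModule) (fun x => cos x ^ (2 * S m))
      (fun x => 2 * n ^ 2 * (x ^ 2 * cos x ^ (2 * S m))
              + - (n * (2 * INR m + 1)) * (x ^ 2 * cos x ^ (2 * m)))); [apply wallis_is|].
    apply (is_RInt_plus (V := R_NormedModule) (fun x => 2 * n ^ 2 * (x ^ 2 * cos x ^ (2 * S m)))
      (fun x => - (n * (2 * INR m + 1)) * (x ^ 2 * cos x ^ (2 * m)))).
    - apply (is_RInt_scal (V := R_NormedModule) (fun x => x ^ 2 * cos x ^ (2 * S m))).
      apply wallis2_is.
    - apply (is_RInt_scal (V := R_NormedModule) (fun x => x ^ 2 * cos x ^ (2 * m))).
      apply wallis2_is. }
  assert (B : is_RInt (fun x => cos x ^ (2 * S m) + (2 * n ^ 2 * (x ^ 2 * cos x ^ (2 * S m))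
              + - (n * (2 * INR m + 1)) * (x ^ 2 * cos x ^ (2 * m)))) 0 (PI / 2)
      (((PI / 2) * cos (PI / 2) ^ (2 * m + 2)
          + n * ((PI / 2) ^ 2 * (sin (PI / 2) * cos (PI / 2) ^ (2 * m + 1))))
       - (0 * cos 0 ^ (2 * m + 2) + n * (0 ^ 2 * (sin 0 * cos 0 ^ (2 * m + 1)))))).
  { apply (is_RInt_primitive (fun x => x * cos x ^ (2 * m + 2)
             + n * (x ^ 2 * (sin x * cos x ^ (2 * m + 1))))).
    - intros x. auto_derive; [exact I|]. rewrite cos_double_pow.
      replace (m + (m + 0) + 1)%nat with (2 * m + 1)%nat by lia.
      replace (m + (m + 0) + 2)%nat with (2 * m + 2)%nat by lia.
      replace (Nat.pred (2 * m + 1)) with (2 * m)%nat by lia.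
      replace (Nat.pred (2 * m + 2)) with (2 * m + 1)%nat by lia.
      rewrite (pow_add _ (2 * m) 1), (pow_add _ (2 * m) 2), !plus_INR, mult_INR.
      unfold n. rewrite (S_INR m). simpl (INR 2). simpl (INR 1).
      rewrite pow_1. set (c := cos x ^ (2 * m)).
      transitivity (c * (cos x * cos x) + (INR m + 1) * x ^ 2 * (c * (cos x * cos x))
        - (INR m + 1) * (2 * INR m + 1) * x ^ 2 * c * (sin x * sin x)); [ring|].
      rewrite sin_sq. ring.
    - intros x. auto_derive. exact I. }
  pose proof (is_RInt_unique _ _ _ _ A) as EA. rewrite (is_RInt_unique _ _ _ _ B) in EA.
  rewrite sin_0, cos_PI2, !pow_add, pow_1 in EA.
  assert (Z : 0 ^ 2 = 0) by ring. rewrite Z in EA. lra.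
Qed.

Lemma wallis_0 : wallis 0 = PI / 2.
Proof.
  unfold wallis. simpl. rewrite RInt_const. unfold scal; simpl; unfold mult; simpl. ring.
Qed.

Lemma wallis_pos n : 0 < wallis n.
Proof.
  induction n as [|n IH].
  - rewrite wallis_0. pose proof PI_RGT_0. lra.
  - pose proof (wallis_rec n) as E. pose proof (INR_S_pos n). pose proof (pos_INR n).
    assert (0 < 2 * INR (S n) * wallis (S n)) by (rewrite E; apply Rmult_lt_0_compat; lra).
    apply (Rmult_lt_reg_l (2 * INR (S n))); lra.
Qed.

Lemma wallis2_0 : wallis2 0 = PI ^ 3 / 24.
Proof.
  apply is_RInt_unique.
  replace (PI ^ 3 / 24) with ((PI / 2) ^ 3 / 3 - 0 ^ 3 / 3) by field.
  apply (is_RInt_primitive (fun x => x ^ 3 / 3)).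
  - intros x. auto_derive; [exact I|]. simpl. field.
  - intros x. auto_derive. exact I.
Qed.

Lemma x_cos_le_sin x : 0 <= x <= PI / 2 -> x * cos x <= sin x.
Proof.
  intros [H0 H1].
  assert (A : is_RInt (fun y => y * sin y) 0 x ((sin x - x * cos x) - (sin 0 - 0 * cos 0))).
  { apply (is_RInt_primitive (fun y => sin y - y * cos y)).
    - intros y. auto_derive; [exact I|]. ring.
    - intros y. auto_derive. exact I. }
  assert (B : 0 <= (sin x - x * cos x) - (sin 0 - 0 * cos 0)).
  { rewrite <- (is_RInt_unique _ _ _ _ A). apply RInt_ge_0; [exact H0| eexists; exact A |].
    intros y Hy. pose proof PI_RGT_0. apply Rmult_le_pos; [lra|]. apply sin_ge_0; lra. }
  rewrite sin_0 in B. lra.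
Qed.

(** From x cos x <= sin x, the integrand is at most cos^(2m) sin^2 = cos^(2m) - cos^(2m+2). *)
Lemma wallis2_bounds m : 0 <= wallis2 (S m) <= wallis m - wallis (S m).
Proof.
  pose proof PI_RGT_0. split.
  - unfold wallis2. apply RInt_ge_0; [lra | eexists; apply wallis2_is |].
    intros x Hx. apply Rmult_le_pos; [apply pow2_ge_0|]. rewrite pow_mult. apply pow_le, pow2_ge_0.
  - assert (A : is_RInt (fun x => cos x ^ (2 * m) + - cos x ^ (2 * S m)) 0 (PI / 2)
        (wallis m + - wallis (S m))).
    { apply (is_RInt_plus (V := R_NormedModule) (fun x => cos x ^ (2 * m))
        (fun x => - cos x ^ (2 * S m))); [apply wallis_is|].
      apply (is_RInt_opp (V := R_NormedModule) (fun x => cos x ^ (2 * S m))). apply wallis_is. }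
    change (wallis m - wallis (S m)) with (wallis m + - wallis (S m)).
    rewrite <- (is_RInt_unique _ _ _ _ A). unfold wallis2.
    apply RInt_le; [lra | eexists; apply wallis2_is | eexists; exact A |].
    intros x Hx. rewrite cos_double_pow.
    assert (C0 : 0 <= cos x ^ (2 * m)) by (rewrite pow_mult; apply pow_le, pow2_ge_0).
    pose proof (x_cos_le_sin x ltac:(lra)) as J.
    assert (C1 : 0 <= cos x) by (apply cos_ge_0; lra).
    pose proof (sin_sq x) as S2.
    assert (K : (x * cos x) * (x * cos x) <= sin x * sin x).
    { assert (0 <= x * cos x) by (apply Rmult_le_pos; lra). apply Rmult_le_compat; lra. }
    replace (x ^ 2 * (cos x ^ (2 * m) * (cos x * cos x)))
      with (cos x ^ (2 * m) * ((x * cos x) * (x * cos x))) by ring.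
    replace (cos x ^ (2 * m) + - (cos x ^ (2 * m) * (cos x * cos x)))
      with (cos x ^ (2 * m) * (1 - cos x * cos x)) by ring.
    apply Rmult_le_compat_l; lra.
Qed.

(* Matsuoka's proof of [zeta(2) = pi^2/6]: the partial sums telescope. *)
Lemma zeta2_telescope n :
  rsum (fun i => / INR (S i) ^ 2) n = PI ^ 2 / 6 - 2 * (wallis2 n / wallis n).
Proof.
  induction n as [|n IH].
  - cbn [rsum]. rewrite wallis_0, wallis2_0. pose proof PI_RGT_0. field. lra.
  - cbn [rsum]. rewrite IH.
    pose proof (wallis_rec n) as E1. pose proof (wallis2_rec n) as E2.
    pose proof (wallis_pos n) as P1. pose proof (wallis_pos (S n)) as P2.
    pose proof (INR_S_pos n) as P3. pose proof (pos_INR n) as P4.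
    enough (wallis2 n / wallis n = wallis2 (S n) / wallis (S n) + / (2 * INR (S n) ^ 2)) as ->.
    { field. lra. }
    set (N := INR (S n)) in *. set (a := 2 * INR n + 1) in *.
    assert (Pa : 0 < a) by (unfold a; lra).
    assert (W : wallis n = 2 * N * wallis (S n) / a).
    { apply (Rmult_eq_reg_l a); [|lra]. rewrite <- E1. field. lra. }
    assert (V : wallis2 n = (wallis (S n) + 2 * N ^ 2 * wallis2 (S n)) / (N * a)).
    { apply (Rmult_eq_reg_l (N * a)); [|nra]. rewrite <- E2. field. lra. }
    rewrite W, V. field. lra.
Qed.

Lemma zeta2_bounds n : (1 <= n)%nat ->
  PI ^ 2 / 6 - 2 / INR n <= rsum (fun i => / INR (S i) ^ 2) n <= PI ^ 2 / 6.
Proof.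
  intros Hn. rewrite zeta2_telescope. destruct n as [|m]; [lia|].
  pose proof (wallis2_bounds m) as [B1 B2]. pose proof (wallis_pos (S m)) as P.
  pose proof (wallis_rec m) as E. pose proof (pos_INR m) as P0.
  rewrite S_INR in *.
  assert (0 <= wallis2 (S m) / wallis (S m)) by (apply Rdiv_le_0_compat; lra).
  assert (wallis2 (S m) / wallis (S m) <= 1 / (INR m + 1)).
  { apply Rle_div_l; [exact P|].
    assert (E' : wallis m - wallis (S m) = wallis (S m) / (2 * INR m + 1)).
    { apply (Rmult_eq_reg_l (2 * INR m + 1)); [|lra]. rewrite Rmult_minus_distr_l, <- E.
      field. lra. }
    rewrite E' in B2. eapply Rle_trans; [exact B2|].
    unfold Rdiv. rewrite Rmult_1_l, Rmult_comm. apply Rmult_le_compat_r; [lra|].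
    apply Rinv_le_contravar; lra. }
  unfold Rdiv in *. lra.
Qed.

(** * Asymptotics of the horizontal period *)

(** A partial sum of the Dirichlet series of [c] at 2, whose value is zeta(3)/zeta(2). *)
Definition mean_weight (c : nat -> R) (n : nat) : R := rsum (fun k => c (S k) / INR (S k) ^ 2) n.

Lemma sum_squares n :
  rsum (fun j => INR (S j) ^ 2) n = INR n ^ 3 / 3 + INR n ^ 2 / 2 + INR n / 6.
Proof.
  induction n as [|n IH]; [simpl; field|].
  cbn [rsum]. rewrite IH, S_INR. field.
Qed.

Lemma INR_div_bounds n d : d <> 0%nat -> INR (n / d) <= INR n / INR d < INR (n / d) + 1.
Proof.
  intros H. split; [apply INR_div_le; exact H|].
  assert (0 < INR d) by (apply lt_0_INR; lia).
  apply Rlt_div_l; [assumption|]. rewrite <- S_INR, <- mult_INR. apply lt_INR.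
  pose proof (Nat.div_mod n d H). pose proof (Nat.mod_upper_bound n d H). nia.
Qed.

Lemma ratio_ge_1 n k : (k < n)%nat -> 1 <= INR n / INR (S k).
Proof.
  intros H. pose proof (INR_S_pos k). apply Rle_div_r; [assumption|].
  rewrite Rmult_1_l. apply le_INR. lia.
Qed.

Lemma period_mean_weight c n : inv_weights c ->
  Rabs (period n - INR n ^ 3 / 3 * mean_weight c n) <= INR n ^ 2 * harm n.
Proof.
  intros Hc.
  assert (E : period n = rsum (fun k => c (S k) *
                 (INR (S k) * rsum (fun j => INR (S j) ^ 2) (n / S k))) n).
  { unfold period, wsum.
    rewrite <- (rsum_ext (fun i => rsum (fun y => INR (S i) / INR (Nat.gcd (S i) y)) (S i))).
    2:{ intros i Hi. apply rsum_ext; intros y Hy. ring. }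
    rewrite (gcd_weighted_sum c (fun x y => INR x) n Hc).
    apply rsum_ext; intros k Hk. f_equal. rewrite <- rsum_scal. apply rsum_ext; intros j Hj.
    rewrite rsum_const, mult_INR. ring. }
  unfold mean_weight. rewrite E, <- rsum_scal, <- rsum_minus.
  eapply Rle_trans; [apply rsum_abs|].
  unfold harm. rewrite <- rsum_scal. apply rsum_le; intros k Hk.
  pose proof (INR_S_pos k) as P.
  pose proof (ratio_ge_1 n k Hk) as T1.
  pose proof (INR_div_bounds n (S k) ltac:(lia)) as [T2 T3].
  pose proof (pos_INR (n / S k)) as T4.
  rewrite sum_squares.
  set (tau := INR n / INR (S k)) in *. set (N := INR (n / S k)) in *.
  replace (c (S k) * (INR (S k) * (N ^ 3 / 3 + N ^ 2 / 2 + N / 6))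
           - INR n ^ 3 / 3 * (c (S k) / INR (S k) ^ 2))
    with (c (S k) * (INR (S k) * (N ^ 3 / 3 + N ^ 2 / 2 + N / 6 - tau ^ 3 / 3)))
    by (unfold tau; field; lra).
  replace (INR n ^ 2 * / INR (S k)) with (1 * (INR (S k) * tau ^ 2)) by (unfold tau; field; lra).
  rewrite Rabs_mult. apply Rmult_le_compat; try apply Rabs_pos.
  - apply Hc. lia.
  - rewrite Rabs_mult, (Rabs_pos_eq (INR (S k))) by lra.
    apply Rmult_le_compat_l; [lra|]. apply Rabs_le. split.
    (* Rounding tau down loses at most (tau^3 - (tau - 1)^3)/3 <= tau^2, since tau >= 1. *)
    + assert ((tau - 1) ^ 3 <= N ^ 3) by (apply pow_incr; lra). nra.
    + assert (N ^ 3 <= tau ^ 3) by (apply pow_incr; lra).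
      assert (N ^ 2 <= tau ^ 2) by (apply pow_incr; lra). nra.
Qed.

(** Finite form of zeta(2) times the series of c(k)/k^2 being zeta(3): one factor 1/i of 1/i^3 is
    expanded over the divisors of i, and the sums are exchanged. *)
Lemma cubes_mean_weight c n : inv_weights c -> (1 <= n)%nat ->
  Rabs (PI ^ 2 / 6 * mean_weight c n - rsum (fun i => / INR (S i) ^ 3) n) <= 4 / INR n * harm n.
Proof.
  intros Hc Hn.
  assert (Pn : 0 < INR n) by (apply lt_0_INR; lia).
  assert (E : rsum (fun i => / INR (S i) ^ 3) n = rsum (fun k => c (S k) / INR (S k) ^ 2 *
                 rsum (fun j => / INR (S j) ^ 2) (n / S k)) n).
  { transitivity (rsum (fun i => rsum (fun k => c (S k) *
                     (if dvdb (S k) (S i) then / INR (S i) ^ 2 else 0)) n) n).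
    - apply rsum_ext; intros i Hi. pose proof (INR_S_pos i).
      pose proof (inv_weights_gcd c (S i) (S i) n Hc ltac:(lia)) as G.
      rewrite Nat.gcd_diag in G.
      replace (/ INR (S i) ^ 3) with (/ INR (S i) ^ 2 * / INR (S i)) by (field; lra).
      rewrite G, <- rsum_scal. apply rsum_ext; intros k Hk.
      destruct (dvdb (S k) (S i)); simpl; ring.
    - rewrite rsum_swap. apply rsum_ext; intros k Hk.
      rewrite rsum_scal, (rsum_multiples (fun x => / INR x ^ 2)) by lia.
      unfold Rdiv. rewrite Rmult_assoc. f_equal. rewrite <- rsum_scal.
      apply rsum_ext; intros j Hj. rewrite mult_INR.
      pose proof (INR_S_pos k). pose proof (INR_S_pos j). field. lra. }
  rewrite E. unfold mean_weight. rewrite <- rsum_scal, <- rsum_minus.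
  eapply Rle_trans; [apply rsum_abs|].
  unfold harm. rewrite <- rsum_scal. apply rsum_le; intros k Hk.
  pose proof (INR_S_pos k) as P.
  pose proof (ratio_ge_1 n k Hk) as T1.
  pose proof (INR_div_bounds n (S k) ltac:(lia)) as [T2 T3].
  assert (N1 : (1 <= n / S k)%nat).
  { destruct (n / S k)%nat; [change (INR 0) with 0 in T3; lra | lia]. }
  pose proof (zeta2_bounds (n / S k) N1) as B.
  apply le_INR in N1. change (INR 1) with 1 in N1.
  set (Z := rsum (fun j => / INR (S j) ^ 2) (n / S k)) in *.
  replace (PI ^ 2 / 6 * (c (S k) / INR (S k) ^ 2) - c (S k) / INR (S k) ^ 2 * Z)
    with (c (S k) * (/ INR (S k) ^ 2 * (PI ^ 2 / 6 - Z))) by (field; lra).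
  replace (4 / INR n * / INR (S k)) with (1 * (/ INR (S k) ^ 2 * (4 * / (INR n / INR (S k)))))
    by (field; lra).
  rewrite Rabs_mult. apply Rmult_le_compat; try apply Rabs_pos.
  - apply Hc. lia.
  - assert (0 < / INR (S k) ^ 2) by (apply Rinv_0_lt_compat, pow_lt; lra).
    rewrite Rabs_mult, (Rabs_pos_eq (/ INR (S k) ^ 2)) by lra.
    apply Rmult_le_compat_l; [lra|]. rewrite Rabs_pos_eq by lra.
    apply Rle_trans with (2 / INR (n / S k)); [lra|].
    (* N >= 1 and N > tau - 1 give N >= tau/2, hence 2/N <= 4/tau. *)
    set (tau := INR n / INR (S k)) in *. set (N := INR (n / S k)) in *.
    replace (4 * / tau) with (2 * / (tau / 2)) by (field; lra).
    unfold Rdiv. apply Rmult_le_compat_l; [lra|]. apply Rinv_le_contravar; lra.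
Qed.

Lemma cubes_tail n m : (1 <= n)%nat ->
  0 <= rsum (fun i => / INR (S i) ^ 3) (n + m) - rsum (fun i => / INR (S i) ^ 3) n
    <= / INR n - / INR (n + m).
Proof.
  intros Hn. assert (Pn : 1 <= INR n) by (apply le_INR in Hn; exact Hn).
  induction m as [|m IH].
  - rewrite Nat.add_0_r. lra.
  - rewrite Nat.add_succ_r. cbn [rsum]. rewrite S_INR.
    set (x := INR (n + m)) in *.
    assert (Px : 1 <= x) by (unfold x; rewrite plus_INR; pose proof (pos_INR m); lra).
    assert (0 < / (x + 1) ^ 3) by (apply Rinv_0_lt_compat, pow_lt; lra).
    assert (/ (x + 1) ^ 3 <= / x - / (x + 1)).
    { replace (/ x - / (x + 1)) with (/ (x * (x + 1))) by (field; lra).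
      apply Rinv_le_contravar; nra. }
    lra.
Qed.

Lemma zeta3_lim : is_lim_seq (fun n => rsum (fun i => / INR (S i) ^ 3) (S n)) zeta3.
Proof.
  set (u := fun n => rsum (fun i => / INR (S i) ^ 3) (S n)).
  assert (EX : ex_finite_lim_seq u).
  { apply (ex_finite_lim_seq_incr u 2).
    - intros n. pose proof (cubes_tail (S n) 1 ltac:(lia)) as H.
      rewrite Nat.add_1_r in H. unfold u. lra.
    - intros n. pose proof (cubes_tail 1 n ltac:(lia)) as H. unfold u.
      change (1 + n)%nat with (S n) in H.
      assert (0 < / INR (S n)) by (apply Rinv_0_lt_compat, INR_S_pos).
      change (rsum (fun i => / INR (S i) ^ 3) 1) with (0 + / 1 ^ 3) in H.
      change (INR 1) with 1 in H. rewrite pow1, Rinv_1 in H. lra. }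
  apply Lim_seq_correct' in EX.
  replace zeta3 with (real (Lim_seq u)); [exact EX|].
  unfold zeta3, Series. f_equal. apply Lim_seq_ext. intros n. unfold u.
  induction n as [|n IH].
  - rewrite sum_O. simpl. ring.
  - rewrite sum_Sn, <- IH. reflexivity.
Qed.

Lemma zeta3_bounds n : (1 <= n)%nat ->
  rsum (fun i => / INR (S i) ^ 3) n <= zeta3 <= rsum (fun i => / INR (S i) ^ 3) n + / INR n.
Proof.
  intros Hn.
  assert (L : is_lim_seq (fun m => rsum (fun i => / INR (S i) ^ 3) (n + m)) zeta3).
  { apply (is_lim_seq_ext (fun m => rsum (fun i => / INR (S i) ^ 3) (S (m + (n - 1))))).
    - intros m. f_equal. lia.
    - apply (is_lim_seq_incr_n (fun m => rsum (fun i => / INR (S i) ^ 3) (S m)) (n - 1)).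
      apply zeta3_lim. }
  split.
  - apply (is_lim_seq_le (fun _ => rsum (fun i => / INR (S i) ^ 3) n)
             (fun m => rsum (fun i => / INR (S i) ^ 3) (n + m))
             (rsum (fun i => / INR (S i) ^ 3) n) zeta3).
    + intros m. pose proof (cubes_tail n m Hn). lra.
    + apply is_lim_seq_const.
    + exact L.
  - apply (is_lim_seq_le (fun m => rsum (fun i => / INR (S i) ^ 3) (n + m))
             (fun _ => rsum (fun i => / INR (S i) ^ 3) n + / INR n)
             zeta3 (rsum (fun i => / INR (S i) ^ 3) n + / INR n)).
    + intros m. pose proof (cubes_tail n m Hn).
      assert (0 < / INR (n + m)) by (apply Rinv_0_lt_compat, lt_0_INR; lia). lra.
    + exact L.
    + apply is_lim_seq_const.
Qed.

Lemma zeta3_range : 1 <= zeta3 <= 2.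
Proof.
  pose proof (zeta3_bounds 1 ltac:(lia)) as H.
  change (rsum (fun i => / INR (S i) ^ 3) 1) with (0 + / 1 ^ 3) in H.
  change (INR 1) with 1 in H. rewrite pow1, Rinv_1 in H. lra.
Qed.

Lemma harm_ge_1 n : (1 <= n)%nat -> 1 <= harm n.
Proof.
  intros Hn. destruct n as [|n]; [lia|]. unfold harm. rewrite rsum_head.
  change (INR 1) with 1. rewrite Rinv_1.
  assert (0 <= rsum (fun i => / INR (S (S i))) n).
  { apply rsum_nonneg; intros i Hi. left. apply Rinv_0_lt_compat, INR_S_pos. }
  lra.
Qed.

Lemma c_g_cube : c_g ^ 3 = PI ^ 2 / (2 * zeta3).
Proof.
  pose proof zeta3_range. pose proof PI_RGT_0.
  assert (0 < PI ^ 2 / (2 * zeta3)) by (apply Rdiv_lt_0_compat; [apply pow_lt|]; lra).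
  unfold c_g. rewrite <- Rpower_pow by (apply exp_pos). rewrite Rpower_mult.
  replace (1 / 3 * INR 3) with 1 by (simpl; field). apply Rpower_1. assumption.
Qed.

(** The origin of [c_g]: (n^3/3) * 6 zeta(3)/pi^2 = n^3/c_g^3. The constant 3 is 1 from
    [period_mean_weight] plus 10/pi^2 <= 2, where 10 = 2 (4 + 1) includes the tail of zeta(3). *)
Lemma period_asymptotics c n : inv_weights c -> (1 <= n)%nat ->
  Rabs (period n - INR n ^ 3 / c_g ^ 3) <= 3 * INR n ^ 2 * harm n.
Proof.
  intros Hc Hn.
  pose proof (period_mean_weight c n Hc) as A.
  pose proof (cubes_mean_weight c n Hc Hn) as B.
  pose proof (zeta3_bounds n Hn) as C.
  pose proof (harm_ge_1 n Hn) as D.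
  pose proof zeta3_range as Z.
  assert (Pn : 1 <= INR n) by (apply le_INR in Hn; exact Hn).
  pose proof PI_RGT_0 as P0.
  assert (P9 : 9 < PI ^ 2) by (pose proof PI2_3_2; nra).
  rewrite c_g_cube.
  set (C3 := rsum (fun i => / INR (S i) ^ 3) n) in *. set (mw := mean_weight c n) in *.
  set (N := INR n) in *. set (h := harm n) in *.
  assert (In : 0 < / N) by (apply Rinv_0_lt_compat; lra).
  assert (B' : Rabs (PI ^ 2 / 6 * mw - zeta3) <= 5 * (/ N * h)).
  { replace (PI ^ 2 / 6 * mw - zeta3) with ((PI ^ 2 / 6 * mw - C3) + (C3 - zeta3)) by ring.
    eapply Rle_trans; [apply Rabs_triang|].
    assert (Rabs (C3 - zeta3) <= / N) by (apply Rabs_le; lra).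
    assert (/ N <= / N * h) by nra. unfold Rdiv in B. lra. }
  replace (period n - N ^ 3 / (PI ^ 2 / (2 * zeta3)))
    with ((period n - N ^ 3 / 3 * mw) + 2 * N ^ 3 / PI ^ 2 * (PI ^ 2 / 6 * mw - zeta3))
    by (field; lra).
  eapply Rle_trans; [apply Rabs_triang|].
  assert (E : Rabs (2 * N ^ 3 / PI ^ 2 * (PI ^ 2 / 6 * mw - zeta3)) <= 2 * N ^ 2 * h).
  { assert (PN : 0 < 2 * N ^ 3 / PI ^ 2) by (apply Rdiv_lt_0_compat; [|lra]; assert (0 < N ^ 3) by (apply pow_lt; lra); lra).
    rewrite Rabs_mult, (Rabs_pos_eq (2 * N ^ 3 / PI ^ 2)) by lra.
    eapply Rle_trans; [apply Rmult_le_compat_l; [lra|exact B']|].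
    replace (2 * N ^ 3 / PI ^ 2 * (5 * (/ N * h))) with (10 / PI ^ 2 * (N ^ 2 * h)) by (field; lra).
    assert (10 / PI ^ 2 <= 2) by (apply Rle_div_l; lra).
    assert (0 <= N ^ 2 * h) by (apply Rmult_le_pos; [apply pow2_ge_0|lra]). nra. }
  lra.
Qed.

(** * Monotonicity, equivariance, comparison with a parabola *)

Lemma conv_mono (U V : pt -> Prop) P : (forall Q, U Q -> V Q) -> conv U P -> conv V P.
Proof. intros H HP C HC HV. apply HP; auto. Qed.

(** A point of the smaller set that is extreme in the larger hull is also extreme in the smaller
    hull, so survivors of [U] survive in [V]. *)
Lemma peel_mono (U V : pt -> Prop) : (forall Q, U Q -> V Q) -> forall P, peel U P -> peel V P.
Proof.
  intros H P [HP NE]. split; [auto|]. intros [_ HE]. apply NE.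
  split; [apply conv_incl; exact HP|].
  intros Q1 Q2 l H1 H2. apply HE; eapply conv_mono; eauto.
Qed.

Lemma peel_iter_mono m (U V : pt -> Prop) :
  (forall Q, U Q -> V Q) -> forall P, peel_iter m U P -> peel_iter m V P.
Proof. intros H; induction m as [|m IH]; [exact H|]. exact (peel_mono _ _ IH). Qed.

Lemma peel_iter_level t m P : (1 <= t)%Z -> (t mod 2 = 1)%Z ->
  peel_iter m (level t 0) P <-> level t m P.
Proof.
  intros H1 H2. revert P. induction m as [|m IH]; intros P; [reflexivity|].
  rewrite <- (peel_level t m P H1 H2).
  split; apply peel_mono; intros Q; apply IH.
Qed.

(** Passage to grid units followed by an integer translation; such affine bijections commute with
    peeling. *)
Definition grid_coord (n : nat) (al be : Z) (P : pt) : pt :=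
  (INR n * fst P - IZR al, INR n * snd P - IZR be).

Definition grid_point (n : nat) (al be : Z) (P : pt) : pt :=
  ((fst P + IZR al) / INR n, (snd P + IZR be) / INR n).

Lemma grid_coord_comb n al be l P Q :
  grid_coord n al be (comb l P Q) = comb l (grid_coord n al be P) (grid_coord n al be Q).
Proof. unfold grid_coord, comb; simpl; f_equal; ring. Qed.

Lemma grid_point_comb n al be l P Q : (0 < n)%nat ->
  grid_point n al be (comb l P Q) = comb l (grid_point n al be P) (grid_point n al be Q).
Proof.
  intros Hn. apply lt_0_INR in Hn. unfold grid_point, comb; simpl; f_equal; field; lra.
Qed.

Lemma grid_point_coord n al be P : (0 < n)%nat -> grid_point n al be (grid_coord n al be P) = P.
Proof.
  intros Hn. apply lt_0_INR in Hn. destruct P. unfold grid_point, grid_coord; simpl.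
  f_equal; field; lra.
Qed.

Lemma grid_coord_point n al be P : (0 < n)%nat -> grid_coord n al be (grid_point n al be P) = P.
Proof.
  intros Hn. apply lt_0_INR in Hn. destruct P. unfold grid_point, grid_coord; simpl.
  f_equal; field; lra.
Qed.

Lemma conv_rescale n al be U P : (0 < n)%nat ->
  conv (fun Q => U (grid_coord n al be Q)) P <-> conv U (grid_coord n al be P).
Proof.
  intros Hn; split; intros H C HC HU.
  - apply (H (fun Q => C (grid_coord n al be Q))).
    + intros Q1 Q2 l H1 H2 Hl. rewrite grid_coord_comb. auto.
    + auto.
  - rewrite <- (grid_point_coord n al be P Hn).
    apply (H (fun Q => C (grid_point n al be Q))).
    + intros Q1 Q2 l H1 H2 Hl. rewrite grid_point_comb by assumption. auto.
    + intros Q HQ. apply HU. rewrite grid_coord_point; assumption.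
Qed.

Lemma peel_rescale n al be U P : (0 < n)%nat ->
  peel (fun Q => U (grid_coord n al be Q)) P <-> peel U (grid_coord n al be P).
Proof.
  intros Hn. unfold peel.
  enough (E : extreme (conv (fun Q => U (grid_coord n al be Q))) P
              <-> extreme (conv U) (grid_coord n al be P)) by (rewrite E; reflexivity).
  unfold extreme. rewrite conv_rescale by assumption. split; intros [H1 H2]; split; auto.
  - intros Q1 Q2 l C1 C2 Hl E.
    rewrite <- (grid_coord_point n al be Q1 Hn), <- (grid_coord_point n al be Q2 Hn). f_equal.
    apply (H2 _ _ l); auto.
    + apply conv_rescale; [assumption|]. rewrite grid_coord_point; assumption.
    + apply conv_rescale; [assumption|]. rewrite grid_coord_point; assumption.
    + rewrite <- grid_point_comb, <- E, grid_point_coord; auto.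
  - intros Q1 Q2 l C1 C2 Hl E.
    rewrite <- (grid_point_coord n al be Q1 Hn), <- (grid_point_coord n al be Q2 Hn). f_equal.
    apply (H2 _ _ l); auto.
    + apply conv_rescale in C1; assumption.
    + apply conv_rescale in C2; assumption.
    + rewrite E. apply grid_coord_comb.
Qed.

Lemma peel_iter_rescale n al be U m P : (0 < n)%nat ->
  peel_iter m (fun Q => U (grid_coord n al be Q)) P <-> peel_iter m U (grid_coord n al be P).
Proof.
  intros Hn. revert P; induction m as [|m IH]; intros P; [reflexivity|].
  change (peel_iter (S m) U (grid_coord n al be P)) with (peel (peel_iter m U) (grid_coord n al be P)).
  rewrite <- (peel_rescale n al be (peel_iter m U) P Hn).
  split; apply peel_mono; intros Q; apply IH.
Qed.

Lemma lower_boundary_between U x lo hi y0 :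
  conv U (x, y0) -> y0 <= hi -> (forall y, conv U (x, y) -> lo <= y) ->
  exists g, lower_boundary U x = Finite g /\ lo <= g <= hi.
Proof.
  intros H0 Hhi Hlo.
  destruct (Glb_Rbar_correct (fun y => conv U (x, y))) as [A B].
  fold (lower_boundary U x) in *.
  specialize (A y0 H0). specialize (B (Finite lo) Hlo).
  destruct (lower_boundary U x) as [g| |]; simpl in *; try contradiction.
  exists g. split; [reflexivity|lra].
Qed.

Lemma halfplane_below (al be ga : R) : convex_set (fun P => al + be * fst P + ga <= snd P).
Proof.
  intros P Q l HP HQ Hl. unfold comb; simpl in *.
  replace (al + be * (l * fst P + (1 - l) * fst Q) + ga)
    with (l * (al + be * fst P + ga) + (1 - l) * (al + be * fst Q + ga)) by ring.
  nra.
Qed.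

Lemma shape_expand n X0 X : 0 < period n ->
  shape n X = shape n X0 + (X0 + shape_b n) / period n * (X - X0) + (X - X0) ^ 2 / (2 * period n).
Proof. intros H. unfold shape. field. lra. Qed.

Lemma hull_lower t m x y : (1 <= t)%Z -> (t mod 2 = 1)%Z ->
  conv (level t m) (x, y) ->
  shape (Z.to_nat t) x + INR m / INR (Z.to_nat t) - shape_error (Z.to_nat t) <= y.
Proof.
  intros H1 H2 HC. set (n := Z.to_nat t).
  destruct (period_bounds n ltac:(unfold n; lia)) as [P _].
  (* The half plane above the tangent of [shape] at [x], suitably shifted, contains the level set,
     so the bound extends from lattice points to the hull. *)
  set (d := (x + shape_b n) / period n).
  pose proof (HC _ (halfplane_below (shape n x - d * x) d (INR m / INR n - shape_error n))) as G.
  cbv beta in G. simpl fst in G; simpl snd in G.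
  enough (shape n x - d * x + d * x + (INR m / INR n - shape_error n) <= y) by lra.
  apply G. intros Q (X & Y & EX & EY & HA). rewrite EX, EY.
  pose proof (above_shape _ t m X Y inv_weights_exist H1 H2 HA) as B. fold n in B.
  rewrite (shape_expand n x (IZR X) P) in B. fold d in B.
  assert (0 <= (IZR X - x) ^ 2 / (2 * period n))
    by (apply Rdiv_le_0_compat; [apply pow2_ge_0|lra]).
  lra.
Qed.

Lemma ceil_exists z : exists i, z <= IZR i <= z + 1.
Proof.
  destruct (floor_exists z) as (i & Hi). exists (i + 1)%Z. rewrite plus_IZR. lra.
Qed.

(** Interpolation between lattice points at the two integers around [x]: one unit pays for rounding
    the ordinates up, another for the chord of a parabola of curvature at most 1. *)
Lemma hull_upper t m x : (1 <= t)%Z -> (t mod 2 = 1)%Z -> 1 <= period (Z.to_nat t) ->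
  exists y, conv (level t m) (x, y) /\
    y <= shape (Z.to_nat t) x + INR m / INR (Z.to_nat t) + shape_error (Z.to_nat t) + 2.
Proof.
  intros H1 H2 P. set (n := Z.to_nat t) in *.
  destruct (floor_exists x) as (i & Hi).
  assert (G : forall X, exists Y, level t m (IZR X, IZR Y) /\
            IZR Y <= shape n (IZR X) + INR m / INR n + shape_error n + 1).
  { intros X.
    destruct (ceil_exists (shape n (IZR X) + INR m / INR n + shape_error n)) as (Y & HY).
    exists Y. split; [|lra]. exists X, Y. split; [reflexivity|]. split; [reflexivity|].
    apply (shape_above _ t m X Y inv_weights_exist H1 H2). fold n. lra. }
  destruct (G i) as (Y0 & L0 & B0). destruct (G (i + 1)%Z) as (Y1 & L1 & B1).
  set (th := x - IZR i).
  exists ((1 - th) * IZR Y0 + (1 - (1 - th)) * IZR Y1). split.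
  - replace (x, (1 - th) * IZR Y0 + (1 - (1 - th)) * IZR Y1)
      with (comb (1 - th) (IZR i, IZR Y0) (IZR (i + 1), IZR Y1)).
    + apply conv_convex; [apply conv_incl; exact L0 | apply conv_incl; exact L1 | unfold th; lra].
    + unfold comb; simpl. rewrite plus_IZR. f_equal. unfold th; ring.
  - rewrite plus_IZR in B1.
    rewrite (shape_expand n x (IZR i)) in B0 by lra.
    rewrite (shape_expand n x (IZR i + 1)) in B1 by lra.
    set (d := (x + shape_b n) / period n) in *.
    set (A := shape n x + INR m / INR n + shape_error n + 1) in *.
    replace (IZR i - x) with (- th) in B0 by (unfold th; ring).
    replace (IZR i + 1 - x) with (1 - th) in B1 by (unfold th; ring).
    assert (T : 0 <= th <= 1) by (unfold th; lra).
    assert (Q : forall u, 0 <= u <= 1 -> u ^ 2 / (2 * period n) <= u ^ 2 / 2).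
    { intros u Hu. unfold Rdiv. apply Rmult_le_compat_l; [apply pow2_ge_0|].
      apply Rinv_le_contravar; lra. }
    pose proof (Q th T) as Q0. pose proof (Q (1 - th) ltac:(lra)) as Q1.
    replace ((- th) ^ 2) with (th ^ 2) in B0 by ring.
    assert (C0 : IZR Y0 <= A - d * th + th ^ 2 / 2) by (unfold A; lra).
    assert (C1 : IZR Y1 <= A + d * (1 - th) + (1 - th) ^ 2 / 2) by (unfold A; lra).
    apply Rle_trans with ((1 - th) * (A - d * th + th ^ 2 / 2)
                          + (1 - (1 - th)) * (A + d * (1 - th) + (1 - th) ^ 2 / 2)).
    + apply Rplus_le_compat; apply Rmult_le_compat_l; lra.
    + replace ((1 - th) * (A - d * th + th ^ 2 / 2)
               + (1 - (1 - th)) * (A + d * (1 - th) + (1 - th) ^ 2 / 2))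
        with (A + th * (1 - th) / 2) by field.
      assert (th * (1 - th) <= 1) by nra. unfold A. lra.
Qed.

Lemma parab_expand a b c n X0 X : (0 < n)%nat ->
  INR n * parab a b c (X / INR n) = INR n * parab a b c (X0 / INR n)
    + (a * X0 / INR n + b) * (X - X0) + a / INR n * (X - X0) ^ 2 / 2.
Proof. intros H. apply lt_0_INR in H. unfold parab. field. lra. Qed.

(** The minimum is -del^2/(2 eta). With [eta] a curvature gap and [del] a slope mismatch, two nearly
    touching parabolas cross by at most one grid unit. *)
Lemma quadratic_lower eta del u : 0 < eta -> del ^ 2 <= 2 * eta ->
  -1 <= del * u + eta * u ^ 2 / 2.
Proof.
  intros He Hd.
  assert (0 <= (eta * u + del) ^ 2) by apply pow2_ge_0.
  apply (Rmult_le_reg_l (2 * eta)); [lra|].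
  replace (2 * eta * (del * u + eta * u ^ 2 / 2)) with ((eta * u + del) ^ 2 - del ^ 2) by field.
  lra.
Qed.

Lemma peel_upper a b c n t m x :
  0 < a -> (0 < n)%nat -> (1 <= t)%Z -> (t mod 2 = 1)%Z ->
  let N := Z.to_nat t in let H := period N in
  1 <= H -> INR n / a / 2 <= H <= INR n / a - 1 ->
  exists y, conv (peel_iter m (grid_above n (parab a b c))) (x, y) /\
    INR n * y <= INR n * parab a b c x + INR m / INR N + 2 * shape_error N + 4.
Proof.
  intros Ha Hn H1 H2 N H HH HB.
  pose proof (lt_0_INR n Hn) as Pn.
  set (nu := INR n / a) in *.
  assert (Ean : a / INR n = / nu) by (unfold nu; field; lra).
  assert (Pnu : 0 < nu) by (apply Rdiv_lt_0_compat; lra).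
  set (X0 := INR n * x). set (s0 := a * X0 / INR n + b).
  (* This horizontal shift matches the slopes at [X0] up to 1/H. The vertical shift [be] then leaves
     room for the shape error plus the one unit granted by [quadratic_lower]. *)
  destruct (floor_exists (X0 + shape_b N - H * s0)) as (al & Hal).
  destruct (ceil_exists (INR n * parab a b c x + shape_error N + 1 - shape N (X0 - IZR al)))
    as (be & Hbe).
  set (D := shape N (X0 - IZR al) + IZR be - INR n * parab a b c x) in *.
  assert (HD : shape_error N + 1 <= D <= shape_error N + 2) by (unfold D; lra).
  assert (EX0 : X0 / INR n = x) by (unfold X0; field; lra).
  set (eta := / H - / nu).
  (* The curvature gap is (nu - H)/(H nu) >= 1/(H nu), and nu <= 2H: the two bounds on [H] are
     exactly what absorbs a slope mismatch of 1/H. *)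
  assert (Heta : / H ^ 2 <= 2 * eta).
  { unfold eta. apply (Rmult_le_reg_r (H ^ 2 * nu)); [apply Rmult_lt_0_compat; [apply pow_lt|]; lra|].
    replace (/ H ^ 2 * (H ^ 2 * nu)) with nu by (field; lra).
    replace (2 * (/ H - / nu) * (H ^ 2 * nu)) with (2 * H * (nu - H)) by (field; lra).
    nra. }
  assert (Peta : 0 < eta).
  { assert (0 < / H ^ 2) by (apply Rinv_0_lt_compat, pow_lt; lra). lra. }
  set (del := (X0 - IZR al + shape_b N) / H - s0).
  assert (Hdel : del ^ 2 <= 2 * eta).
  { eapply Rle_trans; [|exact Heta].
    assert (E : del = (X0 + shape_b N - H * s0 - IZR al) * / H) by (unfold del; field; lra).
    rewrite E, Rpow_mult_distr, pow_inv.
    rewrite <- (Rmult_1_l (/ H ^ 2)) at 2.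
    apply Rmult_le_compat_r; [left; apply Rinv_0_lt_compat, pow_lt; lra|]. nra. }
  assert (INCL : forall Q, level t 0 (grid_coord n al be Q) -> grid_above n (parab a b c) Q).
  { intros Q (X & Y & EX & EY & HA). unfold grid_coord in EX, EY; simpl in EX, EY.
    assert (EQ1 : fst Q = IZR (X + al) / INR n) by (rewrite plus_IZR, <- EX; field; lra).
    assert (EQ2 : snd Q = IZR (Y + be) / INR n) by (rewrite plus_IZR, <- EY; field; lra).
    split; [exists (X + al)%Z, (Y + be)%Z; auto|].
    rewrite EQ1, EQ2. apply Rle_div_r; [assumption|]. rewrite Rmult_comm.
    rewrite (parab_expand a b c n X0) by assumption. rewrite EX0, Ean. fold s0.
    pose proof (above_shape _ t 0 X Y inv_weights_exist H1 H2 HA) as B. fold N in B.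
    change (INR 0) with 0 in B. unfold Rdiv in B at 1. rewrite Rmult_0_l in B.
    rewrite (shape_expand N (X0 - IZR al)) in B by (fold H; lra). fold H in B.
    set (u := IZR (X + al) - X0).
    replace (IZR X - (X0 - IZR al)) with u in B by (unfold u; rewrite plus_IZR; ring).
    pose proof (quadratic_lower eta del u Peta Hdel) as QL.
    rewrite (plus_IZR Y be).
    assert (I : del * u + eta * u ^ 2 / 2 = (X0 - IZR al + shape_b N) / H * u + u ^ 2 / (2 * H)
                 - (s0 * u + / nu * u ^ 2 / 2)) by (unfold del, eta; field; lra).
    unfold D in HD. lra. }
  destruct (hull_upper t m (X0 - IZR al) H1 H2 HH) as (Y & CY & BY). fold N in BY.
  exists ((Y + IZR be) / INR n). split.
  - apply (conv_mono (peel_iter m (fun Q => level t 0 (grid_coord n al be Q)))).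
    { apply peel_iter_mono. exact INCL. }
    apply (conv_mono (fun Q => level t m (grid_coord n al be Q))).
    { intros Q HQ. apply peel_iter_rescale; [assumption|]. apply peel_iter_level; assumption. }
    apply conv_rescale; [assumption|]. unfold grid_coord; simpl.
    replace (INR n * x - IZR al, INR n * ((Y + IZR be) / INR n) - IZR be)
      with (X0 - IZR al, Y) by (unfold X0; f_equal; field; lra).
    exact CY.
  - replace (INR n * ((Y + IZR be) / INR n)) with (Y + IZR be) by (field; lra).
    unfold D in HD. lra.
Qed.

(** The comparison with reversed inclusion: the flatter polygon, placed just below the parabola at
    [x], contains all its grid points. *)
Lemma peel_lower a b c n t m x y :
  0 < a -> (0 < n)%nat -> (1 <= t)%Z -> (t mod 2 = 1)%Z ->
  let N := Z.to_nat t in let H := period N in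
  1 <= INR n / a -> INR n / a + 1 <= H ->
  conv (peel_iter m (grid_above n (parab a b c))) (x, y) ->
  INR n * parab a b c x + INR m / INR N - 2 * shape_error N - 4 <= INR n * y.
Proof.
  intros Ha Hn H1 H2 N H HH HB HC.
  pose proof (lt_0_INR n Hn) as Pn.
  set (nu := INR n / a) in *.
  assert (Ean : a / INR n = / nu) by (unfold nu; field; lra).
  set (X0 := INR n * x). set (s0 := a * X0 / INR n + b).
  destruct (floor_exists (X0 + shape_b N - H * s0)) as (al & Hal).
  destruct (floor_exists (INR n * parab a b c x - shape_error N - 1 - shape N (X0 - IZR al)))
    as (be & Hbe).
  set (D := INR n * parab a b c x - shape N (X0 - IZR al) - IZR be) in *.
  assert (HD : shape_error N + 1 <= D <= shape_error N + 2) by (unfold D; lra).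
  assert (EX0 : X0 / INR n = x) by (unfold X0; field; lra).
  set (eta := / nu - / H).
  assert (Heta : / H ^ 2 <= 2 * eta).
  { unfold eta. apply (Rmult_le_reg_r (H ^ 2 * nu)); [apply Rmult_lt_0_compat; [apply pow_lt|]; lra|].
    replace (/ H ^ 2 * (H ^ 2 * nu)) with nu by (field; lra).
    replace (2 * (/ nu - / H) * (H ^ 2 * nu)) with (2 * H * (H - nu)) by (field; lra).
    nra. }
  assert (Peta : 0 < eta).
  { assert (0 < / H ^ 2) by (apply Rinv_0_lt_compat, pow_lt; lra). lra. }
  set (del := s0 - (X0 - IZR al + shape_b N) / H).
  assert (Hdel : del ^ 2 <= 2 * eta).
  { eapply Rle_trans; [|exact Heta].
    assert (E : del = - (X0 + shape_b N - H * s0 - IZR al) * / H) by (unfold del; field; lra).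
    rewrite E, Rpow_mult_distr, pow_inv.
    rewrite <- (Rmult_1_l (/ H ^ 2)) at 2.
    apply Rmult_le_compat_r; [left; apply Rinv_0_lt_compat, pow_lt; lra|]. nra. }
  assert (INCL : forall Q, grid_above n (parab a b c) Q -> level t 0 (grid_coord n al be Q)).
  { intros Q [(i & j & EQ1 & EQ2) HQ]. exists (i - al)%Z, (j - be)%Z.
    split; [simpl; rewrite EQ1, minus_IZR; field; lra|].
    split; [simpl; rewrite EQ2, minus_IZR; field; lra|].
    apply (shape_above _ t 0 _ _ inv_weights_exist H1 H2). fold N.
    rewrite EQ1, EQ2 in HQ. apply Rle_div_r in HQ; [|assumption]. rewrite Rmult_comm in HQ.
    rewrite (parab_expand a b c n X0) in HQ by assumption. rewrite EX0, Ean in HQ. fold s0 in HQ.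
    change (INR 0) with 0. unfold Rdiv at 1. rewrite Rmult_0_l.
    rewrite !minus_IZR.
    rewrite (shape_expand N (X0 - IZR al)) by (fold H; lra). fold H.
    set (u := IZR i - X0) in *.
    replace (IZR i - IZR al - (X0 - IZR al)) with u by (unfold u; ring).
    pose proof (quadratic_lower eta del u Peta Hdel) as QL.
    assert (I : del * u + eta * u ^ 2 / 2 = s0 * u + / nu * u ^ 2 / 2
       - ((X0 - IZR al + shape_b N) / H * u + u ^ 2 / (2 * H))) by (unfold del, eta; field; lra).
    unfold D in HD. lra. }
  assert (CL : conv (level t m) (grid_coord n al be (x, y))).
  { apply conv_rescale; [assumption|].
    apply (conv_mono (peel_iter m (fun Q => level t 0 (grid_coord n al be Q)))).
    { intros Q HQ. apply peel_iter_rescale in HQ; [|assumption].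
      apply peel_iter_level in HQ; assumption. }
    eapply conv_mono; [|exact HC]. apply peel_iter_mono. exact INCL. }
  unfold grid_coord in CL; simpl in CL. fold X0 in CL.
  pose proof (hull_lower t m _ _ H1 H2 CL) as B. fold N in B.
  unfold D in HD. lra.
Qed.

(** * Choice of the polygons and conclusion *)

Lemma c_g_range : 1 <= c_g <= 2.
Proof.
  assert (Hp : 0 < c_g) by apply exp_pos.
  pose proof zeta3_range as Z. pose proof c_g_cube as E.
  pose proof PI2_3_2. pose proof PI_4.
  assert (L : 1 <= c_g ^ 3) by (rewrite E; apply Rle_div_r; nra).
  assert (U : c_g ^ 3 <= 8) by (rewrite E; apply Rle_div_l; nra).
  split; apply Rnot_lt_le; intros C.
  - assert (c_g ^ 2 < 1) by nra. nra.
  - assert (4 < c_g ^ 2) by nra. nra.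
Qed.

Lemma odd_between z : 3 <= z -> exists t, (1 <= t)%Z /\ (t mod 2 = 1)%Z /\ z - 2 <= IZR t <= z.
Proof.
  intros Hz. destruct (floor_exists ((z - 1) / 2)) as (i & Hi).
  exists (2 * i + 1)%Z.
  assert (0 < i)%Z by (apply lt_IZR; lra).
  split; [lia|]. split.
  - rewrite Z.add_comm, Z.mul_comm, Z.mod_add by lia. reflexivity.
  - rewrite plus_IZR, mult_IZR. lra.
Qed.

Lemma ln_le_sqrt L : 1 <= L -> ln L <= 2 * sqrt L.
Proof.
  intros HL. assert (Ps : 0 < sqrt L) by (apply sqrt_lt_R0; lra).
  rewrite <- (sqrt_sqrt L) at 1 by lra. rewrite ln_mult by assumption.
  pose proof (exp_ineq1_le (ln (sqrt L))) as E. rewrite exp_ln in E by assumption. lra.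
Qed.

(** From N^2 <= 9 L^2 and [harm N <= 2 * l]: 54 = 3 * 9 * 2, and 45 = 18 + 27, where 27 bounds 3N
    through N <= N^2. *)
Lemma period_window N L l : (1 <= N)%nat -> 1 <= l -> INR N <= 3 * L -> ln (INR N) <= l ->
  Rabs (period N - (INR N / c_g) ^ 3) <= 54 * (L ^ 2 * l) /\
  0 <= shape_error N <= 45 * (L ^ 2 * l).
Proof.
  intros HN Hl H1 H2.
  assert (PN : 1 <= INR N) by (apply le_INR in HN; exact HN).
  pose proof (harm_le_ln N HN) as B. pose proof (harm_ge_1 N HN) as B1.
  assert (B2 : harm N <= 2 * l) by lra.
  assert (SQ : INR N ^ 2 <= 9 * L ^ 2).
  { replace (9 * L ^ 2) with ((3 * L) ^ 2) by ring. apply pow_incr; lra. }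
  assert (SQ0 : 0 <= INR N ^ 2) by apply pow2_ge_0.
  assert (SH : INR N ^ 2 * harm N <= 9 * L ^ 2 * (2 * l)) by (apply Rmult_le_compat; lra).
  pose proof c_g_range as C.
  split.
  - pose proof (period_asymptotics _ N inv_weights_exist HN) as A.
    replace ((INR N / c_g) ^ 3) with (INR N ^ 3 / c_g ^ 3) by (field; lra). lra.
  - unfold shape_error. replace (INR N * INR N) with (INR N ^ 2) by ring.
    assert (0 <= INR N ^ 2 * harm N) by (apply Rmult_le_pos; lra).
    split; [lra|].
    assert (INR N <= INR N ^ 2) by nra.
    assert (L ^ 2 * 1 <= L ^ 2 * l) by (apply Rmult_le_compat_l; [apply pow2_ge_0 | lra]).
    lra.
Qed.

(* [L] is the cube root of the inverse curvature [nu = n / a] in grid units, and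
   [t] is moved off [c_g L] just far enough to absorb the error of the asymptotics. *)
Lemma choose_steeper L l : 500 * l <= L -> 1 <= l -> ln (3 * L) <= l ->
  exists t, (1 <= t)%Z /\ (t mod 2 = 1)%Z /\
    L ^ 3 / 2 <= period (Z.to_nat t) <= L ^ 3 - 1 /\
    c_g * L - 52 * l <= INR (Z.to_nat t) <= c_g * L /\
    0 <= shape_error (Z.to_nat t) <= 45 * (L ^ 2 * l).
Proof.
  intros HL Hl Hln. pose proof c_g_range as C.
  (* After division by c_g <= 2 the shift is at least 25 l and lowers the cube by about 75 L^2 l,
     more than the error 54 L^2 l. Rounding to an odd number costs at most 2 <= 2l, hence 52. *)
  destruct (odd_between (c_g * L - 50 * l)) as (t & T1 & T2 & T3); [nra|].
  exists t. split; [exact T1|]. split; [exact T2|].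
  assert (EN : INR (Z.to_nat t) = IZR t) by (rewrite INR_IZR_INZ, Z2Nat.id by lia; reflexivity).
  set (N := Z.to_nat t) in *.
  assert (HN : (1 <= N)%nat) by (unfold N; lia).
  assert (PN : 1 <= INR N) by (apply le_INR in HN; exact HN).
  rewrite <- EN in T3.
  assert (N3 : INR N <= 3 * L) by nra.
  destruct (period_window N L l HN Hl N3) as [A B].
  { eapply Rle_trans; [|exact Hln]. apply ln_le; lra. }
  split; [|split; [lra|exact B]].
  apply Rabs_le_between in A.
  set (r := INR N / c_g) in *.
  assert (R1 : r <= L - 25 * l).
  { unfold r. apply Rle_div_l; [lra|]. nra. }
  assert (R2 : L - 52 * l <= r).
  { unfold r. apply Rle_div_r; [lra|]. nra. }
  assert (U : r ^ 3 <= L ^ 3 - 69 * (L ^ 2 * l)).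
  { apply Rle_trans with ((L - 25 * l) ^ 3); [apply pow_incr; split; lra|].
    replace ((L - 25 * l) ^ 3) with (L ^ 3 - 75 * l * L ^ 2 + 1875 * l ^ 2 * L - 15625 * l ^ 3) by ring.
    assert (0 <= l ^ 3) by (apply pow_le; lra).
    assert (500 * l ^ 2 * L <= l * L ^ 2) by nra. nra. }
  assert (W : L ^ 3 - 156 * (L ^ 2 * l) <= r ^ 3).
  { apply Rle_trans with ((L - 52 * l) ^ 3); [|apply pow_incr; split; lra].
    replace ((L - 52 * l) ^ 3) with (L ^ 3 - 156 * l * L ^ 2 + 8112 * l ^ 2 * L - 140608 * l ^ 3) by ring.
    assert (500 * l ^ 3 <= l ^ 2 * L) by nra.
    assert (0 <= l ^ 3) by (apply pow_le; lra). nra. }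
  assert (LL : 1 <= L ^ 2 * l) by nra.
  assert (L3 : 500 * (L ^ 2 * l) <= L ^ 3) by nra.
  lra.
Qed.

Lemma choose_flatter L l : 500 * l <= L -> 1 <= l -> ln (3 * L) <= l ->
  exists t, (1 <= t)%Z /\ (t mod 2 = 1)%Z /\
    L ^ 3 + 1 <= period (Z.to_nat t) /\
    c_g * L <= INR (Z.to_nat t) <= c_g * L + 52 * l /\
    0 <= shape_error (Z.to_nat t) <= 45 * (L ^ 2 * l).
Proof.
  intros HL Hl Hln. pose proof c_g_range as C.
  (* The extra 2 compensates rounding down to an odd number. *)
  destruct (odd_between (c_g * L + 50 * l + 2)) as (t & T1 & T2 & T3); [nra|].
  exists t. split; [exact T1|]. split; [exact T2|].
  assert (EN : INR (Z.to_nat t) = IZR t) by (rewrite INR_IZR_INZ, Z2Nat.id by lia; reflexivity).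
  set (N := Z.to_nat t) in *.
  assert (HN : (1 <= N)%nat) by (unfold N; lia).
  assert (PN : 1 <= INR N) by (apply le_INR in HN; exact HN).
  rewrite <- EN in T3.
  assert (N3 : INR N <= 3 * L) by nra.
  destruct (period_window N L l HN Hl N3) as [A B].
  { eapply Rle_trans; [|exact Hln]. apply ln_le; lra. }
  split; [|split; [lra|exact B]].
  apply Rabs_le_between in A.
  set (r := INR N / c_g) in *.
  assert (R1 : L + 25 * l <= r).
  { unfold r. apply Rle_div_r; [lra|]. nra. }
  assert (W : L ^ 3 + 75 * (L ^ 2 * l) <= r ^ 3).
  { apply Rle_trans with ((L + 25 * l) ^ 3); [|apply pow_incr; split; lra].
    replace ((L + 25 * l) ^ 3) with (L ^ 3 + 75 * (L ^ 2 * l) + 1875 * l ^ 2 * L + 15625 * l ^ 3) by ring.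
    assert (0 <= l ^ 3) by (apply pow_le; lra). nra. }
  assert (LL : 1 <= L ^ 2 * l) by nra.
  lra.
Qed.

(** The threshold is 3000^2: ln L <= 2 sqrt L gives 500 * 3 ln L <= 3000 sqrt L <= L. *)
Lemma large_enough L l : 9000000 <= L -> l = 3 * ln L ->
  500 * l <= L /\ 1 <= l /\ ln (3 * L) <= l.
Proof.
  intros HL ->.
  assert (S : 3000 <= sqrt L).
  { rewrite <- (sqrt_pow2 3000) by lra. apply sqrt_le_1; lra. }
  assert (S2 : sqrt L * sqrt L = L) by (apply sqrt_sqrt; lra).
  pose proof (ln_le_sqrt L ltac:(lra)) as B.
  assert (L1 : 1 <= ln L).
  { rewrite <- (ln_exp 1) at 1. apply ln_le; [apply exp_pos|]. pose proof exp_le_3. lra. }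
  split; [nra|]. split; [lra|].
  rewrite ln_mult by lra.
  assert (ln 3 <= ln L) by (apply ln_le; lra). lra.
Qed.

Lemma Rpower_third_pow x y (k : nat) : 0 < x -> y = INR k / 3 -> Rpower x y = Rpower x (1 / 3) ^ k.
Proof.
  intros Hx ->. rewrite <- Rpower_pow by apply exp_pos. rewrite Rpower_mult. f_equal. field.
Qed.

(** With A the cube root of a, the vertical velocity A has normal component A/sp, while the
    curvature is a/sp^3 = (A/sp)^3. *)
Lemma graph_acsf a b c : 0 < a ->
  is_acsf (fun t p => p) (fun t p => parab a b c p + t * Rpower a (1 / 3)).
Proof.
  intros Ha t p _. unfold acsf_at. cbv beta zeta.
  set (A := Rpower a (1 / 3)).
  assert (PA : 0 < A) by apply exp_pos.
  assert (EA : a = A ^ 3).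
  { unfold A. rewrite <- (Rpower_third_pow a 1 3); [symmetry; apply Rpower_1; exact Ha|exact Ha|].
    simpl; field. }
  assert (D1 : forall q, Derive (fun r => r) q = 1) by (intros; apply Derive_id).
  assert (D2 : forall q, is_derive (fun r => parab a b c r + t * A) q (a * q + b)).
  { intros q. unfold parab. auto_derive; [exact I|]. field. }
  assert (D2' : forall q, Derive (fun r => parab a b c r + t * A) q = a * q + b)
    by (intros; apply is_derive_unique, D2).
  assert (D3 : is_derive (fun s => parab a b c p + s * A) t A).
  { auto_derive; [exact I|]. ring. }
  assert (D4 : is_derive (fun q => Derive (fun r => parab a b c r + t * A) q) p a).
  { apply (is_derive_ext (fun q => a * q + b)); [intros; symmetry; apply D2'|].
    auto_derive; [exact I|]. ring. }
  assert (D5 : is_derive (fun q => Derive (fun r : R => r) q) p 0).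
  { apply (is_derive_ext (fun _ => 1)); [intros; symmetry; apply D1|].
    auto_derive; [exact I|]. ring. }
  split; [apply ex_derive_const|].
  split; [eexists; exact D3|].
  split; [intros; apply ex_derive_id|].
  split; [intros; eexists; apply D2|].
  split; [eexists; exact D5|].
  split; [eexists; exact D4|].
  apply is_derive_unique in D3, D4, D5.
  set (g1 := Derive (fun q => Derive (fun r => parab a b c r + t * A) q) p) in *.
  set (g2 := Derive (fun q : R => Derive (fun r : R => r) q) p) in *.
  change (Derive (fun s : R => parab a b c p + s * A) t = A) in D3.
  change (g1 = a) in D4. change (g2 = 0) in D5.
  rewrite D3, D4, D5, D1, D2', Derive_const.
  set (sp := sqrt (1 ^ 2 + (a * p + b) ^ 2)).
  assert (Psp : 0 < sp).
  { apply sqrt_lt_R0. pose proof (pow2_ge_0 (a * p + b)). lra. }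
  split; [exact Psp|].
  replace ((1 * a - (a * p + b) * 0) / sp ^ 3) with ((A / sp) ^ 3)
    by (rewrite EA; field; lra).
  assert (PAs : 0 < A / sp) by (apply Rdiv_lt_0_compat; assumption).
  unfold cbrt. destruct (Rlt_dec 0 ((A / sp) ^ 3)) as [_|N].
  - rewrite <- Rpower_pow by assumption. rewrite Rpower_mult.
    replace (INR 3 * (1 / 3)) with 1 by (simpl; field). rewrite Rpower_1 by assumption.
    field. lra.
  - exfalso. apply N. apply pow_lt. exact PAs.
Qed.

(** In the application S = T n^(4/3) and L is the cube root of n/a, so S/L = n T a^(1/3) is the
    predicted rise in grid units. The factor 104 = 2 * 52 comes from 1/N <= 2/L. *)
Lemma rate_upper S L N c l m : 0 <= S -> 1 <= c -> 104 * l <= L -> 1 <= l ->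
  c * L - 52 * l <= N <= c * L -> m <= c * S -> m / N <= S / L + 104 * l * (S / L ^ 2).
Proof.
  intros HS Hc HL Hl HN Hm.
  assert (LN : L / 2 <= N) by nra.
  assert (m / N <= c * S / N).
  { unfold Rdiv. apply Rmult_le_compat_r; [|exact Hm]. left; apply Rinv_0_lt_compat; lra. }
  replace (c * S / N) with (S / L + S * (c * L - N) * (/ L * / N)) in H by (field; lra).
  assert (IN : / N <= 2 * / L).
  { replace (2 * / L) with (/ (L / 2)) by (field; lra). apply Rinv_le_contravar; lra. }
  assert (PL : 0 < / L) by (apply Rinv_0_lt_compat; lra).
  assert (PN : 0 < / N) by (apply Rinv_0_lt_compat; lra).
  assert (S * (c * L - N) * (/ L * / N) <= S * (52 * l) * (/ L * (2 * / L))).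
  { apply Rmult_le_compat; try nra. }
  replace (104 * l * (S / L ^ 2)) with (S * (52 * l) * (/ L * (2 * / L))) by (field; lra).
  lra.
Qed.

(** The final -1 pays for the floor in the number of steps. *)
Lemma rate_lower S L N c l m : 0 <= S -> 1 <= c -> 1 <= L -> 1 <= l ->
  c * L <= N <= c * L + 52 * l -> c * S - 1 <= m -> S / L - 52 * l * (S / L ^ 2) - 1 <= m / N.
Proof.
  intros HS Hc HL Hl HN Hm.
  assert (LN : L <= N) by nra.
  assert (PL : 0 < / L) by (apply Rinv_0_lt_compat; lra).
  assert (PN : 0 < / N) by (apply Rinv_0_lt_compat; lra).
  assert (IN : / N <= / L) by (apply Rinv_le_contravar; lra).
  assert (I1 : / N <= 1) by (rewrite <- Rinv_1; apply Rinv_le_contravar; lra).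
  assert ((c * S - 1) / N <= m / N).
  { unfold Rdiv. apply Rmult_le_compat_r; lra. }
  replace ((c * S - 1) / N) with (S / L - S * (N - c * L) * (/ L * / N) - / N) in H by (field; lra).
  assert (S * (N - c * L) * (/ L * / N) <= S * (52 * l) * (/ L * / L)).
  { apply Rmult_le_compat; try nra. }
  replace (52 * l * (S / L ^ 2)) with (S * (52 * l) * (/ L * / L)) by (field; lra).
  lra.
Qed.

Lemma peel_parabola_bound a b c T n x : 0 < a -> 0 < T -> (0 < n)%nat ->
  a * 9000000 ^ 3 <= INR n ->
  exists g, lower_boundary (peel_iter (nsteps T n) (grid_above n (parab a b c))) x = Finite g /\
    Rabs (g - (parab a b c x + T * Rpower a (1 / 3)))
    <= 112 * (T * Rpower a (2 / 3) + Rpower a (- (2 / 3))) * ln (INR n / a) / Rpower (INR n) (1 / 3).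
Proof.
  intros Ha HT Hn Hbig.
  pose proof (lt_0_INR n Hn) as Pn.
  set (A := Rpower a (1 / 3)). set (P := Rpower (INR n) (1 / 3)).
  assert (PA : 0 < A) by apply exp_pos. assert (PP : 0 < P) by apply exp_pos.
  assert (EA : a = A ^ 3).
  { unfold A. rewrite <- (Rpower_third_pow a 1 3); [symmetry; apply Rpower_1; exact Ha|exact Ha|].
    simpl; field. }
  assert (EP : INR n = P ^ 3).
  { unfold P. rewrite <- (Rpower_third_pow (INR n) 1 3); [symmetry; apply Rpower_1; exact Pn|exact Pn|].
    simpl; field. }
  assert (EA2 : Rpower a (2 / 3) = A ^ 2) by (apply Rpower_third_pow; [exact Ha|simpl; field]).
  assert (EAm : Rpower a (- (2 / 3)) = / A ^ 2) by (rewrite Rpower_Ropp, EA2; reflexivity).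
  assert (EP4 : Rpower (INR n) (4 / 3) = P ^ 4) by (apply Rpower_third_pow; [exact Pn|simpl; field]).
  set (L := P / A).
  assert (PL : 0 < L) by (apply Rdiv_lt_0_compat; assumption).
  assert (EL : INR n / a = L ^ 3) by (rewrite EP, EA; unfold L; field; lra).
  set (l := ln (INR n / a)).
  assert (El : l = 3 * ln L).
  { unfold l. rewrite EL. rewrite ln_pow by exact PL. simpl; ring. }
  assert (BL : 9000000 <= L).
  { apply Rnot_lt_le. intros C.
    assert (E : 9000000 ^ 3 <= L ^ 3).
    { rewrite <- EL. apply (proj1 (Rle_div_r (9000000 ^ 3) (INR n) a Ha)). rewrite Rmult_comm. exact Hbig. }
    assert (L * L < 9000000 * 9000000) by (apply Rmult_gt_0_lt_compat; lra).
    assert (L * (L * L) < 9000000 * (9000000 * 9000000)) by (apply Rmult_gt_0_lt_compat; nra).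
    simpl in E. lra. }
  destruct (large_enough L l BL El) as (B1 & B2 & B3).
  pose proof c_g_range as C.
  set (S := T * P ^ 4).
  assert (PS : 0 < S) by (apply Rmult_lt_0_compat; [exact HT|apply pow_lt; exact PP]).
  assert (Hm : INR (nsteps T n) <= c_g * S /\ c_g * S - 1 <= INR (nsteps T n)).
  { unfold nsteps. rewrite EP4. rewrite (Rmult_assoc c_g). fold S.
    destruct (base_Int_part (c_g * S)) as [I1 I2].
    assert (0 <= Int_part (c_g * S))%Z.
    { assert (0 < c_g * S) by nra.
      assert (-1 < Int_part (c_g * S))%Z; [apply lt_IZR; lra|lia]. }
    rewrite INR_IZR_INZ, Z2Nat.id by assumption. lra. }
  set (m := nsteps T n) in *. destruct Hm as [Hm1 Hm2].
  destruct (choose_steeper L l B1 B2 B3) as (t1 & T1 & T1' & H1 & N1 & E1).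
  destruct (choose_flatter L l B1 B2 B3) as (t2 & T2 & T2' & H2 & N2 & E2).
  assert (L3 : 9000000 <= L ^ 3) by nra.
  destruct (peel_upper a b c n t1 m x Ha Hn T1 T1') as (y & Cy & By); [lra|rewrite EL; exact H1|].
  pose proof (rate_upper S L _ c_g l (INR m) ltac:(lra) ltac:(lra) ltac:(lra) B2 N1 Hm1) as R1.
  pose proof (rate_lower S L _ c_g l (INR m) ltac:(lra) ltac:(lra) ltac:(lra) B2 N2 Hm2) as R2.
  assert (LL : 1 <= L ^ 2 * l) by nra.
  assert (PSL : 0 <= l * (S / L ^ 2)).
  { apply Rmult_le_pos; [lra|]. apply Rdiv_le_0_compat; [lra|]. apply pow_lt; exact PL. }
  set (W := INR n * parab a b c x) in *.
  (* 112 dominates both 104, from the speed, and 2 * 45 + 4 + 1, from two shape errors and the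
     additive constants, since L^2 l >= 1. *)
  set (e := 112 * (l * (S / L ^ 2) + L ^ 2 * l)).
  destruct (lower_boundary_between (peel_iter m (grid_above n (parab a b c))) x
              ((W + S / L - e) / INR n) ((W + S / L + e) / INR n) y Cy) as (g & Eg & Bg).
  { apply Rle_div_r; [exact Pn|]. unfold e. lra. }
  { intros y' Cy'.
    pose proof (peel_lower a b c n t2 m x y' Ha Hn T2 T2' ltac:(rewrite EL; lra)
                  ltac:(rewrite EL; exact H2) Cy') as B. cbv zeta in B.
    apply Rle_div_l; [exact Pn|]. unfold e. fold W in B. lra. }
  exists g. split; [exact Eg|].
  rewrite EA2, EAm.
  replace ((W + S / L - e) / INR n) with (parab a b c x + T * A - e / INR n) in Bg
    by (unfold W, S, L; rewrite EP; field; lra).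
  replace ((W + S / L + e) / INR n) with (parab a b c x + T * A + e / INR n) in Bg
    by (unfold W, S, L; rewrite EP; field; lra).
  replace (112 * (T * A ^ 2 + / A ^ 2) * l / P) with (e / INR n)
    by (unfold e, S, L; rewrite EP; field; lra).
  apply Rabs_le. lra.
Qed.

Theorem theorem1 :
  (* (1) the vertically translating parabolas form an ACSF starting at Pi *)
  (forall a b c : R, 0 < a ->
     is_acsf (fun t p => p) (fun t p => parab a b c p + t * Rpower a (1/3))) /\
  (* (2) grid peeling approximates Pi^T, with an absolute implicit constant *)
  (exists C : R, 0 < C /\
     forall a b c T : R, 0 < a -> 0 < T ->
     exists N : nat, forall n : nat, (N <= n)%nat -> (0 < n)%nat ->
       forall x : R,
         Rbar_le
           (Rbar_abs (Rbar_minus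
              (lower_boundary (peel_iter (nsteps T n) (grid_above n (parab a b c))) x)
              (Finite (parab a b c x + T * Rpower a (1/3)))))
           (Finite (C * (T * Rpower a (2/3) + Rpower a (-(2/3)))
                      * ln (INR n / a) / Rpower (INR n) (1/3)))).
Proof.
  split; [exact graph_acsf|].
  exists 112. split; [lra|]. intros a b c T Ha HT.
  (* The threshold depends on a alone and makes the cube root of n/a at least 9000000. *)
  exists (Z.to_nat (up (a * 9000000 ^ 3))). intros n HN Hn x.
  assert (Hbig : a * 9000000 ^ 3 <= INR n).
  { destruct (archimed (a * 9000000 ^ 3)) as [A1 _].
    apply le_INR in HN. rewrite INR_IZR_INZ in HN.
    assert (0 < a * 9000000 ^ 3) by nra.
    rewrite Z2Nat.id in HN by (apply le_IZR; lra). lra. }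
  destruct (peel_parabola_bound a b c T n x Ha HT Hn Hbig) as (g & -> & B).
  exact B.
Qed.
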